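(* Let $X$ be an Oka manifold. Then $X$ is homotopically elliptic; that is, the affine singular set $eX$ is a fibrant simplicial set (a Kan complex) and the inclusion $eX\hookrightarrow sX$ into the singular set of $X$ is a weak equivalence of simplicial sets (equivalently, the inclusion $eX\hookrightarrow sX$ is the inclusion of a strong deformation retract).
   Context: **Oka manifolds.** A Stein inclusion is the inclusion $T\hookrightarrow S$ into a reduced Stein space $S$ (or a Stein manifold: the choice is immaterial) of a closed analytic subvariety $T$ ($T$ may be empty). A complex manifold $X$ has the basic Oka property with interpolation (BOPI) with respect to $T\hookrightarrow S$ if every continuous map $h:S\to X$ with $h|T$ holomorphic can be deformed to a holomorphic map $S\to X$ with $h|T$ fixed; that is, there is a continuous map $H:S\times[0,1]\to X$ with $H(\cdot,0)=h$, $H(\cdot,1)$ holomorphic, and $H(x,t)=h(x)$ for all $x\in T$ and $t\in[0,1]$. A complex manifold $X$ is Oka if it has BOPI with respect to every Stein inclusion. It is known that this is equivalent to the following: for every Stein inclusion $T\hookrightarrow\mathbb{C}^n$, $n\geq 1$, with $T$ contractible, every holomorphic map $T\to X$ extends to a holomorphic map $\mathbb{C}^n\to X$. **Simplices.** Let $\mathbf\Delta$ be the category with objects $\mathbf n=\{0,1,\dots,n\}$, $n\geq 0$, and order-preserving maps as morphisms. A simplicial set is a functor $\mathbf\Delta^{\mathrm{op}}\to\mathbf{Set}$. The standard $n$-simplex is $$T_n=\{(t_0,\dots,t_n)\in\mathbb{R}^{n+1}:t_0+\dots+t_n=1,\ t_0,\dots,t_n\geq 0\}$$ with the subspace topology,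 and the affine $n$-simplex is $$A_n=\{(t_0,\dots,t_n)\in\mathbb{C}^{n+1}:t_0+\dots+t_n=1\},$$ a complex manifold biholomorphic to $\mathbb{C}^n$. An order-preserving map $\theta:\mathbf n\to\mathbf m$ induces a continuous map $\theta_*:T_n\to T_m$ and a holomorphic map $\theta_*:A_n\to A_m$, both given by $\theta_*(t_0,\dots,t_n)=(s_0,\dots,s_m)$ with $s_i=\sum_{j\in\theta^{-1}(i)}t_j$ (an empty sum is zero). **Singular sets.** For a topological space $X$, the singular set $sX$ is the simplicial set whose $n$-simplices are the continuous maps $T_n\to X$, with structure maps given by precomposition by the maps $\theta_*$. For a complex manifold $X$, the affine singular set $eX$ is the simplicial set whose $n$-simplices are the holomorphic maps $A_n\to X$, with structure maps given by precomposition by the maps $\theta_*$. Since a holomorphic map $A_n\to X$ is determined by its restriction to $T_n\subset A_n$, restriction gives a monomorphism (cofibration) of simplicial sets $eX\hookrightarrow sX$, referred to as the inclusion. **Homotopical ellipticity.** For a complex manifold $X$ the following two conditions are equivalent: (a) $eX$ is fibrant (a Kan complex) and the cofibration $eX\hookrightarrow sX$ is a weak equivalence of simplicial sets; (b) the cofibration $eX\hookrightarrow sX$ is the inclusion of a strong deformation retract. $X$ is called homotopically elliptic if these conditions are satisfied. *)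

(* Defs.v *)
From HB Require Import structures.
From mathcomp Require Import all_boot all_order all_algebra.
From mathcomp Require Import complex.
From mathcomp Require Import all_classical all_reals all_analysis.
From Stdlib Require Import Relations.Relation_Operators.

Set Implicit Arguments.
Unset Strict Implicit.
Unset Printing Implicit Defensive.

Import Order.TTheory GRing.Theory Num.Theory numFieldNormedType.Exports.

Local Open Scope classical_set_scope.
Local Open Scope ring_scope.

(* The topology and norm of MathComp-Analysis are inferred on
   numClosedFieldTypes, but not on [complex R] itself. *)
Definition Cplx (R : realType) : numClosedFieldType := R[i].

(* Holomorphy in charts is complex (Frechet) differentiability over the field
   [Cplx R] at every point of an open set.  Chart maps are total functions of
   which only the restriction to [mdom c], resp. to its image, is meaningful.
   Charts may have different dimensions, so that a manifold need be neither
   connected nor pure-dimensional. *)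
Record complexManifold (R : realType) := ComplexManifold {
  mspace :> topologicalType;
  mhausdorff : hausdorff_space mspace;
  msecond_countable : @second_countable mspace;
  mchart : Type;
  mdim : mchart -> nat;
  mdom : mchart -> set mspace;
  mmap : forall c, mspace -> 'rV[Cplx R]_(mdim c);
  minv : forall c, 'rV[Cplx R]_(mdim c) -> mspace;
  mdom_open : forall c, open (mdom c);
  mrange_open : forall c, open (mmap c @` mdom c);
  mcover : forall x, exists c, mdom c x;
  mmapK : forall c x, mdom c x -> minv (mmap c x) = x;
  mmap_continuous : forall c x, mdom c x -> {for x, continuous (mmap c)};
  minv_continuous : forall c x, mdom c x ->
    {for mmap c x, continuous (@minv c)};
  mtransition : forall c c' x, mdom c x -> mdom c' x ->
    differentiable (mmap c' \o @minv c) (mmap c x)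
}.
Arguments mdom {R M} c : rename.
Arguments mmap {R M} c _ : rename.
Arguments minv {R M} c _ : rename.
Arguments mdim {R M} c : rename.

Section Holomorphic.
Variable R : realType.
Implicit Types M N S X : complexManifold R.

(* Only meaningful when required at all points of an open set. *)
Definition differentiable_map_at M N (f : M -> N) (x : M) : Prop :=
  {for x, continuous f} /\
  forall (c : mchart M) (c' : mchart N), mdom c x -> mdom c' (f x) ->
    differentiable (mmap c' \o f \o minv c) (mmap c x).

Definition holomorphic_on M N (U : set M) (f : M -> N) : Prop :=
  forall x, U x -> differentiable_map_at f x.

Definition holomorphic M N (f : M -> N) : Prop := holomorphic_on setT f.

Record holoMap M N := HoloMap {
  holo_fun :> M -> N;
  holo_funP : holomorphic holo_fun
}.

Definition holomorphic_fun_on M (U : set M) (f : M -> Cplx R) : Prop :=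
  forall x, U x -> forall c : mchart M, mdom c x ->
    differentiable (f \o minv c : 'rV[Cplx R]_(mdim c) -> Cplx R) (mmap c x).

(* The points where |f| <= sup_K |f| for every holomorphic f; [b] ranges over
   the upper bounds of |f| on K. *)
Definition holomorphic_hull M (K : set M) : set M :=
  [set x | forall f : M -> Cplx R, holomorphic_fun_on setT f ->
     forall b : Cplx R, (forall y, K y -> `|f y| <= b) -> `|f x| <= b].

Definition holomorphically_convex M : Prop :=
  forall K : set M, compact K -> compact (holomorphic_hull K).

Definition holomorphically_separable M : Prop :=
  forall x y : M, x <> y ->
    exists2 f : M -> Cplx R, holomorphic_fun_on setT f & f x <> f y.

Definition stein M : Prop :=
  holomorphically_convex M /\ holomorphically_separable M.

(* As [p] ranges over the whole of [M], such a [T] is closed in [M]. *)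
Definition analytic_subvariety M (T : set M) : Prop :=
  forall p : M, exists U : set M, exists k : nat, exists g : 'I_k -> M -> Cplx R,
    [/\ open U, U p, forall l, holomorphic_fun_on U (g l) &
        forall x, U x -> (T x <-> forall l, g l x = 0)].

(* Holomorphy of the restriction to a reduced subvariety: near each point of
   [T], it is the restriction of a holomorphic map of the ambient manifold. *)
Definition holomorphic_on_subvariety M N (T : set M) (h : M -> N) : Prop :=
  forall p, T p -> exists U : set M, exists g : M -> N,
    [/\ open U, U p, holomorphic_on U g & forall x, U x -> T x -> g x = h x].

(* Basic Oka property with interpolation.  A continuous map on S x [0,1] is
   given as a function on S x R continuous on the subspace S x [0,1]. *)
Definition BOPI X S (T : set S) : Prop :=
  forall h : S -> X, continuous h -> holomorphic_on_subvariety T h ->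
    exists H : S * R -> X,
      [/\ {within [set: S] `*` `[0, 1]%classic, continuous H},
          forall x, H (x, 0) = h x,
          holomorphic (fun x => H (x, 1)) &
          forall x t, T x -> `[0, 1]%classic t -> H (x, t) = h x].

Definition oka X : Prop :=
  forall (S : complexManifold R) (T : set S),
    stein S -> analytic_subvariety T -> BOPI X T.

End Holomorphic.

Notation delta m n := {omorphism 'I_m.+1 -> 'I_n.+1}.

Lemma delta_eqP m n (f g : delta m n) : f =1 g -> f = g.
Proof.
case: f g => [f [[fP]]] [g [[gP]]] /= /funext fg; subst g.
by rewrite (Prop_irrelevance fP gP).
Qed.

Lemma cst_nondecreasing m n (v : 'I_n.+1) :
  {homo (cst v : 'I_m.+1 -> 'I_n.+1) : x y / (x <= y)%O}.
Proof. by []. Qed.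

HB.instance Definition _ m n (v : 'I_n.+1) :=
  Order.isOrderMorphism.Build _ 'I_m.+1 _ 'I_n.+1 (cst v)
    (@cst_nondecreasing m n v).

Record simplicialSet := SimplicialSet {
  simplices :> nat -> Type;
  sact : forall m n, delta m n -> simplices n -> simplices m;
  sact_id : forall n (x : simplices n), sact (idfun : delta n n) x = x;
  sact_comp : forall l m n (g : delta m n) (f : delta l m) (x : simplices n),
    sact (g \o f : delta l n) x = sact f (sact g x)
}.
Arguments sact {K m n} _ _ : rename.

Record simplicialMap (K L : simplicialSet) := SimplicialMap {
  smap :> forall n, K n -> L n;
  smap_natural : forall m n (th : delta m n) (x : K n),
    smap (sact th x) = sact th (smap x)
}.
Arguments smap {K L} _ {n} _.

Program Definition simplicial_prod (K L : simplicialSet) : simplicialSet :=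
  @SimplicialSet (fun n => (K n * L n)%type)
    (fun m n th x => (sact th x.1, sact th x.2)) _ _.
Next Obligation. by move=> K L n [x y]; rewrite !sact_id. Qed.
Next Obligation. by move=> K L l m n g f [x y]; rewrite !sact_comp. Qed.

Program Definition standard_simplex (n : nat) : simplicialSet :=
  @SimplicialSet (fun m => delta m n) (fun l m th x => x \o th) _ _.
Next Obligation. by move=> n m x; exact: delta_eqP. Qed.
Next Obligation. by move=> n k l m g f x; exact: delta_eqP. Qed.

(* The k-th horn of Delta[n]: the union of the faces opposite to the vertices
   j <> k, that is, the simplices omitting some vertex other than k. *)
Definition in_horn m n (k : 'I_n.+1) (x : delta m n) : Prop :=
  exists2 j : 'I_n.+1, j <> k & forall i, x i <> j.

Lemma in_horn_sact l m n (k : 'I_n.+1) (th : delta l m) (x : delta m n) :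
  in_horn k x -> in_horn k (x \o th : delta l n).
Proof. by move=> [j jk xj]; exists j => // i; exact: xj. Qed.

Program Definition horn (n : nat) (k : 'I_n.+1) : simplicialSet :=
  @SimplicialSet (fun m => {x : delta m n | in_horn k x})
    (fun l m th x => exist _ _ (in_horn_sact th (proj2_sig x))) _ _.
Next Obligation.
by move=> n k m [x xk]; apply: eq_exist; exact: delta_eqP.
Qed.
Next Obligation.
by move=> n k l m p g f [x xk]; apply: eq_exist; exact: delta_eqP.
Qed.

Definition kan (K : simplicialSet) : Prop :=
  forall (n : nat) (k : 'I_n.+2) (f : simplicialMap (horn k) K),
    exists g : simplicialMap (standard_simplex n.+1) K,
      forall m (x : horn k m), smap g (sval x) = smap f x.

(* [i] is the inclusion of a strong deformation retract: [r] retracts [L] onto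
   [K] and [H] is a simplicial homotopy from the identity of [L] to [i r],
   constant on [K]. *)
Definition strong_deformation_retract (K L : simplicialSet)
    (i : simplicialMap K L) : Prop :=
  exists (r : simplicialMap L K)
         (H : simplicialMap (simplicial_prod L (standard_simplex 1)) L),
    [/\ forall n (x : K n), smap r (smap i x) = x,
        forall n (y : L n), smap H (y, cst ord0 : delta n 1) = y,
        forall n (y : L n),
          smap H (y, cst ord_max : delta n 1) = smap i (smap r y) &
        forall n (x : K n) (s : delta n 1), smap H (smap i x, s) = smap i x].

Section Push.
Variable K : numFieldType.

Definition simplex_push m n (th : delta m n) (t : 'rV[K]_m.+1) :
    'rV[K]_n.+1 :=
  \row_i \sum_(j | th j == i) t 0 j.

Lemma simplex_push_id n (t : 'rV[K]_n.+1) :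
  simplex_push (idfun : delta n n) t = t.
Proof. by apply/rowP => i; rewrite mxE big_pred1_eq. Qed.

Lemma simplex_push_comp l m n (g : delta m n) (f : delta l m)
    (t : 'rV[K]_l.+1) :
  simplex_push (g \o f : delta l n) t = simplex_push g (simplex_push f t).
Proof.
apply/rowP => i; rewrite !mxE.
rewrite (partition_big f (fun j => g j == i)) //=; apply: eq_bigr => j gj.
rewrite mxE; apply: eq_bigl => a /=.
by case: (eqVneq (f a) j) => [->|_]; rewrite ?andbF ?andbT.
Qed.

Lemma simplex_push_sum m n (th : delta m n) (t : 'rV[K]_m.+1) :
  \sum_i simplex_push th t 0 i = \sum_j t 0 j.
Proof.
rewrite (partition_big th xpredT) //=.
by apply: eq_bigr => i _; rewrite mxE.
Qed.

Lemma simplex_push_linear m n (th : delta m n) : linear (@simplex_push m n th).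
Proof.
move=> a u v; apply/rowP => i; rewrite !mxE mulr_sumr -big_split /=.
by apply: eq_bigr => j _; rewrite !mxE.
Qed.

Lemma continuous_rV (T : topologicalType) n (f : T -> 'rV[K]_n) :
  (forall j, continuous (fun t => f t 0 j)) -> continuous f.
Proof.
move=> fc t A [P fP PA].
have : \forall s \near t, forall i j, P i j (f s i j).
  apply: (@filter_forall _ _ (fun i s => forall j, P i j (f s i j))) => i.
  apply: (@filter_forall _ _ (fun j s => P i j (f s i j))) => j.
  move: (fP i j) => Pij; rewrite (ord1 i) in Pij *.
  exact: (fc j t _ Pij).
by apply: filterS => s Ps; apply: PA => i j; exact: Ps.
Qed.

Lemma continuous_sum_fin (T : topologicalType) (I : Type) (s : seq I)
    (P : pred I) (f : I -> T -> K) :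
  (forall i, continuous (f i)) ->
  continuous (fun t => \sum_(i <- s | P i) f i t).
Proof.
move=> fc; elim: s => [|i s IH] t.
  have -> : (fun t => \sum_(i <- [::] | P i) f i t) = cst 0.
    by apply/funext => u; rewrite big_nil.
  exact: cvg_cst.
have [Pi|nPi] := boolP (P i); last first.
  have -> : (fun t => \sum_(j <- i :: s | P j) f j t) =
      fun t => \sum_(j <- s | P j) f j t; last exact: IH.
  by apply/funext => u; rewrite big_cons (negbTE nPi).
have -> : (fun t => \sum_(j <- i :: s | P j) f j t) =
    fun t => f i t + \sum_(j <- s | P j) f j t.
  by apply/funext => u; rewrite big_cons Pi.
exact: (cvgD (fc i t) (IH t)).
Qed.

Lemma linear_rV_continuous m n (f : {linear 'rV[K]_m -> 'rV[K]_n}) :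
  continuous f.
Proof.
apply: continuous_rV => j.
have -> : (fun t => f t 0 j) = fun t => \sum_i t 0 i * lin1_mx f i j.
  apply/funext => t; have := congr1 (fun M : 'rV[K]_n => M 0 j) (mul_rV_lin1 f t).
  by rewrite mxE => <-.
apply: continuous_sum_fin => i t.
have ct : (fun s : 'rV[K]_m => s 0 i) @ t --> t 0 i by exact: coord_continuous.
exact: (cvgM ct (cvg_cst (lin1_mx f i j))).
Qed.

HB.instance Definition _ m n (th : delta m n) :=
  GRing.isLinear.Build K 'rV[K]_m.+1 'rV[K]_n.+1 _ (simplex_push th)
    (simplex_push_linear th).

Lemma simplex_push_continuous m n (th : delta m n) :
  continuous (simplex_push th).
Proof. exact: linear_rV_continuous. Qed.

End Push.

Lemma hausdorff_inj (T U : topologicalType) (f : T -> U) :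
  injective f -> continuous f -> hausdorff_space U -> hausdorff_space T.
Proof.
move=> finj fc hU x y xy; apply: finj; apply: hU => A B Ax By.
have [z [Az Bz]] := xy _ _ (fc x A Ax) (fc y B By).
by exists (f z).
Qed.

Lemma second_countable_can (T U : topologicalType) (f : T -> U) (g : U -> T) :
  cancel f g -> continuous f -> continuous g ->
  @second_countable U -> @second_countable T.
Proof.
move=> fK fc gc [B cB [Bo Bb]].
exists [set f @^-1` W | W in B].
  by apply: card_le_trans (card_image_le _ _) _; exact: cB.
split=> [_ [W BW <-]|x N Nx].
  by apply: open_comp => [z _|]; [exact: fc|exact: Bo].
have [|W [BW Wfx] WN] := Bb (f x) (g @^-1` N).
  by apply: gc; rewrite fK.
exists (f @^-1` W); first by split=> //; exists W.
by move=> y Wfy; rewrite -(fK y); exact: WN.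
Qed.

Section Simplices.
Variable R : realType.

Definition std_simplex_set n : set 'rV[R]_n.+1 :=
  [set t | \sum_i t 0 i = 1 /\ forall i, 0 <= t 0 i].
Definition std_simplex n : topologicalType := set_type (@std_simplex_set n).

Definition affine_simplex_set n : set 'rV[Cplx R]_n.+1 :=
  [set t | \sum_i t 0 i = 1].
Definition affine_simplex n : topologicalType :=
  set_type (@affine_simplex_set n).

Lemma std_simplex_push_subproof m n (th : delta m n) (t : std_simplex m) :
  simplex_push th (set_val t) \in @std_simplex_set n.
Proof.
have [t1 t0] := set_valP t; apply/mem_set; split.
  by rewrite simplex_push_sum.
by move=> i; rewrite mxE sumr_ge0.
Qed.
Definition std_simplex_push m n (th : delta m n) (t : std_simplex m) :
  std_simplex n :=
  exist (fun s => s \in @std_simplex_set n) _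
     (std_simplex_push_subproof th t).

Lemma affine_simplex_push_subproof m n (th : delta m n)
    (t : affine_simplex m) :
  simplex_push th (set_val t) \in @affine_simplex_set n.
Proof.
by apply/mem_set; rewrite /affine_simplex_set /= simplex_push_sum (set_valP t).
Qed.
Definition affine_simplex_push m n (th : delta m n) (t : affine_simplex m) :
  affine_simplex n :=
  exist (fun s => s \in @affine_simplex_set n) _
     (affine_simplex_push_subproof th t).

Lemma std_simplex_push_continuous m n (th : delta m n) :
  continuous (std_simplex_push th).
Proof.
apply: continuous_comp_initial => t.
apply: (@continuous_comp _ _ _ (set_val : std_simplex m -> _) (simplex_push th)).
  exact: initial_continuous.
exact: simplex_push_continuous.
Qed.

Lemma affine_simplex_push_continuous m n (th : delta m n) :
  continuous (affine_simplex_push th).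
Proof.
apply: continuous_comp_initial => t.
apply: (@continuous_comp _ _ _ (set_val : affine_simplex m -> _) (simplex_push th)).
  exact: initial_continuous.
exact: simplex_push_continuous.
Qed.

Lemma std_to_affine_subproof n (t : std_simplex n) :
  map_mx (real_complex R) (set_val t) \in @affine_simplex_set n.
Proof.
have [t1 _] := set_valP t; apply/mem_set; rewrite /affine_simplex_set /=.
transitivity (real_complex R (\sum_i set_val t 0 i)); last by rewrite t1.
by rewrite rmorph_sum; apply: eq_bigr => i _; rewrite mxE.
Qed.
Definition std_to_affine n (t : std_simplex n) : affine_simplex n :=
  exist (fun s => s \in @affine_simplex_set n) _ (std_to_affine_subproof t).

Lemma Cplx_gt0 (e : Cplx R) : 0 < e ->
  exists2 r : R, 0 < r & e = real_complex R r.
Proof.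
case: e => r i; rewrite ltcE /= => /andP[/eqP -> r0].
by exists r.
Qed.

Lemma Cplx_norm_real (x : R) :
  `|real_complex R x : Cplx R| = real_complex R `|x|.
Proof. by rewrite [LHS]normc_def /= expr0n addr0 sqrtr_sqr. Qed.

Lemma real_complex_continuous : continuous (real_complex R : R -> Cplx R).
Proof.
move=> x; apply/cvgrPdist_lt => e /Cplx_gt0[r r0 ->].
have /cvgrPdist_lt/(_ r r0) : (id : R -> R) @ x --> x by exact: cvg_id.
by apply: filterS => y xy; rewrite -rmorphB Cplx_norm_real ltcR.
Qed.

Lemma std_to_affine_continuous n : continuous (@std_to_affine n).
Proof.
apply: continuous_comp_initial; apply: continuous_rV => j.
have -> : (fun t : std_simplex n => (set_val (std_to_affine t)) 0 j) =
    real_complex R \o (fun t : 'rV[R]_n.+1 => t 0 j) \o set_val.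
  by apply/funext => t; rewrite /= set_valE /= mxE.
move=> t; apply: (@continuous_comp _ _ _
  ((fun t : 'rV[R]_n.+1 => t 0 j) \o set_val : std_simplex n -> R)
  (real_complex R : R -> Cplx R)); last exact: real_complex_continuous.
apply: (@continuous_comp _ _ _ (set_val : std_simplex n -> _)
  (fun t : 'rV[R]_n.+1 => t 0 j)).
  exact: initial_continuous.
exact: coord_continuous.
Qed.

Lemma std_to_affine_push m n (th : delta m n) (t : std_simplex m) :
  std_to_affine (std_simplex_push th t) =
  affine_simplex_push th (std_to_affine t).
Proof.
apply: val_inj; apply/rowP => i; rewrite /= !mxE rmorph_sum.
by apply: eq_bigr => j _; rewrite mxE.
Qed.

(* The global chart of A_n forgets the coordinate t_0. *)
Definition affine_chart n (t : affine_simplex n) : 'rV[Cplx R]_n :=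
  \row_i set_val t 0 (lift ord0 i).

Definition affine_lift n (s : 'rV[Cplx R]_n) : 'rV[Cplx R]_n.+1 :=
  \row_j if unlift ord0 j is Some i then s 0 i else 1 - \sum_i s 0 i.

Lemma affine_lift_subproof n (s : 'rV[Cplx R]_n) :
  affine_lift s \in @affine_simplex_set n.
Proof.
apply/mem_set; rewrite /affine_simplex_set /= big_ord_recl mxE unlift_none.
rewrite -[RHS](subrK (\sum_i s 0 i)); congr (_ + _).
by apply: eq_bigr => i _; rewrite mxE liftK.
Qed.
Definition affine_chart_inv n (s : 'rV[Cplx R]_n) : affine_simplex n :=
  exist (fun t => t \in @affine_simplex_set n) _ (affine_lift_subproof s).

Lemma affine_chartK n : cancel (@affine_chart n) (@affine_chart_inv n).
Proof.
move=> t; apply: val_inj; apply/rowP => j; rewrite /= mxE.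
have /= := set_valP t; rewrite /affine_simplex_set /= big_ord_recl => t1.
case: unliftP => [i ->|->]; first by rewrite mxE.
apply: (etrans (congr1 (fun z => z - _) (esym t1))).
rewrite [X in _ - X](eq_bigr (fun i => set_val t 0 (lift ord0 i))).
  by rewrite addrK.
by move=> i _; rewrite mxE.
Qed.

Lemma affine_chart_invK n : cancel (@affine_chart_inv n) (@affine_chart n).
Proof.
by move=> s; apply/rowP => i; rewrite mxE set_valE /= mxE liftK.
Qed.

Lemma affine_chart_continuous n : continuous (@affine_chart n).
Proof.
apply: continuous_rV => j.
have -> : (fun t : affine_simplex n => affine_chart t 0 j) =
    (fun t : 'rV[Cplx R]_n.+1 => t 0 (lift ord0 j)) \o set_val.
  by apply/funext => t; rewrite mxE.
move=> t; apply: (@continuous_comp _ _ _ (set_val : affine_simplex n -> _)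
  (fun t : 'rV[Cplx R]_n.+1 => t 0 (lift ord0 j))).
  exact: initial_continuous.
exact: coord_continuous.
Qed.

Definition affine_lift0 n (s : 'rV[Cplx R]_n) : 'rV[Cplx R]_n.+1 :=
  \row_j if unlift ord0 j is Some i then s 0 i else - \sum_i s 0 i.

Lemma affine_lift0_linear n : linear (@affine_lift0 n).
Proof.
move=> a u v; apply/rowP => j; rewrite !mxE.
case: (unlift ord0 j) => [i|]; first by rewrite !mxE.
rewrite mulrN mulr_sumr -opprD -big_split /=; congr (- _).
by apply: eq_bigr => i _; rewrite !mxE.
Qed.
HB.instance Definition _ n :=
  GRing.isLinear.Build (Cplx R) 'rV[Cplx R]_n 'rV[Cplx R]_n.+1 _ (@affine_lift0 n)
    (@affine_lift0_linear n).

Lemma affine_liftE n (s : 'rV[Cplx R]_n) :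
  affine_lift s = delta_mx 0 0 + affine_lift0 s.
Proof.
apply/rowP => j; rewrite !mxE.
case: unliftP => [i ->|->]; last by rewrite eqxx.
by rewrite eq_sym (negbTE (neq_lift _ _)) andbF add0r.
Qed.

Lemma affine_chart_inv_continuous n : continuous (@affine_chart_inv n).
Proof.
apply: continuous_comp_initial => s.
have -> : set_val \o @affine_chart_inv n =
    (fun s => delta_mx 0 0 + affine_lift0 s).
  by apply/funext => u; rewrite -affine_liftE.
exact: (cvgD (cvg_cst _) (@linear_rV_continuous _ _ _ (@affine_lift0 n) s)).
Qed.

Lemma Cplx_dense (z : Cplx R) (e : R) : 0 < e -> exists q : rat * rat,
  `|z - (ratr q.1 +i* ratr q.2)%C| < real_complex R e.
Proof.
move=> e0; case: z => a b.
have e2 : 0 < e / 2 by rewrite divr_gt0.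
have lt2 (x : R) : x - e / 2 < x + e / 2.
  by rewrite ltrBlDr -addrA ltrDl addr_gt0.
have [p] := @rat_in_itvoo R _ _ (lt2 a).
have [q] := @rat_in_itvoo R _ _ (lt2 b).
rewrite !in_itv /= -!ltr_distlC => bq ap; exists (p, q) => /=.
have -> : (a +i* b - (ratr p +i* ratr q))%C =
    real_complex R (a - ratr p) + (0 +i* (b - ratr q))%C.
  by apply/eqP; rewrite eq_complex /= addr0 add0r !eqxx.
apply: le_lt_trans (ler_normD _ _) _; rewrite Cplx_norm_real.
rewrite [X in _ + X]normc_def /= expr0n add0r sqrtr_sqr -rmorphD ltcR.
by rewrite (splitr e) ltrD.
Qed.

Lemma rV_second_countable n : @second_countable 'rV[Cplx R]_n.
Proof.
pose c (q : rat * rat) : Cplx R := (ratr q.1 +i* ratr q.2)%C.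
pose D (kq : nat * {ffun 'I_n -> rat * rat}) : set 'rV[Cplx R]_n :=
  ball (\row_j c (kq.2 j)) (real_complex R kq.1.+1%:R^-1).
exists (range D); first by apply: card_le_trans (card_image_le _ _) _; exact: countableP.
split=> [_ [kq _ <-]|x N /nbhs_ballP[e /= /Cplx_gt0[r r0 ->] xN]].
  exact: ball_open.
have r2 : 0 < r / 2 by rewrite divr_gt0.
have [k _ /(_ k (leqnn k)) kr] := near_infty_natSinv_lt (PosNum r2).
have k0 : 0 < k.+1%:R^-1 :> R by rewrite invr_gt0.
have /choice[q xq] : forall j, exists q : rat * rat,
    `|x 0 j - c q| < real_complex R k.+1%:R^-1.
  by move=> j; exact: Cplx_dense.
have xD : ball x (real_complex R k.+1%:R^-1) (\row_j c ([ffun j => q j] j)).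
  split=> [|i j]; first by rewrite ltcR.
  by rewrite (ord1 i) mxE ffunE; exact: xq.
exists (D (k, [ffun j => q j])).
  by split; [exists (k, [ffun j => q j])|exact: ball_sym].
move=> y Dy; apply: xN; apply: le_ball (ball_triangle xD Dy).
rewrite -rmorphD lecR; apply: ltW; rewrite (splitr r); exact: ltrD.
Qed.

Definition affine_simplex_manifold (n : nat) : complexManifold R.
Proof.
refine (@ComplexManifold R (affine_simplex n) _ _ unit (fun=> n) (fun=> setT)
  (fun=> @affine_chart n) (fun=> @affine_chart_inv n) _ _ _ _ _ _ _).
- apply: (@hausdorff_inj _ _ (@affine_chart n)).
  + exact: can_inj (@affine_chartK n).
  + exact: affine_chart_continuous.
  + exact: norm_hausdorff.
- apply: (second_countable_can (@affine_chartK n)).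
  + exact: affine_chart_continuous.
  + exact: affine_chart_inv_continuous.
  + exact: rV_second_countable.
- by move=> _; exact: openT.
- move=> _; suff -> : @affine_chart n @` setT = setT by exact: openT.
  by apply/seteqP; split=> // s _; exists (affine_chart_inv s); rewrite ?affine_chart_invK.
- by move=> x; exists tt.
- by move=> _ x _; exact: affine_chartK.
- by move=> _ x _; exact: affine_chart_continuous.
- by move=> _ x _; exact: affine_chart_inv_continuous.
- move=> _ _ x _ _.
  suff -> : @affine_chart n \o @affine_chart_inv n = idfun by [].
  by apply/funext => s; rewrite /= affine_chart_invK.
Defined.

Definition chart_push0 m n (th : delta m n) (s : 'rV[Cplx R]_m) :
    'rV[Cplx R]_n :=
  \row_i simplex_push th (affine_lift0 s) 0 (lift ord0 i).

Lemma chart_push0_linear m n (th : delta m n) : linear (chart_push0 th).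
Proof.
move=> a u v; apply/rowP => i; rewrite mxE.
have -> : simplex_push th (affine_lift0 (a *: u + v)) =
    a *: simplex_push th (affine_lift0 u) + simplex_push th (affine_lift0 v).
  by rewrite !linearP.
by rewrite !mxE.
Qed.
HB.instance Definition _ m n (th : delta m n) :=
  GRing.isLinear.Build (Cplx R) 'rV[Cplx R]_m 'rV[Cplx R]_n _ (chart_push0 th)
    (chart_push0_linear th).

Lemma chart_push_differentiable m n (th : delta m n) (s : 'rV[Cplx R]_m) :
  differentiable
    (@affine_chart n \o affine_simplex_push th \o @affine_chart_inv m) s.
Proof.
have -> : @affine_chart n \o affine_simplex_push th \o @affine_chart_inv m =
    cst (\row_i simplex_push th (delta_mx 0 0) 0 (lift ord0 i)) +
    chart_push0 th.
  apply/funext => u; apply/rowP => i.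
  transitivity (simplex_push th (affine_lift u) 0 (lift ord0 i)).
    by rewrite /= mxE.
  rewrite affine_liftE linearD [LHS]mxE.
  by rewrite [RHS]mxE [X in _ = X + _]mxE [X in _ = _ + X]mxE.
apply: differentiableD; first exact: differentiable_cst.
apply: linear_differentiable; exact: linear_rV_continuous.
Qed.

Lemma singular_act_continuous (X : topologicalType) m n (th : delta m n)
    (f : continuousType (std_simplex n) X) :
  continuous (f \o std_simplex_push th).
Proof.
move=> t; apply: continuous_comp; first exact: std_simplex_push_continuous.
exact: cts_fun.
Qed.

Program Definition singular_set (X : topologicalType) : simplicialSet :=
  @SimplicialSet (fun n => continuousType (std_simplex n) X)
    (fun m n th f => mkcts (@singular_act_continuous X m n th f)) _ _.
Next Obligation.
move=> X n f; apply/continuousEP => t /=; rewrite /mkcts /=; congr (f _).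
by apply: val_inj; exact: simplex_push_id.
Qed.
Next Obligation.
move=> X l m n g f h; apply/continuousEP => t /=; rewrite /mkcts /=.
by congr (h _); apply: val_inj; exact: simplex_push_comp.
Qed.

Variable X : complexManifold R.

Lemma affine_singular_act_holomorphic m n (th : delta m n)
    (f : holoMap (affine_simplex_manifold n) X) :
  @holomorphic R (affine_simplex_manifold m) X (f \o affine_simplex_push th).
Proof.
move=> t _; have [fc fd] := @holo_funP _ _ _ f (affine_simplex_push th t) I.
split.
  apply: (@continuous_comp (affine_simplex m) (affine_simplex n) X
    (affine_simplex_push th) f) => //.
  exact: affine_simplex_push_continuous.
move=> c c' _ Xc'; have /= fd' := fd tt c' I Xc'.
have -> : mmap c' \o (f \o affine_simplex_push th) \o minv c =
    (mmap c' \o f \o @affine_chart_inv n) \o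
    (@affine_chart n \o affine_simplex_push th \o @affine_chart_inv m).
  by apply/funext => s; rewrite /= affine_chartK.
apply: differentiable_comp; first exact: chart_push_differentiable.
by rewrite /= affine_chartK.
Qed.

Lemma holoMap_eqP (M N : complexManifold R) (f g : holoMap M N) :
  f =1 g -> f = g.
Proof.
case: f g => [f fP] [g gP] /= /funext fg; subst g.
by rewrite (Prop_irrelevance fP gP).
Qed.

Program Definition affine_singular_set : simplicialSet :=
  @SimplicialSet (fun n => holoMap (affine_simplex_manifold n) X)
    (fun m n th f => HoloMap (@affine_singular_act_holomorphic m n th f)) _ _.
Next Obligation.
move=> n f; apply: holoMap_eqP => t /=; congr (f _).
by apply: val_inj; exact: simplex_push_id.
Qed.
Next Obligation.
move=> l m n g f h; apply: holoMap_eqP => t /=; congr (h _).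
by apply: val_inj; exact: simplex_push_comp.
Qed.

Lemma affine_restrict_continuous n
    (f : holoMap (affine_simplex_manifold n) X) :
  continuous (f \o @std_to_affine n : std_simplex n -> X).
Proof.
move=> t; apply: (@continuous_comp (std_simplex n) (affine_simplex n) X
  (@std_to_affine n) f); first exact: std_to_affine_continuous.
by have [] := @holo_funP _ _ _ f (std_to_affine t) I.
Qed.

Program Definition affine_singular_inclusion :
    simplicialMap affine_singular_set (singular_set X) :=
  @SimplicialMap affine_singular_set (singular_set X)
    (fun n f => mkcts (@affine_restrict_continuous n f)) _.
Next Obligation.
move=> m n th f; apply/continuousEP => t /=; rewrite /mkcts /=.
by rewrite std_to_affine_push.
Qed.

End Simplices.

Section Realization.
Local Open Scope quotient_scope.
Variable R : realType.

Section Space.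
Variable K : simplicialSet.

(* The disjoint union of the K_n x T_n, with K_n discrete. *)
Definition realization_sum : topologicalType :=
  {n : nat & (discrete_topology {classic K n} * std_simplex R n)%type}.

Definition realization_point n (x : K n) (t : std_simplex R n) :
    realization_sum :=
  existT (fun n => (discrete_topology {classic K n} * std_simplex R n)%type)
    n (x, t).

Inductive realization_step : realization_sum -> realization_sum -> Prop :=
| RealizationStep m n (th : delta m n) (x : K n) (t : std_simplex R m) :
    realization_step (realization_point (sact th x) t)
                     (realization_point x (std_simplex_push th t)).

Definition realization_rel (a b : realization_sum) : bool :=
  `[< clos_refl_sym_trans _ realization_step a b >].

Lemma realization_rel_refl : reflexive realization_rel.
Proof. by move=> a; apply/asboolP; exact: rst_refl. Qed.
Lemma realization_rel_sym : symmetric realization_rel.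
Proof.
by move=> a b; apply/idP/idP => /asboolP ab; apply/asboolP; exact: rst_sym.
Qed.
Lemma realization_rel_trans : transitive realization_rel.
Proof.
move=> b a c /asboolP ab /asboolP bc; apply/asboolP; exact: rst_trans ab bc.
Qed.
Definition realization_equiv := EquivRel _ realization_rel_refl
  realization_rel_sym realization_rel_trans.

Definition realization : topologicalType :=
  quotient_topology {eq_quot realization_equiv}.

Definition realization_class n (x : K n) (t : std_simplex R n) : realization :=
  \pi_{eq_quot realization_equiv} (realization_point x t).

End Space.

Section Map.
Variables (K L : simplicialSet) (f : simplicialMap K L).

Definition realization_sum_map (a : realization_sum K) : realization L :=
  realization_class (smap f ((projT2 a).1 : K (projT1 a))) (projT2 a).2.

Definition realization_map (u : realization K) : realization L :=
  realization_sum_map (repr (u : {eq_quot realization_equiv K})).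

Lemma realization_mapE n (x : K n) (t : std_simplex R n) :
  realization_map (realization_class x t) = realization_class (smap f x) t.
Proof.
rewrite /realization_map; set a := repr _.
have : realization_equiv K a (realization_point x t).
  by apply/eqmodP; rewrite reprK.
move=> /asboolP; suff E b c : clos_refl_sym_trans _ (@realization_step K) b c ->
    realization_sum_map b = realization_sum_map c by move=> /E ->.
elim=> {b c} [b c [m p th y s]|//|b c _ -> //|b c d _ -> _ -> //].
rewrite /realization_sum_map /= smap_natural.
apply/(@eqmodP _ (realization_equiv L))/asboolP/rst_step.
exact: RealizationStep.
Qed.

End Map.

End Realization.

Definition homotopic (R : realType) (T U : topologicalType) (f g : T -> U) :
    Prop :=
  exists H : T * R -> U,
    [/\ {within [set: T] `*` `[0, 1]%classic, continuous H},
        forall x, H (x, 0) = f x & forall x, H (x, 1) = g x].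

Definition homotopy_equivalence (R : realType) (T U : topologicalType)
    (f : T -> U) : Prop :=
  continuous f /\
  exists g : U -> T,
    [/\ continuous g, homotopic R (g \o f) idfun & homotopic R (f \o g) idfun].

(* A map of simplicial sets is a weak equivalence if its geometric realization
   is a homotopy equivalence (Quillen). *)
Definition weak_equivalence (R : realType) (K L : simplicialSet)
    (f : simplicialMap K L) : Prop :=
  homotopy_equivalence R (realization_map (R := R) f).

Definition homotopically_elliptic (R : realType) (X : complexManifold R) :
    Prop :=
  kan (affine_singular_set X) /\
  weak_equivalence R (affine_singular_inclusion X).

(* Main.v *)
Require Import Defs.
From mathcomp Require Import all_boot all_order all_algebra.
From mathcomp Require Import complex ring lra zify.
From mathcomp Require Import all_classical all_reals all_analysis.
From Stdlib Require Import Relations.Relation_Operators.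
From HB Require Import structures.

(** Only the fact that eX -> sX is the inclusion of a strong deformation retract
    needs an argument: sX is a Kan complex, hence so is its retract eX, and the
    realization of a deformation retraction is a homotopy equivalence.

    Consider the simplicial set W of homotopies of singular simplices which end
    at a holomorphic map.  Every lifting problem of a boundary inclusion against
    the map W -> sX, k |-> k(.,0), has a solution: a family of homotopies on the
    facets of T_n, ending at holomorphic maps on the facets of A_n, extends to a
    homotopy on T_n from a given map to (the restriction of) a continuous map
    A_n -> X which is holomorphic on the union of the coordinate hyperplanes;
    the basic Oka property deforms the latter to a holomorphic map without
    changing it on the hyperplanes.  By induction over the nondegenerate
    simplices, the section of W -> sX given on eX by constant homotopies extends
    to sX, and a section of W -> sX is a deformation of sX into eX.

    A holomorphic map on A_n is determined by its restriction to T_n, so that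
    the section on eX is well defined.  This is the identity theorem, proved here
    from the Goursat lemma and a maximum principle. *)

Set Implicit Arguments.
Unset Strict Implicit.
Unset Printing Implicit Defensive.

Import Order.TTheory GRing.Theory Num.Theory numFieldNormedType.Exports.

Local Open Scope classical_set_scope.
Local Open Scope ring_scope.

(** * Complex analysis in one variable *)

Section RealAnalysis.
Variable R : realType.

(** The obstacle is to deform all simplices compatibly. The Oka property only deforms a map that is
    already holomorphic on the subvariety, so the homotopies over the facets must have ended before
    the one over the interior can start; this forces a timetable according to dimension. Moreover
    the data live on a real simplex and on complex hyperplanes of a noncompact space. They are
    extended by explicit formulas governed by the least coordinate modulus, and facewise holomorphic
    data still have to be recognized as local restrictions of holomorphic maps, although the union
    of the hyperplanes is singular. Working with sections of a simplicial map confines all choices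
    to nondegenerate simplices, and one section yields both the retraction and the deformation. The
    analysis avoids Cauchy's formula and power series: a primitive supplies the second derivative
    that a maximum principle requires, and a growth bound of Schwarz type gives the identity
    theorem. *)

Lemma continuous_primitive (f : R -> R) (a b : R) : continuous f ->
  exists F : R -> R, forall x, a < x < b -> is_derive x 1 F (f x).
Proof.
move=> fc; exists (fun x => (\int[lebesgue_measure]_(t in [set` `[a, x]]) (f t))%R).
move=> x /andP[ax xb].
have [] := @continuous_FTC1_closed R f a x b xb _ ax (fc x).
  apply: continuous_compact_integrable; first exact: segment_compact.
  exact: continuous_subspaceT.
by move=> d e; apply: (DeriveDef d); rewrite -e derive1E.
Qed.

Lemma mean_value_bound (f df : R -> R) (a b e : R) : a <= b ->
  (forall x, a <= x <= b -> is_derive x 1 f (df x)) ->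
  (forall x, a <= x <= b -> `|df x| <= e) -> `|f b - f a| <= e * (b - a).
Proof.
move=> ab fd fe.
have [||c cab ->] := @MVT_segment R f df a b ab.
- by move=> x; rewrite in_itv /= => /andP[/ltW ax /ltW xb]; apply: fd; rewrite ax.
- apply: derivable_within_continuous => x; rewrite in_itv /= => xab.
  by have [] := fd x xab.
rewrite normrM (ger0_norm (x := b - a)) ?subr_ge0// ler_wpM2r ?subr_ge0//.
by apply: fe; move: cab; rewrite in_itv.
Qed.

End RealAnalysis.

Section Modulus.
Variable R : realType.
Local Notation C := (Cplx R).
Local Notation Re := (@complex.Re R).
Local Notation Im := (@complex.Im R).
Local Notation "x %:C" := (real_complex R x : C) (format "x %:C").
Implicit Types z w : C.

(** The norm of [Cplx R] takes its values in [Cplx R], where the order is only partial. Its real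
    part carries all estimates over to the ordered field [R]. *)
Definition cmod z : R := Re `|z|.

Lemma cmodE z : `|z| = (cmod z)%:C.
Proof. by rewrite /cmod normc_def. Qed.

Lemma cmod_ge0 z : 0 <= cmod z.
Proof. by rewrite -lecR -cmodE normr_ge0. Qed.

Lemma cmodM z w : cmod (z * w) = cmod z * cmod w.
Proof. by apply: complexI; rewrite -cmodE normrM !cmodE rmorphM. Qed.

Lemma cmod_real (x : R) : cmod x%:C = `|x|.
Proof. by apply: complexI; rewrite -cmodE Cplx_norm_real. Qed.

Lemma cmodX z n : cmod (z ^+ n) = cmod z ^+ n.
Proof. by apply: complexI; rewrite -cmodE normrX !cmodE rmorphXn. Qed.

Lemma cmodV z : cmod z^-1 = (cmod z)^-1.
Proof. by apply: complexI; rewrite -cmodE normfV !cmodE fmorphV. Qed.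

Lemma cmod0P z : (cmod z == 0) = (z == 0).
Proof. by rewrite -[RHS]normr_eq0 cmodE -(rmorph0 (real_complex R)) (inj_eq (@complexI _)). Qed.

Lemma cmodN z : cmod (- z) = cmod z.
Proof. by rewrite /cmod normrN. Qed.

Lemma cmod_distC z w : cmod (z - w) = cmod (w - z).
Proof. by rewrite -cmodN opprB. Qed.

Lemma cmod_triangle z w : cmod (z + w) <= cmod z + cmod w.
Proof. by rewrite -lecR rmorphD -!cmodE ler_normD. Qed.

Lemma Re_le_cmod z : `|Re z| <= cmod z.
Proof. by rewrite /cmod normc_def /= -sqrtr_sqr ler_sqrt ?addr_ge0 ?sqr_ge0// lerDl sqr_ge0. Qed.

Lemma Im_le_cmod z : `|Im z| <= cmod z.
Proof. by rewrite /cmod normc_def /= -sqrtr_sqr ler_sqrt ?addr_ge0 ?sqr_ge0// lerDr sqr_ge0. Qed.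

Lemma cmod_le_ReIm z : cmod z <= `|Re z| + `|Im z|.
Proof.
rewrite [z in cmod z]complexE; apply: le_trans (cmod_triangle _ _) _.
rewrite cmodM !cmod_real; have -> : cmod 'i%C = 1; last by rewrite mul1r.
by rewrite /cmod normc_def /= expr0n add0r expr1n sqrtr1.
Qed.

Lemma cmod_cvgP (T : Type) (F : set_system T) (FF : Filter F) (f : T -> C) (a : C) :
  f @ F --> a <-> forall e : R, 0 < e -> \forall t \near F, cmod (a - f t) < e.
Proof.
split=> [/cvgrPdist_lt fa e e0|fa].
  have := fa e%:C; rewrite ltcR => /(_ e0).
  by apply: filterS => t; rewrite cmodE ltcR.
apply/cvgrPdist_lt => e /Cplx_gt0[r r0 ->].
by apply: filterS (fa r r0) => t; rewrite cmodE ltcR.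
Qed.

Lemma nbhs_cmodP z (A : set C) :
  nbhs z A <-> exists2 e : R, 0 < e & forall w, cmod (z - w) < e -> A w.
Proof.
split.
  move/nbhs_ballP => [e /= /Cplx_gt0[r r0 ->]] zA.
  by exists r => // w zw; apply: zA; rewrite -ball_normE /= cmodE ltcR.
move=> [e e0 zA]; apply/nbhs_ballP; exists e%:C => /=; first by rewrite ltcR.
by move=> w; rewrite -ball_normE /= cmodE ltcR; exact: zA.
Qed.

Lemma Re_continuous : continuous (Re : C -> R).
Proof.
move=> z; apply/(@cvgrPdist_lt _ R^o C (nbhs (z : C)) _) => e e0; apply/nbhs_cmodP; exists e => // w.
by apply: le_lt_trans; rewrite -raddfB Re_le_cmod.
Qed.

Lemma Im_continuous : continuous (Im : C -> R).
Proof.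
move=> z; apply/(@cvgrPdist_lt _ R^o C (nbhs (z : C)) _) => e e0; apply/nbhs_cmodP; exists e => // w.
by apply: le_lt_trans; rewrite -raddfB Im_le_cmod.
Qed.

Lemma cmod_continuous : continuous cmod.
Proof.
move=> z; apply/(@cvgrPdist_lt _ R^o C (nbhs (z : C)) _) => e e0; apply/nbhs_cmodP; exists e => // w.
apply: le_lt_trans; rewrite ler_norml; apply/andP; split.
  rewrite lerNl opprB lerBlDl; have := cmod_triangle z (w - z).
  by rewrite subrKC -[w - z]opprB /cmod normrN.
by rewrite lerBlDl -{1}(subrKC w z); exact: cmod_triangle.
Qed.

Lemma Complex_continuous (T : topologicalType) (f g : T -> R) :
  continuous f -> continuous g -> continuous (fun t => (f t +i* g t)%C : C).
Proof.
move=> fc gc t; apply/cmod_cvgP => e e0.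
have e2 : 0 < e / 2 by rewrite divr_gt0.
have /cvgrPdist_lt/(_ _ e2) ft := fc t.
have /cvgrPdist_lt/(_ _ e2) gt := gc t.
near=> s; apply: le_lt_trans (cmod_le_ReIm _) _; rewrite /=.
rewrite (splitr e) ltrD//; [near: s; exact: ft|near: s; exact: gt].
Unshelve. all: by end_near. Qed.

End Modulus.

Section Derive.
Variable R : realType.
Local Notation C := (Cplx R).
Local Notation Re := (@complex.Re R).
Local Notation Im := (@complex.Im R).
Local Notation "x %:C" := (real_complex R x : C) (format "x %:C").
Implicit Types z w : C.

(** Clearing the denominator of the difference quotient removes the exception [w = z] from later
    estimates. The bound is weak while convergence asks for a strict one, whence [e / 2] in the
    converse. *)
Lemma is_derive_cmodP (f : C -> C) z a :
  is_derive z 1 f a <->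
  forall e : R, 0 < e -> \forall w \near z, cmod (f w - f z - a * (w - z)) <= e * cmod (w - z).
Proof.
split=> [[df <-]|H].
  move=> e e0.
  have /cmod_cvgP/(_ e e0) /nbhs_cmodP[d d0 D] := df.
  apply/nbhs_cmodP; exists d => // w zw.
  have [->|wz] := eqVneq w z; first by rewrite !subrr mulr0 subrr /cmod normr0 mulr0.
  have /= := D (w - z); rewrite sub0r opprB => /(_ zw); rewrite subr_eq0 => /(_ wz).
  rewrite /shift /= [_ *: 1]mulr1 subrK.
  set q := lim _ => /ltW h.
  have wz0 : w - z != 0 by rewrite subr_eq0.
  have -> : f w - f z - q * (w - z) = - (q - (w - z)^-1 * (f w - f z)) * (w - z).
    by rewrite opprB mulrBl mulrAC mulVf// mul1r.
  rewrite cmodM ler_wpM2r ?cmod_ge0//.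
  by rewrite /cmod normrN.
have cv : (fun h : C => h^-1 *: ((f \o shift z) (h *: (1:C)) - f z)) @ 0^' --> a.
  apply/cmod_cvgP => e e0.
  have e2 : 0 < e / 2 by rewrite divr_gt0.
  have /nbhs_cmodP[d d0 D] := H _ e2.
  apply/nbhs_cmodP; exists d => // h; rewrite sub0r => hd h0.
  have := D (h + z); rewrite opprD addrCA subrr addr0 addrK => /(_ hd).
  rewrite /shift /= [_ *: 1]mulr1 => le.
  have -> : a - h^-1 *: (f (h + z) - f z) = - (h^-1 * (f (h + z) - f z - a * h)).
    by rewrite [_ *: _]/(_ * _) [in RHS]mulrBr mulrCA mulVf// mulr1 opprB.
  have ch : 0 < cmod h by rewrite lt_neqAle eq_sym cmod0P h0 cmod_ge0.
  rewrite /cmod normrN -/(cmod _) cmodM cmodV mulrC.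
  rewrite -(ltr_pM2r ch) mulfVK ?gt_eqF//; apply: le_lt_trans le _.
  by rewrite ltr_pM2r// ltr_pdivrMr// mulr_natr mulr2n ltrDl.
by apply: DeriveDef; [apply/cvg_ex; exists a|exact: cvg_lim].
Qed.

(** The bridge from complex to real differentiation, through which the real mean value theorem acts
    on holomorphic functions along lines. *)
Lemma is_derive_Re (f : C -> C) (z w a : C) (t : R) :
  is_derive (z + t%:C * w) 1 f a ->
  is_derive t 1 (fun s : R => Re (f (z + s%:C * w))) (Re (a * w)).
Proof.
move=> /is_derive_cmodP H.
have cv : (fun h : R => h^-1 *:
    (((fun s : R => Re (f (z + s%:C * w))) \o shift t) (h *: (1:R)) - Re (f (z + t%:C * w)))) @ 0^'
    --> Re (a * w).
  apply/cvgrPdist_lt => e e0.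
  have e2 : 0 < e / (cmod w + 1) by rewrite divr_gt0// ltr_wpDl// cmod_ge0.
  have /nbhs_cmodP[d d0 D] := H _ e2.
  have d2 : 0 < d / (cmod w + 1) by rewrite divr_gt0// ltr_wpDl// cmod_ge0.
  apply/nbhs_ballP; exists (d / (cmod w + 1)) => // h.
  rewrite -ball_normE /= sub0r normrN => hd h0.
  rewrite [h *: 1]mulr1.
  have := D (z + (h + t)%:C * w).
  have -> : z + t%:C * w - (z + (h + t)%:C * w) = - (h%:C * w).
    by rewrite rmorphD; ring.
  have -> : z + (h + t)%:C * w - (z + t%:C * w) = h%:C * w.
    by rewrite rmorphD; ring.
  rewrite {1}/cmod normrN -/(cmod _) cmodM cmod_real.
  have w1 : 0 < cmod w + 1 by rewrite ltr_wpDl// cmod_ge0.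
  have hw : `|h| * cmod w < d.
    apply: (@le_lt_trans _ _ (`|h| * (cmod w + 1))).
      by rewrite ler_wpM2l// lerDl.
    by rewrite -ltr_pdivlMr.
  move=> /(_ hw) le.
  have -> : Re (a * w) - h^-1 *: (Re (f (z + (h + t)%:C * w)) - Re (f (z + t%:C * w))) =
     - (h^-1 * Re (f (z + (h + t)%:C * w) - f (z + t%:C * w) - a * (h%:C * w))).
    rewrite (_ : forall u v : R, u *: v = u * v)//.
    set X := f (z + (h + t)%:C * w); set Y := f (z + t%:C * w).
    have -> : Re (X - Y - a * (h%:C * w)) = Re X - Re Y - h * Re (a * w).
      rewrite (mulrCA a); case: (a * w) => u v; case: X => X1 X2; case: Y => Y1 Y2.
      by rewrite [LHS]/= mul0r subr0.
    move: (Re X) (Re Y) (Re (a * w)) => x y u.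
    have key (k : R) : k != 0 -> u - k^-1 * (x - y) = - (k^-1 * (x - y - k * u)).
      by move=> k0; rewrite [in RHS]mulrBr [in RHS]mulrA mulVf// mul1r opprB.
    exact: (key h h0).
  rewrite normrN normrM normfV mulrC.
  have hp : 0 < `|h| by rewrite normr_gt0.
  rewrite -(ltr_pM2r hp) mulfVK ?gt_eqF//.
  apply: le_lt_trans (Re_le_cmod _) _; apply: le_lt_trans le _.
  rewrite mulrCA mulrC ltr_pM2r//.
  by rewrite mulrAC ltr_pdivrMr// ltr_pM2l// ltrDl.
by apply: DeriveDef; [apply/cvg_ex; exists (Re (a * w))|exact: cvg_lim].
Qed.

End Derive.

(** * Goursat's lemma for rectangles *)

Section Goursat.
Variable R : realType.
Local Notation C := (Cplx R).
Local Notation Re := (@complex.Re R).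
Local Notation Im := (@complex.Im R).
Local Notation "x %:C" := (real_complex R x : C) (format "x %:C").
Local Notation iC := ('i%C : C).
Implicit Types z w : C.

Lemma ReB z w : Re (z - w) = Re z - Re w.
Proof. by case: z w => [? ?] []. Qed.

Lemma ImB z w : Im (z - w) = Im z - Im w.
Proof. by case: z w => [? ?] []. Qed.

(** Componentwise, so that curves are differentiated over [R] while [C] stays a normed space over
    itself. *)
Definition curve_derive (p : R -> C) (t : R) (d : C) : Prop :=
  is_derive t 1 (Re \o p) (Re d) /\ is_derive t 1 (Im \o p) (Im d).

Lemma curve_deriveB p q t d e :
  curve_derive p t d -> curve_derive q t e ->
  curve_derive (fun s => p s - q s) t (d - e).
Proof.
move=> [p1 p2] [q1 q2]; split.
  have -> : Re \o (fun s => p s - q s) = (Re \o p) - (Re \o q).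
    by apply/funext => s; rewrite /= ReB.
  by rewrite ReB; apply: (@is_deriveB _ _ _ (Re \o p) (Re \o q)).
have -> : Im \o (fun s => p s - q s) = (Im \o p) - (Im \o q).
  by apply/funext => s; rewrite /= ImB.
by rewrite ImB; apply: (@is_deriveB _ _ _ (Im \o p) (Im \o q)).
Qed.

Lemma ImE z : Im z = Re (- iC * z).
Proof. by case: z => x y /=; rewrite oppr0 mul0r add0r mulN1r opprK. Qed.

Lemma is_derive_cmul (f : C -> C) z a c :
  is_derive z 1 f a -> is_derive z 1 (fun w => c * f w) (c * a).
Proof. by move=> fa; exact: (is_deriveZ c). Qed.

Lemma is_derive_curve (f : C -> C) (z w a : C) (t : R) :
  is_derive (z + t%:C * w) 1 f a ->
  curve_derive (fun s : R => f (z + s%:C * w)) t (a * w).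
Proof.
move=> fa; split; first exact: is_derive_Re.
have -> : Im \o (fun s : R => f (z + s%:C * w)) =
    fun s : R => Re ((fun u => - iC * f u) (z + s%:C * w)).
  by apply/funext => s; rewrite /= ImE.
rewrite ImE mulrA; apply: (@is_derive_Re _ (fun u => - iC * f u)).
Qed.

(** The real mean value theorem is applied to the two components separately, which costs the factor
    2. *)
Lemma curve_mean_value (p d : R -> C) (a b e : R) : a <= b ->
  (forall t, a <= t <= b -> curve_derive p t (d t)) ->
  (forall t, a <= t <= b -> cmod (d t) <= e) ->
  cmod (p b - p a) <= 2 * e * (b - a).
Proof.
move=> ab pd de; apply: le_trans (cmod_le_ReIm _) _.
rewrite -mulrA mulr_natl mulr2n lerD// ?ReB ?ImB.
  apply: (@mean_value_bound _ (Re \o p) (Re \o d)) => // t tab.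
    by have [] := pd t tab.
  exact: le_trans (Re_le_cmod _) (de _ tab).
apply: (@mean_value_bound _ (Im \o p) (Im \o d)) => // t tab.
  by have [] := pd t tab.
exact: le_trans (Im_le_cmod _) (de _ tab).
Qed.

Lemma curve_mean_value_sym (p d : R -> C) (a b e : R) :
  (forall t, `|t - a| <= `|b - a| -> curve_derive p t (d t)) ->
  (forall t, `|t - a| <= `|b - a| -> cmod (d t) <= e) ->
  cmod (p b - p a) <= 2 * e * `|b - a|.
Proof.
move=> pd de; have [ab|ba] := leP a b.
  have ba0 : 0 <= b - a by rewrite subr_ge0.
  rewrite (ger0_norm ba0); apply: (curve_mean_value (d := d)) => // t /andP[at_ tb].
    by apply: pd; rewrite ger0_norm ?subr_ge0// (ger0_norm ba0) lerB.
  by apply: de; rewrite ger0_norm ?subr_ge0// (ger0_norm ba0) lerB.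
have ba0 : b - a <= 0 by rewrite subr_le0 ltW.
rewrite (ler0_norm ba0) opprB cmod_distC.
apply: (curve_mean_value (d := d)); first exact: ltW.
  by move=> t /andP[bt ta]; apply: pd; rewrite ler0_norm ?subr_le0// (ler0_norm ba0) lerN2 lerB.
by move=> t /andP[bt ta]; apply: de; rewrite ler0_norm ?subr_le0// (ler0_norm ba0) lerN2 lerB.
Qed.

Lemma continuous_curve_primitive (f : R -> C) (a b : R) : continuous f ->
  exists p : R -> C, forall x, a < x < b -> curve_derive p x (f x).
Proof.
move=> fc.
have [|F1 F1P] := @continuous_primitive R (Re \o f) a b.
  by move=> t; apply: continuous_comp; [exact: fc|exact: Re_continuous].
have [|F2 F2P] := @continuous_primitive R (Im \o f) a b.
  by move=> t; apply: continuous_comp; [exact: fc|exact: Im_continuous].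
by exists (fun t => (F1 t +i* F2 t)%C) => x xab; split; [exact: F1P|exact: F2P].
Qed.

(** The supremum of the left end points is such a point, since every right end point bounds them
    from above. *)
Lemma nested_halving (u : nat -> R) (w : R) : 0 <= w ->
  (forall n, u n <= u n.+1) ->
  (forall n, u n.+1 + w / 2 ^+ n.+1 <= u n + w / 2 ^+ n) ->
  exists x, forall n, u n <= x <= u n + w / 2 ^+ n.
Proof.
move=> w0 u1 u2.
have um m n : (m <= n)%N -> u m <= u n.
  by move/subnK <-; elim: (n - m)%N => // k IH; apply: le_trans IH _; rewrite addSn.
have vm m n : (m <= n)%N -> u n + w / 2 ^+ n <= u m + w / 2 ^+ m.
  by move/subnK <-; elim: (n - m)%N => // k IH; rewrite addSn; apply: le_trans (u2 _) IH.
have uv m n : u m <= u n + w / 2 ^+ n.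
  apply: le_trans (um m (maxn m n) (leq_maxl _ _)) _.
  apply: le_trans (vm n (maxn m n) (leq_maxr _ _)).
  by rewrite lerDl divr_ge0// exprn_ge0.
have hs : has_sup (range u).
  by split; [exists (u 0%N); exists 0%N|exists (u 0%N + w / 2 ^+ 0) => _ [n _ <-]; exact: uv].
exists (sup (range u)) => n; apply/andP; split.
  by apply: sup_upper_bound => //; exists n.
by apply: sup_le_ub => [|_ [m _ <-]]; [case: hs|exact: uv].
Qed.

Variables (f : C -> C) (rho : R).
Hypothesis fd : forall z, `|Re z| < rho -> `|Im z| < rho -> exists a : C, is_derive z 1 f a.

Local Notation inQ x := (- rho < x < rho).
Local Notation pt x y := ((x : R) +i* (y : R))%C.

Variables (P Q : R -> R -> C).
Hypothesis Pd : forall y x : R, inQ x -> curve_derive (P y) x (f (pt x y)).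
Hypothesis Qd : forall x y : R, inQ y -> curve_derive (Q x) y (f (pt x y)).

(* [P y] and [Q x] are primitives of [f] on horizontal and vertical lines; their
   increments stand for the integrals over the sides of a rectangle. *)
Definition boundary_integral x0 x1 y0 y1 : C :=
  (P y0 x1 - P y0 x0) - (P y1 x1 - P y1 x0) +
  iC * ((Q x1 y1 - Q x1 y0) - (Q x0 y1 - Q x0 y0)).
Local Notation I := boundary_integral.

Lemma boundary_integral_split x0 x1 x2 y0 y1 y2 :
  I x0 x2 y0 y2 = I x0 x1 y0 y1 + I x1 x2 y0 y1 + I x0 x1 y1 y2 + I x1 x2 y1 y2.
Proof. by rewrite /I; ring. Qed.

Lemma ptE x y : pt x y = x%:C + iC * y%:C :> C.
Proof. by apply/eqP; rewrite eq_complex /=; apply/andP; split; apply/eqP; ring. Qed.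

(** An affine function has a global primitive [L], whose increments cancel around the rectangle.
    Subtracting them leaves on each side the increment of a curve with derivative at most [e]; the
    constant 4 is the factor 2 of [curve_mean_value] times two opposite sides. *)
Lemma boundary_integral_affine x0 x1 y0 y1 (z0 c a : C) (e : R) :
  inQ x0 -> inQ x1 -> inQ y0 -> inQ y1 -> x0 <= x1 -> y0 <= y1 ->
  (forall x y, x0 <= x <= x1 -> y0 <= y <= y1 ->
    cmod (f (pt x y) - (c + a * (pt x y - z0))) <= e) ->
  cmod (I x0 x1 y0 y1) <= 4 * e * ((x1 - x0) + (y1 - y0)).
Proof.
move=> x0Q x1Q y0Q y1Q x01 y01 fe.
pose L (z : C) := c * z + a / 2 * (z - z0) ^+ 2.
have Ld z : is_derive z 1 L (c + a * (z - z0)).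
  apply/is_derive_cmodP => e' e'0; apply/nbhs_cmodP.
  exists (e' / (cmod (a / 2) + 1)).
    by rewrite divr_gt0// ltr_wpDl// cmod_ge0.
  move=> w zw; have -> : L w - L z - (c + a * (z - z0)) * (w - z) = (a / 2 * (w - z)) * (w - z).
    by rewrite /L; field.
  rewrite cmodM ler_wpM2r ?cmod_ge0// cmodM.
  have a1 : 0 < cmod (a / 2) + 1 by rewrite ltr_wpDl// cmod_ge0.
  move: zw; rewrite ltr_pdivlMr// cmod_distC => zw.
  by apply: le_trans (ltW zw); rewrite mulrC ler_wpM2l ?cmod_ge0// lerDl.
have hor y : y0 <= y <= y1 ->
    cmod ((P y x1 - P y x0) - (L (pt x1 y) - L (pt x0 y))) <= 2 * e * (x1 - x0).
  move=> yy; have -> : P y x1 - P y x0 - (L (pt x1 y) - L (pt x0 y)) =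
     (P y x1 - L (pt x1 y)) - (P y x0 - L (pt x0 y)) by ring.
  apply: (@curve_mean_value (fun x => P y x - L (pt x y))
     (fun x => f (pt x y) - (c + a * (pt x y - z0)))) => // x xx.
    apply: curve_deriveB; first apply: Pd; first by case/andP: xx; case/andP: x0Q; case/andP: x1Q; lra.
    have -> : (fun s => L (pt s y)) = (fun s : R => L (iC * y%:C + s%:C * 1)).
      by apply/funext => s; rewrite ptE mulr1 addrC.
    have E : iC * y%:C + x%:C * 1 = pt x y by rewrite mulr1 addrC -ptE.
    have -> : c + a * (pt x y - z0) = (c + a * (pt x y - z0)) * 1 by rewrite mulr1.
    exact (is_derive_curve (eq_ind_r (fun u : C => is_derive u (1 : C) L _) (Ld (pt x y)) E)).
  exact: fe.
(* Along a vertical line [L] has derivative [i] times the affine function, so [Q x] is compared with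
   [- i L]. *)
have ver x : x0 <= x <= x1 ->
    cmod (iC * (Q x y1 - Q x y0) - (L (pt x y1) - L (pt x y0))) <= 2 * e * (y1 - y0).
  move=> xx; have -> : iC * (Q x y1 - Q x y0) - (L (pt x y1) - L (pt x y0)) =
     iC * ((Q x y1 - (- iC * L (pt x y1))) - (Q x y0 - (- iC * L (pt x y0)))).
    rewrite mulrBr !mulrBr !mulrA mulrN -expr2 sqr_i opprK !mul1r; ring.
  rewrite cmodM; have -> : cmod iC = 1.
    by rewrite /cmod normc_def /= expr0n add0r expr1n sqrtr1.
  rewrite mul1r.
  apply: (@curve_mean_value (fun y => Q x y - (- iC * L (pt x y)))
     (fun y => f (pt x y) - (c + a * (pt x y - z0)))) => // y yy.
    apply: curve_deriveB; first apply: Qd; first by case/andP: yy; case/andP: y0Q; case/andP: y1Q; lra.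
    have -> : (fun s => - iC * L (pt x s)) =
        (fun s : R => (fun u => - iC * L u) (x%:C + s%:C * iC)).
      by apply/funext => s; rewrite ptE (mulrC iC).
    have -> : c + a * (pt x y - z0) = (- iC * (c + a * (pt x y - z0))) * iC.
      by rewrite mulrAC mulNr -expr2 sqr_i opprK mul1r.
    have E : x%:C + y%:C * iC = pt x y by rewrite ptE (mulrC iC).
    exact (is_derive_curve (eq_ind_r (fun u : C => is_derive u (1 : C) (fun u => - iC * L u) _)
      (is_derive_cmul (- iC) (Ld (pt x y))) E)).
  exact: fe.
have y0i : y0 <= y0 <= y1 by rewrite lexx.
have y1i : y0 <= y1 <= y1 by rewrite lexx andbT.
have x0i : x0 <= x0 <= x1 by rewrite lexx.
have x1i : x0 <= x1 <= x1 by rewrite lexx andbT.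
have -> : I x0 x1 y0 y1 =
   (((P y0 x1 - P y0 x0) - (L (pt x1 y0) - L (pt x0 y0)))
   - ((P y1 x1 - P y1 x0) - (L (pt x1 y1) - L (pt x0 y1))))
   + ((iC * (Q x1 y1 - Q x1 y0) - (L (pt x1 y1) - L (pt x1 y0)))
   - (iC * (Q x0 y1 - Q x0 y0) - (L (pt x0 y1) - L (pt x0 y0)))).
  rewrite /I; ring.
have tri (u v : C) : cmod (u - v) <= cmod u + cmod v.
  by apply: le_trans (cmod_triangle _ _) _; rewrite [cmod (- v)]/cmod normrN.
apply: le_trans (cmod_triangle _ _) _.
have -> : 4 * e * (x1 - x0 + (y1 - y0)) =
  (2 * e * (x1 - x0) + 2 * e * (x1 - x0)) + (2 * e * (y1 - y0) + 2 * e * (y1 - y0)) by ring.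
apply: lerD; apply: le_trans (tri _ _) _; apply: lerD; [exact: hor|exact: hor|exact: ver|exact: ver].
Qed.

Lemma boundary_integral_quarter x0 x1 x2 y0 y1 y2 :
  exists u v : bool,
    cmod (I x0 x2 y0 y2) <= 4 * cmod (I (if u then x1 else x0) (if u then x2 else x1)
                                        (if v then y1 else y0) (if v then y2 else y1)).
Proof.
rewrite (boundary_integral_split x0 x1 x2 y0 y1 y2).
set a := I x0 x1 y0 y1; set b := I x1 x2 y0 y1; set c := I x0 x1 y1 y2; set d := I x1 x2 y1 y2.
have t : cmod (a + b + c + d) <= cmod a + cmod b + cmod c + cmod d.
  apply: le_trans (cmod_triangle _ _) _; rewrite lerD2r.
  by apply: le_trans (cmod_triangle _ _) _; rewrite lerD2r cmod_triangle.
case: (leP (cmod a) (cmod b)) => ab; case: (leP (cmod c) (cmod d)) => cd.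
- case: (leP (cmod b) (cmod d)) => bd; [exists true, true|exists true, false];
  rewrite -/a -/b -/c -/d; lra.
- case: (leP (cmod b) (cmod c)) => bd; [exists false, true|exists true, false];
  rewrite -/a -/b -/c -/d; lra.
- case: (leP (cmod a) (cmod d)) => bd; [exists true, true|exists false, false];
  rewrite -/a -/b -/c -/d; lra.
- case: (leP (cmod a) (cmod c)) => bd; [exists false, true|exists false, false];
  rewrite -/a -/b -/c -/d; lra.
Qed.

(** Goursat's argument: pass repeatedly to a quarter that carries at least a fourth of the integral,
    and differentiate [f] at the common point of the rectangles. The n-th integral is at most
    [4 e ((w + h) / 2 ^ n) ^ 2], which cancels the factor [4 ^ n] exactly. *)
Lemma boundary_integral_eq0_le x0 x1 y0 y1 :
  inQ x0 -> inQ x1 -> inQ y0 -> inQ y1 -> x0 <= x1 -> y0 <= y1 ->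
  I x0 x1 y0 y1 = 0.
Proof.
move=> x0Q x1Q y0Q y1Q x01 y01.
pose w := x1 - x0; pose h := y1 - y0.
have w0 : 0 <= w by rewrite subr_ge0.
have h0 : 0 <= h by rewrite subr_ge0.
pose J n x y := I x (x + w / 2 ^+ n) y (y + h / 2 ^+ n).
have half (r : R) n : r / 2 ^+ n = r / 2 ^+ n.+1 + r / 2 ^+ n.+1.
  by rewrite exprSr invfM mulrA -splitr.
have pos (r : R) n : 0 <= r -> 0 <= r / 2 ^+ n.
  by move=> r0; rewrite divr_ge0// exprn_ge0.
have /choice[step stepP] : forall p : nat * (R * R), exists q : R * R,
   [/\ p.2.1 <= q.1, q.1 + w / 2 ^+ p.1.+1 <= p.2.1 + w / 2 ^+ p.1,
      p.2.2 <= q.2, q.2 + h / 2 ^+ p.1.+1 <= p.2.2 + h / 2 ^+ p.1 &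
      cmod (J p.1 p.2.1 p.2.2) <= 4 * cmod (J p.1.+1 q.1 q.2)].
  case=> n [x y] /=.
  have [u [v H]] := boundary_integral_quarter x (x + w / 2 ^+ n.+1) (x + w / 2 ^+ n)
     y (y + h / 2 ^+ n.+1) (y + h / 2 ^+ n).
  exists (if u then x + w / 2 ^+ n.+1 else x, if v then y + h / 2 ^+ n.+1 else y).
  have Hw := pos w n.+1 w0; have Hh := pos h n.+1 h0.
  move: H; rewrite [J n _ _]/J (half w n) (half h n) !addrA => H.
  split=> //=; try by case: (u) => /=; lra.
  - by case: (v) => /=; lra.
  - by case: (v) => /=; lra.
  - by move: H; case: (u); case: (v).
(* The lower left corners of the nested rectangles, the n-th of which has sides [w / 2 ^ n] and
   [h / 2 ^ n]. *)
pose s := fix s n := if n is m.+1 then step (m, s m) else (x0, y0).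
have sP n := stepP (n, s n).
have [xs xsP] : exists x, forall n, (s n).1 <= x <= (s n).1 + w / 2 ^+ n.
  by apply: nested_halving => // n; have [] := sP n.
have [ys ysP] : exists y, forall n, (s n).2 <= y <= (s n).2 + h / 2 ^+ n.
  by apply: nested_halving => // n; have [] := sP n.
have sub n : [/\ x0 <= (s n).1, (s n).1 + w / 2 ^+ n <= x1, y0 <= (s n).2 &
    (s n).2 + h / 2 ^+ n <= y1].
  elim: n => [|n [a b c d]].
    by rewrite /= !expr0 !divr1 !subrKC !lexx.
  have /= [e1 e2 e3 e4 _] := sP n.
  by split; [exact: le_trans e1|exact: le_trans b|exact: le_trans e3|exact: le_trans d].
have Jn n : cmod (I x0 x1 y0 y1) <= 4 ^+ n * cmod (J n (s n).1 (s n).2).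
  elim: n => [|n IH]; first by rewrite /J /= !expr0 !divr1 !subrKC mul1r.
  apply: le_trans IH _; rewrite exprSr -mulrA ler_wpM2l ?exprn_ge0//.
  by have [] := sP n.
have bnd e : 0 < e -> cmod (I x0 x1 y0 y1) <= 4 * e * (w + h) ^+ 2.
  move=> e0.
  have := xsP 0%N; have := ysP 0%N; rewrite /= !expr0 !divr1 !subrKC => yP xP.
  have [||a /is_derive_cmodP/(_ e e0)/nbhs_cmodP[d d0 D]] := @fd (pt xs ys).
  - rewrite /= ltr_norml; apply/andP; split; lra.
  - rewrite /= ltr_norml; apply/andP; split; lra.
  have [n nd] : exists n, (w + h) / 2 ^+ n < d.
    have wh1 : 0 < w + h + 1 by rewrite ltr_wpDl// addr_ge0.
    have [n _ nP] := near_infty_natSinv_expn_lt (PosNum (divr_gt0 d0 wh1)).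
    exists n; move: (nP n (leqnn n)) => /=.
    rewrite div1r ltr_pdivlMr// => H; apply: le_lt_trans H.
    by rewrite mulrC ler_wpM2l ?invr_ge0 ?exprn_ge0// lerDl.
  apply: le_trans (Jn n) _.
  have [a1 a2 a3 a4] := sub n.
  have pw := pos w n w0; have ph := pos h n h0.
  have xn := xsP n; have yn := ysP n.
  have : cmod (J n (s n).1 (s n).2) <=
      4 * (e * ((w + h) / 2 ^+ n)) * ((w + h) / 2 ^+ n).
    have -> : (w + h) / 2 ^+ n =
      ((s n).1 + w / 2 ^+ n - (s n).1) + ((s n).2 + h / 2 ^+ n - (s n).2).
      by rewrite mulrDl; ring.
    apply: (@boundary_integral_affine _ _ _ _ (pt xs ys) (f (pt xs ys)) a) => //; try lra.
    move=> x y xP' yP'.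
    have dist : cmod (pt x y - pt xs ys) <= (w + h) / 2 ^+ n.
      apply: le_trans (cmod_le_ReIm _) _; rewrite /= mulrDl; apply: lerD; rewrite ler_norml; lra.
    rewrite opprD addrA; apply: le_trans (D _ _) _.
      by rewrite cmod_distC; exact: le_lt_trans dist nd.
    rewrite ler_wpM2l ?(ltW e0)//; apply: le_trans dist _; rewrite mulrDl; lra.
  move=> H; apply: le_trans (ler_wpM2l _ H) _; first by rewrite exprn_ge0.
  have -> : 4 ^+ n * (4 * (e * ((w + h) / 2 ^+ n)) * ((w + h) / 2 ^+ n)) =
      4 * e * (w + h) ^+ 2 * (4 ^+ n / (2 ^+ n * 2 ^+ n)).
    by field; rewrite expf_neq0.
  by rewrite -exprMn -natrM divff ?mulr1// expf_neq0.
apply/eqP; rewrite -cmod0P; apply/eqP/le_anti; rewrite cmod_ge0 andbT.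
apply/ler_addgt0Pr => e e0; rewrite add0r.
have wh : 0 < 4 * (w + h) ^+ 2 + 1 by rewrite ltr_wpDl// mulr_ge0// sqr_ge0.
apply: le_trans (bnd (e / (4 * (w + h) ^+ 2 + 1)) _) _; first by rewrite divr_gt0.
rewrite [leLHS](_ : _ = e * (4 * (w + h) ^+ 2) / (4 * (w + h) ^+ 2 + 1)); last by ring.
by rewrite ler_pdivrMr// ler_wpM2l ?(ltW e0)// lerDl.
Qed.

Lemma boundary_integral_eq0 x0 x1 y0 y1 :
  inQ x0 -> inQ x1 -> inQ y0 -> inQ y1 -> I x0 x1 y0 y1 = 0.
Proof.
have swapx a b c d : I a b c d = - I b a c d by rewrite /I; ring.
have swapy a b c d : I a b c d = - I a b d c by rewrite /I; ring.
move=> x0Q x1Q y0Q y1Q.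
have [x01|/ltW x10] := leP x0 x1; have [y01|/ltW y10] := leP y0 y1.
- exact: boundary_integral_eq0_le.
- by rewrite swapy boundary_integral_eq0_le// oppr0.
- by rewrite swapx boundary_integral_eq0_le// oppr0.
- by rewrite swapx swapy boundary_integral_eq0_le// !oppr0.
Qed.

End Goursat.

(** * Primitives on squares *)

Section Primitive.
Variable R : realType.
Local Notation C := (Cplx R).
Local Notation Re := (@complex.Re R).
Local Notation Im := (@complex.Im R).
Local Notation "x %:C" := (real_complex R x : C) (format "x %:C").
Local Notation iC := ('i%C : C).
Local Notation pt x y := ((x : R) +i* (y : R))%C.
Implicit Types z w : C.

Definition open_square (r : R) : set C := [set z | `|Re z| < r /\ `|Im z| < r].

Lemma is_derive_continuous (f : C -> C) z (a : C) :
  is_derive z 1 f a -> {for z, continuous f}.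
Proof.
move=> [fa _]; apply: differentiable_continuous; exact/derivable1_diffP.
Qed.

Lemma cmod_ptB x y x' y' : cmod (pt x y - pt x' y' : C) <= `|x - x'| + `|y - y'|.
Proof. exact: cmod_le_ReIm. Qed.

(** Integrate from 0 along the real axis, then vertically. By Goursat's lemma the increment of [F]
    from [x + i y] to [x' + i y'] can be taken along the horizontal segment at height [y] and the
    vertical one over [x'], where [f] is nearly constant. *)
Lemma complex_primitive (f : C -> C) (rho : R) : continuous f ->
  (forall z, open_square rho z -> exists a : C, is_derive z 1 f a) ->
  exists F : C -> C, forall z, open_square rho z -> is_derive z 1 F (f z).
Proof.
move=> fc fd.
have fd' z : `|Re z| < rho -> `|Im z| < rho -> exists a : C, is_derive z 1 f a.
  by move=> z1 z2; apply: fd.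
have /choice[P Pd] : forall y : R, exists p : R -> C, forall x, - rho < x < rho ->
    curve_derive p x (f (pt x y)).
  move=> y; apply: (@continuous_curve_primitive _ (fun x => f (pt x y))) => x.
  apply: (@continuous_comp R C C (fun x => pt x y : C) f); last exact: fc.
  by apply: Complex_continuous => t; [exact: cvg_id|exact: cvg_cst].
have /choice[Q Qd] : forall x : R, exists p : R -> C, forall y, - rho < y < rho ->
    curve_derive p y (f (pt x y)).
  move=> x; apply: (@continuous_curve_primitive _ (fun y => f (pt x y))) => y.
  apply: (@continuous_comp R C C (fun y => pt x y : C) f); last exact: fc.
  by apply: Complex_continuous => t; [exact: cvg_cst|exact: cvg_id].
exists (fun z => P 0 (Re z) - P 0 0 + iC * (Q (Re z) (Im z) - Q (Re z) 0)).
case=> x y [/= xr yr].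
have rho0 : 0 < rho by apply: le_lt_trans xr.
apply/is_derive_cmodP => e e0.
have e4 : 0 < e / 4 by rewrite divr_gt0.
have /cmod_cvgP/(_ _ e4)/nbhs_cmodP[d d0 D] := fc (pt x y).
(* Distances are estimated by the sum of a horizontal and a vertical one, each below [d / 2]; the
   other two terms keep the path inside the square. *)
pose d1 := Num.min (d / 2) (Num.min (rho - `|x|) (rho - `|y|)).
have d10 : 0 < d1 by rewrite !lt_min !subr_gt0 xr yr divr_gt0.
apply/nbhs_cmodP; exists d1 => // -[x' y'] xy'.
have xx : `|x' - x| < d1.
  by apply: le_lt_trans xy'; rewrite distrC; exact: (Re_le_cmod (pt x y - pt x' y' : C)).
have yy : `|y' - y| < d1.
  by apply: le_lt_trans xy'; rewrite distrC; exact: (Im_le_cmod (pt x y - pt x' y' : C)).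
have inx t : `|t - x| < d1 -> - rho < t < rho.
  rewrite !lt_min => /andP[_ /andP[+ _]]; rewrite -ltr_norml => tx.
  by have := ler_normD (t - x) x; rewrite subrK; lra.
have iny t : `|t - y| < d1 -> - rho < t < rho.
  rewrite !lt_min => /andP[_ /andP[_ +]]; rewrite -ltr_norml => tx.
  by have := ler_normD (t - y) y; rewrite subrK; lra.
have d1d : d1 <= d / 2 by rewrite /d1 ge_min lexx.
have G := @boundary_integral_eq0 R f rho fd' P Q Pd Qd x x' 0 y.
have {}G := G (inx x _) (inx x' xx) _ (iny y _).
rewrite !subrr !normr0 oppr_lt0 rho0 in G.
have {}G := G d10 isT d10; rewrite /boundary_integral in G.
have -> : P 0 x' - P 0 0 + iC * (Q x' y' - Q x' 0) - (P 0 x - P 0 0 + iC * (Q x y - Q x 0))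
    - f (pt x y) * (pt x' y' - pt x y)
  = (P y x' - P y x - f (pt x y) * (x' - x)%:C) + iC * (Q x' y' - Q x' y - f (pt x y) * (y' - y)%:C).
  have -> : pt x' y' - pt x y = (x' - x)%:C + iC * (y' - y)%:C.
    by rewrite -ptE.
  move: G; set a := P 0 x'; set b := P 0 x; set c := P 0 0; set g := Q x' 0; set h := Q x 0.
  set a1 := P y x'; set b1 := P y x; set Q1 := Q x' y; set Q2 := Q x y; set Q3 := Q x' y' => G.
  have -> : a = b + (a1 - b1) - iC * (Q1 - g - (Q2 - h)).
    by apply/eqP; rewrite -subr_eq0; apply/eqP; rewrite -[RHS]G; ring.
  by ring.
have hor : cmod (P y x' - P y x - f (pt x y) * (x' - x)%:C) <= 2 * (e / 4) * `|x' - x|.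
  have -> : P y x' - P y x - f (pt x y) * (x' - x)%:C =
    (P y x' - f (pt x y) * (0 + x'%:C * 1)) - (P y x - f (pt x y) * (0 + x%:C * 1)).
    by rewrite rmorphB; ring.
  apply: (@curve_mean_value_sym _ (fun t => P y t - f (pt x y) * (0 + t%:C * 1))
     (fun t => f (pt t y) - f (pt x y) * 1)) => t tx.
    apply: curve_deriveB; first by apply: Pd; apply: inx; exact: le_lt_trans xx.
    apply: (@is_derive_curve _ (fun u => f (pt x y) * u)).
    by rewrite -[X in is_derive _ _ _ X]mulr1; apply: is_derive_cmul.
  rewrite mulr1 cmod_distC; apply/ltW/D.
  apply: le_lt_trans (cmod_ptB _ _ _ _) _; rewrite subrr normr0 addr0 distrC.
  apply: le_lt_trans tx _; apply: lt_le_trans xx _; lra.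
have ver : cmod (Q x' y' - Q x' y - f (pt x y) * (y' - y)%:C) <= 2 * (e / 4) * `|y' - y|.
  have -> : Q x' y' - Q x' y - f (pt x y) * (y' - y)%:C =
    (Q x' y' - f (pt x y) * (0 + y'%:C * 1)) - (Q x' y - f (pt x y) * (0 + y%:C * 1)).
    by rewrite rmorphB; ring.
  apply: (@curve_mean_value_sym _ (fun t => Q x' t - f (pt x y) * (0 + t%:C * 1))
     (fun t => f (pt x' t) - f (pt x y) * 1)) => t ty.
    apply: curve_deriveB; first by apply: Qd; apply: iny; exact: le_lt_trans yy.
    apply: (@is_derive_curve _ (fun u => f (pt x y) * u)).
    by rewrite -[X in is_derive _ _ _ X]mulr1; apply: is_derive_cmul.
  rewrite mulr1 cmod_distC; apply/ltW/D.
  apply: le_lt_trans (cmod_ptB _ _ _ _) _; rewrite (distrC x) (distrC y).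
  have := le_lt_trans ty yy; lra.
apply: le_trans (cmod_triangle _ _) _; rewrite cmodM.
have -> : cmod iC = 1 by rewrite /cmod normc_def /= expr0n add0r expr1n sqrtr1.
rewrite mul1r; apply: le_trans (lerD hor ver) _.
have /= h1 := Re_le_cmod (pt x' y' - pt x y : C).
have /= h2 := Im_le_cmod (pt x' y' - pt x y : C).
rewrite -mulrDr (_ : 2 * (e / 4) = e * 2^-1); last by field.
rewrite -mulrA ler_wpM2l ?(ltW e0)//; lra.
Qed.

End Primitive.

(** * A maximum principle on squares *)

Section MaximumModulus.
Variable R : realType.
Local Notation C := (Cplx R).
Local Notation Re := (@complex.Re R).
Local Notation Im := (@complex.Im R).
Local Notation "x %:C" := (real_complex R x : C) (format "x %:C").
Local Notation iC := ('i%C : C).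
Local Notation pt x y := ((x : R) +i* (y : R))%C.
Implicit Types z w : C.

Lemma cmod_i : cmod iC = 1.
Proof. by rewrite /cmod normc_def /= expr0n add0r expr1n sqrtr1. Qed.

Definition closed_square (r : R) : set C := [set z | `|Re z| <= r /\ `|Im z| <= r].

Lemma closed_square_compact r : compact (closed_square r).
Proof.
have -> : closed_square r = (fun p : R * R => pt p.1 p.2 : C) @` (`[- r, r] `*` `[- r, r])%classic.
  apply/seteqP; split=> [[x y] [/= xr yr]|_ [[x y] [/= xr yr] <-]].
    by exists (x, y) => //; split; rewrite /= in_itv /= -ler_norml.
  by split; move: xr yr; rewrite /= !in_itv /= -!ler_norml.
apply: continuous_compact; last by apply: compact_setX; exact: segment_compact.
apply: continuous_subspaceT.
by apply: Complex_continuous => t; [exact: cvg_fst|exact: cvg_snd].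
Qed.

Definition sqmod z : R := Re z ^+ 2 + Im z ^+ 2.

Lemma sqmod_quarter_turns (z : C) (t : R) :
  sqmod (z + t%:C * 1) + sqmod (z + t%:C * iC) + sqmod (z + t%:C * (-1)) + sqmod (z + t%:C * (- iC))
  = 4 * sqmod z + 4 * t ^+ 2.
Proof. by case: z => x y; rewrite /sqmod /=; ring. Qed.

(* The four derivative terms cancel to first order since 1 + i - 1 - i = 0 and
   1 + i^2 + 1 + i^2 = 0: a complex version of the mean value property. *)
Lemma quarter_turn_sum (f f' : C -> C) (z a : C) (e d : R) : 0 < e ->
  (forall w, cmod (w - z) <= d -> is_derive w 1 f (f' w)) ->
  (forall w, cmod (w - z) <= d -> cmod (f' w - f' z - a * (w - z)) <= e * cmod (w - z)) ->
  let s t := Re (f (z + t%:C * 1)) + Re (f (z + t%:C * iC)) + Re (f (z + t%:C * (-1)))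
      + Re (f (z + t%:C * (- iC))) in
  0 <= d -> `|s d - s 0| <= 4 * e * d ^+ 2.
Proof.
move=> e0 fd fe s d0.
have near w t : cmod w = 1 -> 0 <= t <= d -> cmod (z + t%:C * w - z) = t.
  by move=> w1 /andP[t0 _]; rewrite addrAC subrr add0r cmodM w1 mulr1 cmod_real ger0_norm.
have m1 : cmod (1 : C) = 1 by rewrite -(rmorph1 (real_complex R)) cmod_real normr1.
have mi := cmod_i.
have m1' : cmod (-1 : C) = 1 by rewrite cmodN.
have mi' : cmod (- iC) = 1 by rewrite cmodN.
pose r w := f' w - f' z - a * (w - z).
pose ds t := Re (f' (z + t%:C * 1) * 1) + Re (f' (z + t%:C * iC) * iC)
  + Re (f' (z + t%:C * (-1)) * -1) + Re (f' (z + t%:C * (- iC)) * - iC).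
have sd t : 0 <= t <= d -> is_derive t 1 s (ds t).
  move=> td.
  have D w : cmod w = 1 -> is_derive t 1 (fun x : R => Re (f (z + x%:C * w))) (Re (f' (z + t%:C * w) * w)).
    by move=> w1; apply: is_derive_Re; apply: fd; rewrite near//; case/andP: td.
  exact: (is_deriveD (is_deriveD (is_deriveD (D _ m1) (D _ mi)) (D _ m1')) (D _ mi')).
have dsE t : ds t = Re (r (z + t%:C * 1) * 1) + Re (r (z + t%:C * iC) * iC)
  + Re (r (z + t%:C * (-1)) * -1) + Re (r (z + t%:C * (- iC)) * - iC).
  have ReD (u v : C) : Re u + Re v = Re (u + v) by case: u v => [? ?] [].
  rewrite /ds /r !ReD; congr Re.
  have ii : iC * iC = -1 by rewrite -expr2 sqr_i.
  rewrite [RHS](_ : _ = f' (z + t%:C * 1) * 1 + f' (z + t%:C * iC) * iC +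
    f' (z + t%:C * -1) * -1 + f' (z + t%:C * - iC) * - iC
    - a * t%:C * (2 + 2 * (iC * iC))); last by ring.
  by rewrite (_ : 2 + 2 * (iC * iC) = 0) ?mulr0 ?subr0// ii; ring.
rewrite expr2 mulrA -[X in _ * X]subr0.
apply: (@mean_value_bound _ s ds) => // t td.
have dt : t <= d by case/andP: td.
have B w : cmod w = 1 -> `|Re (r (z + t%:C * w) * w)| <= e * d.
  move=> w1; apply: le_trans (Re_le_cmod _) _; rewrite cmodM w1 mulr1.
  by apply: le_trans (fe _ _) _; rewrite near// ler_wpM2l// ltW.
rewrite dsE -mulrA (_ : 4 * (e * d) = e * d + e * d + e * d + e * d); last by ring.
apply: le_trans (ler_normD _ _) _; apply: lerD; last exact: B.
apply: le_trans (ler_normD _ _) _; apply: lerD; last exact: B.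
by apply: le_trans (ler_normD _ _) _; apply: lerD; exact: B.
Qed.

(* At an interior maximum of Re (c f) + del |z|^2 the second-order expansion along
   the four directions would be positive. *)
Lemma max_modulus_square (f f' : C -> C) (rho rho' M : R) :
  0 < rho -> rho < rho' ->
  (forall z, open_square rho' z -> is_derive z 1 f (f' z)) ->
  (forall z, open_square rho' z -> exists a : C, is_derive z 1 f' a) ->
  (forall z, closed_square rho z -> ~ open_square rho z -> cmod (f z) <= M) ->
  forall z, closed_square rho z -> cmod (f z) <= M.
Proof.
move=> rho0 rr' fd fd2 fM z1 z1Q; rewrite leNgt; apply/negP => Mz1.
have sub z : closed_square rho z -> open_square rho' z.
  by case=> a b; split; exact: le_lt_trans rr'.
have M0 : 0 <= M.
  apply: le_trans (cmod_ge0 _) (fM (pt rho 0) _ _).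
    by split; rewrite /= ?normr0 ?(ltW rho0)// gtr0_norm.
  by case; rewrite /= gtr0_norm// ltxx.
set m := cmod (f z1) in Mz1.
have fz1 : f z1 != 0 by rewrite -cmod0P gt_eqF// (le_lt_trans M0).
(* A rotation: [c] has modulus 1 and turns [f z1] into the real number [m], so that a real part can
   be maximized instead of a modulus. *)
pose c := m%:C / f z1.
have c1 : cmod c = 1.
  by rewrite cmodM cmodV cmod_real ger0_norm ?cmod_ge0// divff// cmod0P.
pose g z := c * f z.
have gle z : Re (g z) <= cmod (f z).
  apply: le_trans (ler_norm _) _; apply: le_trans (Re_le_cmod _) _.
  by rewrite cmodM c1 mul1r.
have gz1 : Re (g z1) = m by rewrite /g /c mulfVK.
(* So small that [del * sqmod], at most [2 * del * rho ^+ 2] on the square, cannot make up for the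
   gap [m - M]: the maximum of [v] is not on the boundary. *)
pose del := (m - M) / (4 * rho ^+ 2 + 1).
have r1 : 0 < 4 * rho ^+ 2 + 1 by rewrite ltr_wpDl// mulr_ge0// sqr_ge0.
have del0 : 0 < del by rewrite divr_gt0// subr_gt0.
pose v z := Re (g z) + del * sqmod z.
have [|||z0 z0Q vmax] := @compact_EVT_max _ R v (closed_square rho).
- by exists z1.
- exact: closed_square_compact.
- apply: continuous_in_subspaceT => z /set_mem zQ.
  have gc : {for z, continuous (Re \o g)}.
    apply: (@continuous_comp C C R g Re); last exact: Re_continuous.
    exact: is_derive_continuous (is_derive_cmul c (fd z (sub z zQ))).
  have sc : {for z, continuous sqmod}.
    exact: (cvgD (continuous_comp (@Re_continuous R z) (@exprn_continuous _ 2 _))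
                 (continuous_comp (@Im_continuous R z) (@exprn_continuous _ 2 _))).
  exact: (cvgD gc (cvgM (cvg_cst del) sc)).
have sq z : closed_square rho z -> 0 <= sqmod z <= 2 * rho ^+ 2.
  case=> a b; rewrite addr_ge0 ?sqr_ge0//= mulr_natl mulr2n lerD//.
    by rewrite -[_ ^+ 2]real_normK ?num_real// lerXn2r ?nnegrE// ltW.
  by rewrite -[_ ^+ 2]real_normK ?num_real// lerXn2r ?nnegrE// ltW.
have z0o : open_square rho z0.
  apply: contrapT => z0b.
  have := vmax z1 (mem_set z1Q); apply/negP; rewrite -ltNge /v gz1.
  have /andP[p1 _] := sq z1 z1Q.
  have /andP[_ p2] := sq z0 (set_mem z0Q).
  have h1 := le_trans (gle z0) (fM z0 (set_mem z0Q) z0b).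
  have h2 : del * sqmod z0 <= del * (2 * rho ^+ 2) by rewrite ler_wpM2l// ltW.
  have h3 : 0 <= del * sqmod z1 by rewrite mulr_ge0// ltW.
  have h4 : del * (4 * rho ^+ 2 + 1) = m - M by rewrite /del divfK// gt_eqF.
  have h5 : 0 <= del * rho ^+ 2 by rewrite mulr_ge0 ?sqr_ge0// ltW.
  lra.
have z0s := sub z0 (set_mem z0Q).
have [a fa] := fd2 z0 z0s.
pose g' z := c * f' z.
have gd z : open_square rho' z -> is_derive z 1 g (g' z) by move=> /fd h; exact: is_derive_cmul.
have gd2 : is_derive z0 1 g' (c * a) by exact: is_derive_cmul.
(* At this precision the four values of [Re g] lose at most [2 * del * t ^+ 2] together, while those
   of [del * sqmod] gain [4 * del * t ^+ 2]. *)
have e0 : 0 < del / 2 by rewrite divr_gt0.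
have /is_derive_cmodP/(_ _ e0)/nbhs_cmodP[d d0 D] := gd2.
have [x0 y0] := z0o.
pose t := Num.min (d / 2) (Num.min (rho - `|Re z0|) (rho - `|Im z0|)).
have t0 : 0 < t by rewrite !lt_min !subr_gt0 x0 y0 divr_gt0.
have inQ w : cmod (w - z0) <= t -> closed_square rho w.
  rewrite !le_min => /andP[_ /andP[h1 h2]].
  have ReB : Re (w - z0) = Re w - Re z0 by rewrite ReB.
  have ImB : Im (w - z0) = Im w - Im z0 by rewrite ImB.
  split.
    rewrite -(subrK (Re z0) (Re w)) -ReB; apply: le_trans (ler_normD _ _) _.
    by rewrite -lerBrDr; exact: le_trans (Re_le_cmod _) _.
  rewrite -(subrK (Im z0) (Im w)) -ImB; apply: le_trans (ler_normD _ _) _.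
  by rewrite -lerBrDr; exact: le_trans (Im_le_cmod _) _.
have := @quarter_turn_sum g g' z0 (c * a) (del / 2) t e0.
set s := fun t0 : R => _ => /=.
have h w : cmod (w - z0) <= t -> is_derive w 1 g (g' w).
  by move=> /inQ/sub; exact: gd.
have h' w : cmod (w - z0) <= t -> cmod (g' w - g' z0 - c * a * (w - z0)) <= del / 2 * cmod (w - z0).
  rewrite !le_min => /andP[wt _]; apply: D; rewrite cmod_distC.
  apply: le_lt_trans wt _; lra.
move=> /(_ h h' (ltW t0)).
have s0 : s 0 = 4 * Re (g z0) by rewrite /s rmorph0 !mul0r addr0; ring.
have vm w : cmod w = 1 -> Re (g (z0 + t%:C * w)) + del * sqmod (z0 + t%:C * w) <= v z0.
  move=> w1; apply: vmax; apply/mem_set; apply: inQ.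
  by rewrite addrAC subrr add0r cmodM w1 mulr1 cmod_real ger0_norm// ltW.
have m1 : cmod (1 : C) = 1 by rewrite -(rmorph1 (real_complex R)) cmod_real normr1.
have v1 := vm 1 m1; have v2 := vm iC cmod_i.
have v3 : _ := vm (-1) (etrans (cmodN _) m1); have v4 := vm (- iC) (etrans (cmodN _) cmod_i).
have sq4 : del * sqmod (z0 + t%:C * 1) + del * sqmod (z0 + t%:C * iC) +
   del * sqmod (z0 + t%:C * (-1)) + del * sqmod (z0 + t%:C * (- iC)) =
   4 * (del * sqmod z0) + 4 * (del * t ^+ 2).
  by rewrite -!mulrDr sqmod_quarter_turns; ring.
have tt : 0 < del * t ^+ 2 by rewrite mulr_gt0// exprn_gt0.
rewrite s0 ler_norml => /andP[+ _].
rewrite (_ : 4 * (del / 2) * t ^+ 2 = 2 * (del * t ^+ 2)); last by field.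
have : s t + (4 * (del * sqmod z0) + 4 * (del * t ^+ 2)) <= 4 * v z0.
  rewrite -sq4 /s; move: v1 v2 v3 v4; lra.
rewrite /v; lra.
Qed.

End MaximumModulus.

(** * The identity theorem in one variable *)

Section IdentityDisc.
Variable R : realType.
Local Notation C := (Cplx R).
Local Notation Re := (@complex.Re R).
Local Notation Im := (@complex.Im R).
Local Notation "x %:C" := (real_complex R x : C) (format "x %:C").
Local Notation iC := ('i%C : C).
Local Notation pt x y := ((x : R) +i* (y : R))%C.
Implicit Types z w : C.

Lemma is_derive_cexp (k : nat) z : z != 0 ->
  is_derive z 1 (fun w : C => w^-1 ^+ k) (- k%:R * z^-1 ^+ k.+1).
Proof.
move=> z0; have dV : is_derive z 1 (fun w : C => w^-1) (- z^-1 ^+ 2).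
  have H := @der_inv C C idfun z 1 z0 (@derivable_id _ _ _ _).
  have E : - (idfun z) ^- 2 *: 'D_1 idfun z = - z^-1 ^+ 2.
    by rewrite derive_id [LHS]mulr1 exprVn.
  rewrite E in H.
  by apply: DeriveDef; [apply/cvg_ex; eexists; exact: H|apply: cvg_lim => //; exact: H].
have H := @is_deriveX _ _ (fun w : C => w^-1) k z 1 _ dV.
have -> : (fun w : C => w^-1 ^+ k) = (fun w : C => w^-1) ^+ k.
  by apply/funext => w; rewrite exprfctE.
apply: (is_derive_eq H).
case: k {H} => [|k]; first by rewrite mul0r oppr0 mul0r scale0r.
rewrite -pred_Sn (_ : forall u v : C, u *: v = u * v)//.
by rewrite mulrN -mulrA -exprD addn2 mulNr.
Qed.

(* Junk values help here: [0^-1 = 0], so the quotients below vanish at [0]. *)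
Lemma is_derive_quot (f : C -> C) (k : nat) z a :
  (\forall w \near (0 : C), f w = 0) -> is_derive z 1 f a ->
  is_derive z 1 (fun w => f w * w^-1 ^+ k)
    (a * z^-1 ^+ k - k%:R * (f z * z^-1 ^+ k.+1)).
Proof.
move=> f0 fa; have [z0|z0] := eqVneq z 0.
  rewrite z0 in fa *.
  have a0 : a = 0.
    have : is_derive (0 : C) 1 f 0.
      apply: (@near_eq_is_derive _ _ _ (cst 0)).
      by apply: filterS f0 => w ->.
    by move=> [_ <-]; case: fa => _ <-.
  rewrite a0 mul0r (nbhs_singleton f0) mul0r mulr0 subrr.
  apply: (@near_eq_is_derive _ _ _ (cst 0)).
  by apply: filterS f0 => w ->; rewrite mul0r.
have H := is_deriveM fa (is_derive_cexp k z0).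
apply: (is_derive_eq H).
rewrite !(_ : forall u v : C, u *: v = u * v)//.
by rewrite addrC (mulrC _ a) mulNr mulrN mulrCA.
Qed.

(* The maximum principle applied to F / z^k, which is bounded by B / rho^k on the
   boundary of the square, gives |F z| <= B (|z| / rho)^k for all k. *)
Lemma identity_twice (F f : C -> C) (rho rho' : R) : 0 < rho -> rho < rho' ->
  (forall z, open_square rho' z -> is_derive z 1 F (f z)) ->
  (forall z, open_square rho' z -> exists a : C, is_derive z 1 f a) ->
  (\forall z \near (0 : C), F z = 0) ->
  forall z, cmod z < rho -> F z = 0.
Proof.
move=> rho0 rr' Fd fd F0 z zr.
have f0 : \forall z \near (0 : C), f z = 0.
  have : \forall z \near (0 : C), open_square rho' z.
    apply/nbhs_cmodP; exists rho' => [|w]; first exact: lt_trans rr'.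
    rewrite sub0r cmodN => wr; split.
      exact: le_lt_trans (Re_le_cmod _) wr.
    exact: le_lt_trans (Im_le_cmod _) wr.
  move=> S; have /nbhs_interior := F0; apply: filterS2 S => w wS wF.
  have [_ <-] := Fd w wS.
  have : is_derive w 1 F 0.
    apply: (@near_eq_is_derive _ _ _ (cst 0)).
    by apply: filterS wF => u ->.
  by case.
have sub w : closed_square rho w -> open_square rho' w.
  by case=> a b; split; exact: le_lt_trans rr'.
have [B BP] : exists B : R, forall w, closed_square rho w -> cmod (F w) <= B.
  have [|||w0 _ wmax] := @compact_EVT_max _ R (cmod (R:=R) \o F) (closed_square rho).
  - by exists 0; split; rewrite /= normr0 ltW.
  - exact: closed_square_compact.
  - apply: continuous_in_subspaceT => w /set_mem wQ.
    apply: (@continuous_comp C C R F (cmod (R:=R))); last exact: cmod_continuous.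
    exact: is_derive_continuous (Fd w (sub w wQ)).
  by exists (cmod (F w0)) => w wQ; apply: wmax; apply/mem_set.
have zQ : closed_square rho z.
  split; first exact: le_trans (Re_le_cmod _) (ltW zr).
  exact: le_trans (Im_le_cmod _) (ltW zr).
have bnd k : cmod (F z) <= B * (cmod z / rho) ^+ k.
  have [->|z0] := eqVneq z 0.
    rewrite (nbhs_singleton F0) (_ : cmod 0 = 0) ?mul0r ?mulr_ge0 ?exprn_ge0//.
      by apply: le_trans (cmod_ge0 _) (BP z zQ).
    by apply/eqP; rewrite cmod0P.
  have zp : 0 < cmod z by rewrite lt_neqAle eq_sym cmod0P z0 cmod_ge0.
  have := @max_modulus_square R (fun w => F w * w^-1 ^+ k)
     (fun w => f w * w^-1 ^+ k - k%:R * (F w * w^-1 ^+ k.+1)) rho rho' (B / rho ^+ k) rho0 rr'.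
  have d1 w : open_square rho' w -> is_derive w 1 (fun w => F w * w^-1 ^+ k)
      (f w * w^-1 ^+ k - k%:R * (F w * w^-1 ^+ k.+1)).
    by move=> wS; apply: is_derive_quot => //; exact: Fd.
  have d2 w : open_square rho' w -> exists a : C, is_derive w 1
      (fun w => f w * w^-1 ^+ k - k%:R * (F w * w^-1 ^+ k.+1)) a.
    move=> wS; have [a fa] := fd w wS.
    have h1 := is_derive_quot k f0 fa.
    have h2 := is_derive_cmul k%:R (is_derive_quot k.+1 F0 (Fd w wS)).
    eexists; exact: (is_deriveB h1 h2).
  have d3 w : closed_square rho w -> ~ open_square rho w -> cmod (F w * w^-1 ^+ k) <= B / rho ^+ k.
    move=> wQ wS; rewrite cmodM cmodX cmodV exprVn.
    have rw : rho <= cmod w.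
      rewrite leNgt; apply/negP => h; apply: wS; split.
        exact: le_lt_trans (Re_le_cmod _) h.
      exact: le_lt_trans (Im_le_cmod _) h.
    apply: ler_pM; rewrite ?cmod_ge0 ?invr_ge0 ?exprn_ge0 ?cmod_ge0 ?BP//.
    have wp := lt_le_trans rho0 rw.
    rewrite lef_pV2 ?posrE ?exprn_gt0//.
    by apply: lerXn2r => //; rewrite nnegrE ltW.
  move=> /(_ d1 d2 d3 z zQ); rewrite cmodM cmodX cmodV exprVn.
  rewrite ler_pdivrMr ?exprn_gt0// => /le_trans; apply.
  by rewrite expr_div_n mulrAC mulrA.
apply/eqP; rewrite -cmod0P; apply/eqP/le_anti; rewrite cmod_ge0 andbT.
have q1 : `|cmod z / rho| < 1.
  by rewrite ger0_norm ?divr_ge0 ?cmod_ge0 ?ltW// ltr_pdivrMr// mul1r.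
have lim : (fun k => B * (cmod z / rho) ^+ k) @ \oo --> B * 0.
  by apply: cvgM; [exact: cvg_cst|exact: cvg_expr].
rewrite mulr0 in lim; apply: (cvgr_to_ge lim); exact: nearW.
Qed.

(** The maximum principle asks for two derivatives, and [f] comes with one. So [identity_twice] is
    applied to a primitive of [f], and the result is differentiated. *)
Lemma identity_square (f : C -> C) (rho : R) :
  (forall z, open_square rho z -> exists a : C, is_derive z 1 f a) ->
  (\forall z \near (0 : C), f z = 0) ->
  forall z, cmod z < rho -> f z = 0.
Proof.
move=> fd f0 z zr.
(* Radii [cmod z < r0 < r1 < r2 < rho]: the primitive is shown to vanish within [r0], it is
   differentiable on the square [r1], and arguments are clamped to the square [r2]. *)
pose r0 := (cmod z + rho) / 2.
pose r1 := (r0 + rho) / 2.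
pose r2 := (r1 + rho) / 2.
have z0 := cmod_ge0 z.
have [r00 zr0 r01] : [/\ 0 < r0, cmod z < r0 & r0 < r1] by rewrite /r1 /r0; split; lra.
have [r12 r2r] : r1 < r2 /\ r2 < rho by rewrite /r2 /r1 /r0; split; lra.
pose cl (x : R) := Num.max (- r2) (Num.min r2 x).
have cl_id x : `|x| <= r2 -> cl x = x.
  by rewrite ler_norml => /andP[a b]; rewrite /cl (min_idPr b) (max_idPr a).
have cl_le x : `|cl x| <= r2.
  by rewrite ler_norml /cl le_max lexx /= ge_max ge_min lexx andbT; lra.
have cl_c : continuous cl.
  move=> x; apply: (@continuous_max R R (cst (- r2)) (fun x => Num.min r2 x)); first exact: cvg_cst.
  by apply: (@continuous_min R R (cst r2) id); [exact: cvg_cst|exact: cvg_id].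
(* Clamping the argument makes [f] continuous on the whole plane, as [complex_primitive] requires,
   without changing it on the smaller square. *)
pose g z := f (pt (cl (Re z)) (cl (Im z))).
have gE w : closed_square r2 w -> g w = f w.
  by case=> a b; rewrite /g !cl_id//; case: (w).
have gc : continuous g.
  move=> w; apply: (@continuous_comp C C C (fun z => pt (cl (Re z)) (cl (Im z)) : C) f).
    apply: Complex_continuous => u.
      by apply: (@continuous_comp C R R Re cl); [exact: Re_continuous|exact: cl_c].
    by apply: (@continuous_comp C R R Im cl); [exact: Im_continuous|exact: cl_c].
  have [|a] := fd (pt (cl (Re w)) (cl (Im w))); last exact: is_derive_continuous.
  by split; exact: le_lt_trans (cl_le _) r2r.
have open_near r w : open_square r w -> \forall u \near w, open_square r u.
  case=> a b; apply/nbhs_cmodP; exists (Num.min (r - `|Re w|) (r - `|Im w|)).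
    by rewrite lt_min !subr_gt0 a b.
  move=> u; rewrite lt_min cmod_distC => /andP[h1 h2]; split.
    rewrite -(subrK (Re w) (Re u)) -ReB; apply: le_lt_trans (ler_normD _ _) _.
    by rewrite -ltrBrDr; exact: le_lt_trans (Re_le_cmod _) _.
  rewrite -(subrK (Im w) (Im u)) -ImB; apply: le_lt_trans (ler_normD _ _) _.
  by rewrite -ltrBrDr; exact: le_lt_trans (Im_le_cmod _) _.
have gd w : open_square r1 w -> exists a : C, is_derive w 1 g a.
  move=> [a b].
  have wr2 : open_square r2 w by split; exact: lt_trans r12.
  have [|c fc] := fd w; first by split; apply: lt_trans r2r; case: wr2.
  exists c; apply: near_eq_is_derive fc.
  by apply: filterS (open_near _ _ wr2) => u [u1 u2]; rewrite gE//; split; exact: ltW.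
have g0 : \forall w \near (0 : C), g w = 0.
  have : open_square r2 0 by split; rewrite /= normr0; lra.
  move=> /open_near; apply: filterS2 f0 => w fw [w1 w2].
  by rewrite gE//; split; exact: ltW.
have [F0 F0d] := complex_primitive gc gd.
pose F w := F0 w - F0 0.
have Fd w : open_square r1 w -> is_derive w 1 F (g w).
  move=> /F0d h; rewrite -[g w]subr0; exact: (is_deriveB h (is_derive_cst _ _ _)).
(* [F] vanishes at 0, and its derivative vanishes along the segment from 0 to any nearby point. *)
have Fn : \forall w \near (0 : C), F w = 0.
  move/nbhs_cmodP : g0 => [d d0 D].
  apply/nbhs_cmodP; exists (Num.min d r1) => [|w]; first by rewrite lt_min d0/=; lra.
  rewrite sub0r cmodN lt_min => /andP[wd wr].
  have tw t : 0 <= t <= 1 -> cmod (0 + t%:C * w) <= cmod w.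
    case/andP=> t0 t1; rewrite add0r cmodM cmod_real ger0_norm//.
    by rewrite ler_piMl// cmod_ge0.
  have Ft t : 0 <= t <= 1 -> curve_derive (fun t => F (0 + t%:C * w)) t (0 * w).
    move=> t01; have E : g (0 + t%:C * w) = 0.
      by apply: D; rewrite sub0r cmodN; exact: le_lt_trans (tw _ t01) wd.
    have S : open_square r1 (0 + t%:C * w).
      split; first by apply: le_lt_trans (Re_le_cmod _) _; exact: le_lt_trans (tw _ t01) wr.
      by apply: le_lt_trans (Im_le_cmod _) _; exact: le_lt_trans (tw _ t01) wr.
    by have := Fd _ S; rewrite E => h; exact: (is_derive_curve h).
  have F't (t : R) : 0 <= t <= 1 -> cmod (0 * w) <= 0.
    by rewrite mul0r (_ : cmod 0 = 0)//; apply/eqP; rewrite cmod0P.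
  have := curve_mean_value ler01 Ft F't.
  rewrite mulr0 mul0r rmorph1 rmorph0 mul0r mul1r !add0r.
  have -> : F 0 = 0 by rewrite /F subrr.
  rewrite subr0 => h; apply/eqP; rewrite -cmod0P; apply/eqP/le_anti.
  by rewrite h cmod_ge0.
have Fz := identity_twice r00 r01 Fd gd Fn.
have zQ : closed_square r2 z.
  split; [apply: le_trans (Re_le_cmod _) _|apply: le_trans (Im_le_cmod _) _]; lra.
rewrite -(gE z zQ).
have zS : open_square r1 z.
  split; [apply: le_lt_trans (Re_le_cmod _) _|apply: le_lt_trans (Im_le_cmod _) _]; lra.
have [_ <-] := Fd z zS.
have : is_derive z 1 F 0.
  apply: (@near_eq_is_derive _ _ _ (cst 0)).
  apply/nbhs_cmodP; exists (r0 - cmod z) => [|w zw]; first by rewrite subr_gt0.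
  rewrite Fz//; have := cmod_triangle (w - z) z; rewrite subrK cmod_distC; lra.
by case.
Qed.

Lemma is_derive_shift (f : C -> C) (c z : C) (a : C) :
  is_derive (c + z) 1 f a -> is_derive z 1 (fun w => f (c + w)) a.
Proof.
move=> /is_derive_cmodP H; apply/is_derive_cmodP => e e0.
have /nbhs_cmodP[d d0 D] := H e e0; apply/nbhs_cmodP; exists d => // w zw.
have E (u v : C) : c + u - (c + v) = u - v by ring.
by have := D (c + w); rewrite !E => /(_ zw).
Qed.

(** The factor 2 makes room for a square: a complex number whose real and imaginary parts are below
    [rho] in absolute value has modulus less than [2 * rho]. *)
Lemma identity_near (f : C -> C) (c : C) (rho : R) :
  (forall z, cmod (z - c) < rho * 2 -> exists a : C, is_derive z 1 f a) ->
  (\forall z \near c, f z = 0) ->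
  forall z, cmod (z - c) < rho -> f z = 0.
Proof.
move=> fd f0 z zr.
have := @identity_square (fun w => f (c + w)) rho.
move=> /(_ _ _ (z - c) zr); rewrite subrKC; apply.
  move=> w [w1 w2]; have [|a fa] := fd (c + w).
    rewrite addrAC subrr add0r; apply: le_lt_trans (cmod_le_ReIm _) _; lra.
  by exists a; exact: is_derive_shift.
move/nbhs_cmodP : f0 => [d d0 D]; apply/nbhs_cmodP; exists d => // w; rewrite sub0r cmodN => wd.
by apply: D; rewrite opprD addrA subrr sub0r cmodN.
Qed.

(* Replacing [f] by 0 on the lower half-plane keeps it differentiable: along the
   real line both [f] and its derivative vanish. *)
Lemma identity_real_line (f : C -> C) (rho : R) : 0 < rho ->
  (forall z, cmod z < rho -> exists a : C, is_derive z 1 f a) ->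
  (forall x : R, `|x| < rho -> f x%:C = 0) ->
  \forall z \near (0 : C), f z = 0.
Proof.
move=> rho0 fd f0.
pose F z := if 0 < Im z then f z else 0.
have Fd z : cmod z < rho -> exists a : C, is_derive z 1 F a.
  move=> zr; have [a fa] := fd z zr.
  have [z0|z0|z0] := ltgtP (Im z) 0.
  - exists 0; apply: (@near_eq_is_derive _ _ _ (cst 0)).
    apply/nbhs_cmodP; exists (- Im z) => [|w zw]; first by rewrite oppr_gt0.
    rewrite /F ifF//; apply/negbTE; rewrite -leNgt.
    have := Im_le_cmod (z - w); rewrite ImB ler_norml; lra.
  - exists a; apply: near_eq_is_derive fa.
    apply/nbhs_cmodP; exists (Im z) => [|w zw]//.
    rewrite /F ifT//.
    have := Im_le_cmod (z - w); rewrite ImB ler_norml; lra.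
  - have zE : z = (Re z)%:C by case: (z) z0 => x y /= ->.
    have fz : f z = 0.
      by rewrite zE; apply: f0; apply: le_lt_trans zr; exact: Re_le_cmod.
    have a0 : a = 0.
      have h := @is_derive_curve R f z 1 a 0.
      have D : curve_derive (fun s => f (z + s%:C * 1)) 0 (a * 1).
        by apply: h; rewrite rmorph0 mul0r addr0.
      have near0 : \forall s \near (0 : R), f (z + s%:C * 1) = 0.
        apply/nbhs_ballP; exists (rho - cmod z) => /=; first by rewrite subr_gt0.
        move=> s; rewrite -ball_normE /= sub0r normrN => sr.
        rewrite mulr1 zE -rmorphD; apply: f0; apply: le_lt_trans (ler_normD _ _) _.
        have := Re_le_cmod z; lra.
      case: D => D1 D2; rewrite mulr1 in D1 D2.
      have E1 : is_derive (0:R) 1 (Re \o (fun s => f (z + s%:C * 1))) 0.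
        apply: (@near_eq_is_derive _ _ _ (cst 0)).
        by apply: filterS near0 => s /= ->.
      have E2 : is_derive (0:R) 1 (Im \o (fun s => f (z + s%:C * 1))) 0.
        apply: (@near_eq_is_derive _ _ _ (cst 0)).
        by apply: filterS near0 => s /= ->.
      case: D1 => _; case: E1 => _ ->; case: D2 => _; case: E2 => _ ->.
      by case: (a) => u v /= <- <-.
    exists 0; move/is_derive_cmodP : fa; rewrite a0 => H.
    apply/is_derive_cmodP => e e0; apply: filterS (H e e0) => w.
    rewrite /F z0 ltxx; case: ifP => _; rewrite fz ?subrr !mul0r ?subr0 ?subrr// => _.
    rewrite (_ : cmod 0 = 0) ?mulr_ge0 ?cmod_ge0 ?ltW//.
    by apply/eqP; rewrite cmod0P.
(* The disc of radius [3 rho / 8] about [- c] contains that of radius [rho / 8] about [c], which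
   lies in the upper half-plane, where [F] is [f]. From there the disc of radius [3 rho / 8] about
   [c] reaches a neighbourhood of 0. Discs of twice this radius still lie within modulus [rho]. *)
pose c : C := (rho / 8)%:C * iC.
have cc : cmod c = rho / 8 by rewrite cmodM cmod_i mulr1 cmod_real gtr0_norm// divr_gt0.
have Imc : Im c = rho / 8 by rewrite /= mulr1 mul0r addr0.
have F0 : forall z, cmod (z - - c) < rho * 3 / 8 -> F z = 0.
  apply: identity_near.
    move=> z zc; apply: Fd; have := cmod_triangle (z - - c) (- c).
    rewrite subrK cmodN cc; lra.
  apply/nbhs_cmodP; exists (rho / 8) => [|w]; first by rewrite divr_gt0.
  move=> h; rewrite /F ifF//; apply/negbTE; rewrite -leNgt.
  have := Im_le_cmod (- c - w).
  have -> : Im (- c - w) = - Im c - Im w by rewrite ImB; case: (c).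
  rewrite Imc ler_norml; lra.
have f1 : forall z, cmod (z - c) < rho * 3 / 8 -> f z = 0.
  apply: identity_near.
    move=> z zc; apply: fd; have := cmod_triangle (z - c) c.
    rewrite subrK cc; lra.
  apply/nbhs_cmodP; exists (rho / 8) => [|w h]; first by rewrite divr_gt0.
  have wI : 0 < Im w by have := Im_le_cmod (c - w); rewrite ImB Imc ler_norml; lra.
  have := F0 w; rewrite /F wI; apply.
  have -> : w - - c = (w - c) + (c + c) by ring.
  apply: le_lt_trans (cmod_triangle _ _) _; rewrite cmod_distC.
  have := cmod_triangle c c; rewrite cc; lra.
apply/nbhs_cmodP; exists (rho / 8) => [|w]; first by rewrite divr_gt0.
rewrite sub0r cmodN => wr; apply: f1.
have := cmod_triangle w (- c); rewrite cmodN cc; lra.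
Qed.

End IdentityDisc.

(** * The identity theorem on affine simplices *)

Section IdentityTheorem.
Variables (R : realType) (X : complexManifold R).
Local Notation C := (Cplx R).
Local Notation Re := (@complex.Re R).
Local Notation Im := (@complex.Im R).
Local Notation "x %:C" := (real_complex R x : C) (format "x %:C").
Local Notation iC := ('i%C : C).

Lemma affine_line_subproof n (u w : affine_simplex R n) (l : C) :
  (1 - l) *: set_val u + l *: set_val w \in @affine_simplex_set R n.
Proof.
apply/mem_set; rewrite /affine_simplex_set /=.
under eq_bigr do rewrite !mxE.
rewrite big_split /= -!mulr_sumr.
have := set_valP u; have := set_valP w; rewrite /affine_simplex_set /= => -> ->.
by rewrite !mulr1 subrK.
Qed.
Definition affine_line n (u w : affine_simplex R n) (l : C) : affine_simplex R n :=
  exist (fun s => s \in @affine_simplex_set R n) _ (affine_line_subproof u w l).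

Lemma affine_chart_line n (u w : affine_simplex R n) (l : C) :
  affine_chart (affine_line u w l) = affine_chart u + l *: (affine_chart w - affine_chart u).
Proof.
apply/rowP => i; rewrite !mxE; ring.
Qed.

Lemma affine_line_differentiable n (u w : affine_simplex R n) (l : C) :
  differentiable (fun l : C => affine_chart u + l *: (affine_chart w - affine_chart u) : 'rV[C]_n) l.
Proof.
apply: differentiableD; first exact: differentiable_cst.
by have [] := is_diff_scalel l (affine_chart w - affine_chart u).
Qed.

Lemma affine_line_continuous n (u w : affine_simplex R n) :
  continuous (affine_line u w).
Proof.
move=> l; have -> : affine_line u w =
  @affine_chart_inv R n \o (fun l : C => affine_chart u + l *: (affine_chart w - affine_chart u) : 'rV[C]_n).
  by apply/funext => m; rewrite /= -affine_chart_line affine_chartK.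
apply: continuous_comp; last exact: affine_chart_inv_continuous.
exact/differentiable_continuous/affine_line_differentiable.
Qed.

Lemma coord_differentiable n (j : 'I_n) (s : 'rV[C]_n) :
  differentiable (fun s : 'rV[C]_n => s 0 j : C) s.
Proof.
have lin : linear (fun s : 'rV[C]_n => s 0 j : C) by move=> a u v; rewrite !mxE.
pose h := GRing.isLinear.Build _ _ _ _ _ lin.
pose L : {linear 'rV[C]_n -> C} := HB.pack (fun s : 'rV[C]_n => s 0 j : C) h.
have -> : (fun s : 'rV[C]_n => s 0 j : C) = L by [].
by apply: linear_differentiable; exact: coord_continuous.
Qed.

Lemma holomorphic_along_line n (f : holoMap (affine_simplex_manifold R n) X)
    (u w : affine_simplex R n) (c : mchart X) (j : 'I_(mdim c)) (l : C) :
  mdom c (f (affine_line u w l)) ->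
  exists a : C, is_derive l 1 (fun l => mmap c (f (affine_line u w l)) 0 j) a.
Proof.
move=> fl; have [_ fd] := @holo_funP _ _ _ f (affine_line u w l) I.
have {fd} /= fd := fd tt c I fl.
have D : differentiable (fun l => mmap c (f (affine_line u w l)) 0 j : C) l.
  have -> : (fun l => mmap c (f (affine_line u w l)) 0 j : C) =
   (fun s : 'rV[C]_(mdim c) => s 0 j : C) \o ((mmap c \o f \o @affine_chart_inv R n) \o
      (fun l : C => affine_chart u + l *: (affine_chart w - affine_chart u) : 'rV[C]_n)).
    by apply/funext => m; rewrite /= -affine_chart_line affine_chartK.
  apply: differentiable_comp; last exact: coord_differentiable.
  apply: differentiable_comp; first exact: affine_line_differentiable.
  by rewrite -affine_chart_line.
exists ('D_1 (fun l => mmap c (f (affine_line u w l)) 0 j : C) l).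
by apply: DeriveDef => //; apply/derivable1_diffP.
Qed.

Section Line.
Variables (n : nat) (f g : holoMap (affine_simplex_manifold R n) X).
Variables (u w : affine_simplex R n).
Let F l := f (affine_line u w l).
Let G l := g (affine_line u w l).

Let holo_line_continuous (h : holoMap (affine_simplex_manifold R n) X) :
  continuous (fun l => h (affine_line u w l)).
Proof.
move=> l; apply: (@continuous_comp C (affine_simplex R n) X (affine_line u w) h).
  exact: affine_line_continuous.
by have [] := @holo_funP _ _ _ h (affine_line u w l) I.
Qed.

Let chart_disc l0 : F l0 = G l0 -> exists c : mchart X, exists2 r : R, 0 < r &
  forall l, cmod (l0 - l) < r -> mdom c (F l) /\ mdom c (G l).
Proof.
move=> FG; have [c cF] := mcover (F l0); exists c.
have n1 : \forall l \near l0, mdom c (F l).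
  apply: (@holo_line_continuous f l0 (mdom c)); apply: open_nbhs_nbhs.
  by split => //; exact: mdom_open.
have n2 : \forall l \near l0, mdom c (G l).
  apply: (@holo_line_continuous g l0 (mdom c)); apply: open_nbhs_nbhs; split; first exact: mdom_open.
  by rewrite -/(G l0) -FG.
have /nbhs_cmodP[r r0 H] : \forall l \near l0, mdom c (F l) /\ mdom c (G l).
  by apply: filterS2 n1 n2.
by exists r.
Qed.

Let chart_eq c l : mdom c (F l) -> mdom c (G l) ->
  (forall j, mmap c (F l) 0 j - mmap c (G l) 0 j = 0) -> F l = G l.
Proof.
move=> cF cG e; rewrite -(mmapK cF) -(mmapK cG); congr minv.
by apply/rowP => j; apply/eqP; rewrite -subr_eq0; apply/eqP; exact: e.
Qed.

Let diff_derive c j l : mdom c (F l) -> mdom c (G l) ->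
  exists a : C, is_derive l 1 (fun l => mmap c (F l) 0 j - mmap c (G l) 0 j) a.
Proof.
move=> cF cG.
have [a fa] := holomorphic_along_line j cF.
have [b gb] := holomorphic_along_line j cG.
by exists (a - b); exact: (is_deriveB fa gb).
Qed.

Lemma agree_near_real_line (r : R) : 0 < r ->
  (forall x : R, `|x| < r -> F x%:C = G x%:C) -> \forall l \near (0 : C), F l = G l.
Proof.
move=> r0 FG.
have FG0 : F 0 = G 0 by rewrite -(rmorph0 (real_complex R)); apply: FG; rewrite normr0.
have [c [r' r'0 H]] := chart_disc FG0.
have E (j : 'I_(mdim c)) : \forall l \near (0 : C), mmap c (F l) 0 j - mmap c (G l) 0 j = 0.
  apply: (@identity_real_line _ _ (Num.min r r')); first by rewrite lt_min r0.
    move=> z; rewrite lt_min => /andP[_ zr].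
    by have [|h1 h2] := H z; [rewrite sub0r cmodN|exact: diff_derive].
  by move=> x; rewrite lt_min => /andP[xr _]; rewrite FG// subrr.
have D : \forall l \near (0 : C), mdom c (F l) /\ mdom c (G l).
  by apply/nbhs_cmodP; exists r'.
have E' : \forall l \near (0 : C), forall j, mmap c (F l) 0 j - mmap c (G l) 0 j = 0.
  exact: (@filter_forall C _ (fun j l => mmap c (F l) 0 j - mmap c (G l) 0 j = 0)
    (nbhs (0 : C)) (nbhs_filter _) E).
apply: filterS2 D E' => l [h1 h2] h3.
exact: (chart_eq h1 h2).
Qed.

(** The maps agree at [l0] because the manifold is Hausdorff. Hence one chart contains both images
    of a disc about [l0], and the one-variable theorem applies there from a nearby point [l1]. *)
Lemma agree_near_closed (l0 : C) :
  (forall r : R, 0 < r -> exists2 l1, cmod (l1 - l0) < r & \forall l \near l1, F l = G l) ->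
  \forall l \near l0, F l = G l.
Proof.
move=> cl.
have FG : F l0 = G l0.
  apply: contrapT => ne.
  have := @mhausdorff R X; rewrite open_hausdorff => /(_ (F l0) (G l0)).
  move=> /(_ (introN eqP ne)) [[A B] /= [/set_mem FA /set_mem GB] [Ao Bo AB]].
  have n1 : \forall l \near l0, A (F l).
    by apply: (@holo_line_continuous f l0 A); apply: open_nbhs_nbhs.
  have n2 : \forall l \near l0, B (G l).
    by apply: (@holo_line_continuous g l0 B); apply: open_nbhs_nbhs.
  have /nbhs_cmodP[r r0 H] : \forall l \near l0, A (F l) /\ B (G l) by apply: filterS2 n1 n2.
  have [l1 l1r /nbhs_singleton e] := cl r r0.
  have [h1 h2] := H l1 (eq_ind_r (fun x => x < r) l1r (cmod_distC _ _)).
  have : (A `&` B) (F l1) by split => //; rewrite e.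
  by rewrite (eqP AB).
have [c [r r0 H]] := chart_disc FG.
have r4 : 0 < r / 4 by rewrite divr_gt0.
have [l1 l1r E] := cl _ r4.
apply/nbhs_cmodP; exists (r / 8) => [|l lr]; first by rewrite divr_gt0.
have r8 : r / 8 < r by rewrite ltr_pdivrMr// ltr_pMr// ltr1n.
have [h1 h2] : mdom c (F l) /\ mdom c (G l) by apply: H; exact: lt_trans lr r8.
apply: (chart_eq h1 h2) => j.
(* The disc of radius [3 r / 8] about [l1] contains that of radius [r / 8] about [l0], and the disc
   of twice its radius fits into the disc of radius [r] about [l0]. *)
apply: (@identity_near _ (fun l => mmap c (F l) 0 j - mmap c (G l) 0 j) l1 (3 * r / 8)).
- move=> z zl; have [|k1 k2] := H z; last exact: diff_derive.
  rewrite cmod_distC -(subrK l1 z) -addrA; apply: le_lt_trans (cmod_triangle _ _) _.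
  lra.
- by apply: filterS E => l' ->; rewrite subrr.
- rewrite -(subrK l0 l) -addrA; apply: le_lt_trans (cmod_triangle _ _) _.
  rewrite (cmod_distC l l0) (cmod_distC l0 l1).
  lra.
Qed.

(** The points near which the maps agree form an open and closed set. It is pulled back to the
    segment from 0 to [l], so that connectedness of the unit interval suffices. *)
Lemma agree_on_line (r : R) : 0 < r ->
  (forall x : R, `|x| < r -> F x%:C = G x%:C) -> forall l, F l = G l.
Proof.
move=> r0 FG l.
pose W := [set m : C | \forall m' \near m, F m' = G m'].
have Wo : open W by rewrite openE => m; exact: nbhs_interior.
pose E := (fun t : R => t%:C * l) @^-1` W.
have cont : continuous (fun t : R => t%:C * l).
  move=> t; apply: cvgM; last exact: cvg_cst.
  exact: real_complex_continuous.
have Eo : open E by apply: open_comp => // t _; exact: cont.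
have Ec : closed E.
  move=> t clt; apply: agree_near_closed => e e0.
  have : \forall s \near t, cmod (s%:C * l - t%:C * l) < e.
    have /(@cmod_cvgP R R (nbhs t) _)/(_ e e0) := cont t.
    by apply: filterS => s; rewrite cmod_distC.
  by move=> /clt[s [Es se]]; exists (s%:C * l).
have conn : connected (`[0, 1] : set R) by exact: segment_connected.
have EE : `[0, 1] `&` E = `[0, 1]%classic.
  apply: conn; [exists 0|by exists E|by exists E].
  split; first by rewrite /= in_itv /= lexx ler01.
  by rewrite /E /= rmorph0 mul0r; exact: agree_near_real_line FG.
have : (`[0, 1] `&` E) 1 by rewrite EE /= in_itv /= lexx ler01.
by case=> _; rewrite /E /= rmorph1 mul1r => /nbhs_singleton.
Qed.

End Line.

(** Two passages along complex lines. A real point is joined to the barycentre, near which the real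
    line stays in the standard simplex. A general point [x + i y] is the value at [i] of the line
    through the real points [x] and [x + y]. *)
Lemma holoMap_eq_of_std_simplex n (f g : holoMap (affine_simplex_manifold R n) X) :
  (forall t : std_simplex R n, f (std_to_affine t) = g (std_to_affine t)) -> f = g.
Proof.
move=> fg.
have real_pt (z : affine_simplex R n) : (forall i, Im (set_val z 0 i) = 0) -> f z = g z.
  move=> zr.
  pose b : R := n.+1%:R^-1.
  have b0 : 0 < b by rewrite invr_gt0 ltr0n.
  have bS : (\row_i b%:C : 'rV[C]_n.+1) \in @affine_simplex_set R n.
    apply/mem_set; rewrite /affine_simplex_set /=.
    under eq_bigr do rewrite mxE.
    by rewrite sumr_const card_ord -rmorphMn /b -mulr_natr mulVf ?rmorph1// pnatr_eq0.
  pose u : affine_simplex R n := exist (fun s => s \in @affine_simplex_set R n) _ bS.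
  pose y i := Re (set_val z 0 i).
  have zE i : set_val z 0 i = (y i)%:C.
    by rewrite /y; case: (set_val z 0 i) (zr i) => p q /= ->.
  have y1 : \sum_i y i = 1.
    apply: (@complexI R); rewrite rmorph_sum rmorph1 -(set_valP z).
    by apply: eq_bigr => i _; rewrite zE.
  pose S := \sum_i `|y i - b|.
  have S0 : 0 <= S by apply: sumr_ge0.
  have S1 : 0 < S + 1 by rewrite ltr_wpDl.
  (* When the absolute value of [x] is below this bound, every coordinate [b + x * (y i - b)] is
     nonnegative. *)
  have r0 : 0 < b / (S + 1) by rewrite divr_gt0.
  have H := @agree_on_line n f g u z _ r0.
  have -> : z = affine_line u z 1.
    by apply: val_inj; rewrite /= subrr scale0r add0r scale1r.
  apply: H => x xr.
  have yi i : 0 <= (1 - x) * b + x * y i.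
    have : `|x| * `|y i - b| <= b.
      rewrite ltr_pdivlMr// in xr; apply: le_trans (ltW xr); rewrite ler_wpM2l//.
      rewrite -[leLHS]addr0 lerD//.
      by rewrite /S (bigD1 i)//= lerDl sumr_ge0.
    rewrite -normrM ler_norml; lra.
  have tS : (\row_i ((1 - x) * b + x * y i) : 'rV[R]_n.+1) \in @std_simplex_set R n.
    apply/mem_set; split; last by move=> i; rewrite mxE.
    under eq_bigr do rewrite mxE.
    rewrite big_split /= -!mulr_sumr y1 sumr_const card_ord -mulr_natr mulVf ?pnatr_eq0//.
    by rewrite !mulr1 subrK.
  have -> : affine_line u z x%:C =
    std_to_affine (exist (fun s => s \in @std_simplex_set R n) _ tS).
    apply: val_inj; apply/rowP => i; rewrite /= !mxE zE.
    by rewrite !rmorphD !rmorphM rmorphB rmorph1.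
  exact: fg.
apply: holoMap_eqP => z.
pose x i := Re (set_val z 0 i); pose y i := Im (set_val z 0 i).
have xyS (s : R) : (\row_i (x i + s * y i)%:C : 'rV[C]_n.+1) \in @affine_simplex_set R n.
  apply/mem_set; rewrite /affine_simplex_set /=.
  under eq_bigr do rewrite mxE.
  rewrite -rmorph_sum big_split /= -mulr_sumr.
  have E : \sum_i set_val z 0 i = (\sum_i x i)%:C + iC * (\sum_i y i)%:C.
    rewrite !rmorph_sum mulr_sumr -big_split /=; apply: eq_bigr => i _.
    by rewrite {1}[set_val z 0 i]complexE.
  have := set_valP z; rewrite /affine_simplex_set /= E -ptE => /eqP.
  by rewrite eq_complex /= => /andP[/eqP -> /eqP ->]; rewrite mulr0 addr0.
pose u : affine_simplex R n := exist (fun s => s \in @affine_simplex_set R n) _ (xyS 0).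
pose w : affine_simplex R n := exist (fun s => s \in @affine_simplex_set R n) _ (xyS 1).
have H := @agree_on_line n f g u w _ ltr01.
have -> : z = affine_line u w iC.
  apply: val_inj; apply/rowP => i; rewrite /= !mxE mul0r addr0 mul1r rmorphD.
  rewrite -[LHS]/(set_val z 0 i) {1}[set_val z 0 i]complexE -/(x i) -/(y i); ring.
apply: H => s _; apply: real_pt => i; rewrite set_valE /= !mxE.
have -> : (1 - s%:C) * (x i + 0 * y i)%:C + s%:C * (x i + 1 * y i)%:C = (x i + s * y i)%:C.
  by rewrite mul0r addr0 mul1r !rmorphD rmorphM; ring.
by [].
Qed.

End IdentityTheorem.

(** * Extension of sections of simplicial maps *)

Section Delta.
Local Open Scope nat_scope.

Definition mk_delta m n (f : 'I_m.+1 -> 'I_n.+1)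
    (H : {homo f : x y / (x <= y)%O}) : delta m n :=
  HB.pack f (Order.isOrderMorphism.Build _ 'I_m.+1 _ 'I_n.+1 f H).

Lemma mk_deltaE m n (f : 'I_m.+1 -> 'I_n.+1) H i : @mk_delta m n f H i = f i.
Proof. by []. Qed.

Lemma delta_homo m n (f : delta m n) (i j : 'I_m.+1) : i <= j -> f i <= f j.
Proof. by move=> ij; have := omorph_le f; apply. Qed.

Definition in_boundary m n (x : delta m n) : Prop :=
  exists j : 'I_n.+1, forall i, x i <> j.

Lemma in_boundary_sact l m n (th : delta l m) (x : delta m n) :
  in_boundary x -> in_boundary (x \o th : delta l n).
Proof. by move=> [j xj]; exists j => i; exact: xj. Qed.

Lemma not_in_boundary m n (x : delta m n) :
  ~ in_boundary x -> forall j, exists i, x i = j.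
Proof.
move=> xb j; apply: contrapT => h; apply: xb; exists j => i xi.
by apply: h; exists i.
Qed.

(** Any choice of preimages under an order-preserving surjection is order-preserving, so the
    preimage of [x i] can be prescribed. *)
Lemma delta_section m n (x : delta m n) (i : 'I_m.+1) : ~ in_boundary x ->
  exists d : delta n m, (forall j, x (d j) = j) /\ d (x i) = i.
Proof.
move=> /not_in_boundary /choice[d0 d0P].
pose d j := if j == x i then i else d0 j.
have dP j : x (d j) = j by rewrite /d; case: eqP.
have dm : {homo d : j k / (j <= k)%O}.
  move=> j k jk; rewrite leEord leqNgt; apply/negP => kj.
  have := delta_homo x (ltnW kj); rewrite !dP => kj'.
  have E : j = k by apply/val_inj/eqP; rewrite eqn_leq kj' andbT.
  by rewrite E ltnn in kj.
by exists (mk_delta dm); split=> [j|]; rewrite mk_deltaE// /d eqxx.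
Qed.

Lemma surjective_delta_id n (x : delta n n) : ~ in_boundary x -> forall i, x i = i.
Proof.
move=> xb; have xs := not_in_boundary xb.
have xinj : injective x.
  have /choice[d dP] := xs.
  have dinj : injective d by move=> j k /(congr1 x); rewrite !dP.
  have [d' _ d'd] := injF_bij dinj.
  have xd' i : x i = d' i by rewrite -{1}(d'd i) dP.
  by move=> i j; rewrite !xd' => /(congr1 d); rewrite !d'd.
pose s := [seq nat_of_ord (x (inord i)) | i <- iota 0 n.+1].
have sE : s = iota 0 n.+1.
  apply: (@sorted_eq _ leq leq_trans anti_leq).
  - apply/(sortedP 0) => i; rewrite size_map size_iota => iS.
    rewrite !(nth_map 0) ?size_iota ?(ltnW iS)// !nth_iota ?(ltnW iS)// !add0n.
    by apply: delta_homo; rewrite !inordK// ltnW.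
  - exact: iota_sorted.
  - apply: uniq_perm.
    + rewrite map_inj_in_uniq ?iota_uniq// => i j.
      rewrite !mem_iota !add0n /= => iS jS /val_inj/xinj/(congr1 val).
      by rewrite /= !inordK.
    + exact: iota_uniq.
    + move=> k; rewrite mem_iota /= add0n; apply/mapP/idP => [[i _ ->]|kn]; first exact: ltn_ord.
      have [i xi] := xs (Ordinal kn); exists (nat_of_ord i); first by rewrite mem_iota add0n /= ltn_ord.
      by rewrite inord_val xi.
move=> i; apply: val_inj.
have /(congr1 (fun s => nth 0 s i)) := sE.
by rewrite (nth_map 0) ?size_iota// !nth_iota// add0n inord_val.
Qed.

Lemma delta_factor m n (x : delta m n) : in_boundary x ->
  exists k (d : delta k n) (e : delta m k), k < n /\ x = (d \o e : delta m n).
Proof.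
case: n x => [x [j xj]|n x [j xj]].
  by case: (xj ord0); rewrite [LHS]ord1 [RHS]ord1.
have liftm : {homo (lift j : 'I_n.+1 -> 'I_n.+2) : a b / (a <= b)%O}.
  by move=> a b ab; rewrite leEord /= leq_bump2.
pose e i := odflt ord0 (unlift j (x i)).
have eP i : lift j (e i) = x i.
  rewrite /e; case: unliftP => [k ->//|xij].
  by case: (xj i); rewrite xij.
have em : {homo e : a b / (a <= b)%O}.
  move=> a b ab; rewrite leEord -(leq_bump2 j).
  by have := delta_homo x ab; rewrite -!eP.
exists n, (mk_delta liftm), (mk_delta em); split=> //.
by apply: delta_eqP => i /=; rewrite eP.
Qed.

End Delta.

Section SectionExtension.
Variables (W S : simplicialSet) (p : simplicialMap W S).

(** The right lifting property against the boundary inclusions: [p] is an acyclic fibration. The map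
    from the boundary to [W] is spelled out as a compatible family. *)
Definition boundary_lifting : Prop :=
  forall n (y : S n) (b : forall m (x : delta m n), in_boundary x -> W m),
    (forall l m (th : delta l m) (x : delta m n) hx hx',
       b l (x \o th : delta l n) hx' = sact th (b m x hx)) ->
    (forall m x hx, smap p (b m x hx) = sact x y) ->
    exists w : W n, smap p w = y /\ forall m x hx, sact x w = b m x hx.

(** [G] is the graph of a section of [p] over a simplicial subset of [S]; graphs can be enlarged by
    taking unions. *)
Definition partial_section (G : forall n, S n -> W n -> Prop) : Prop :=
  [/\ forall n y w w', G n y w -> G n y w' -> w = w',
      forall m n (th : delta m n) y w, G n y w -> G m (sact th y) (sact th w) &
      forall n y w, G n y w -> smap p w = y].

(** Zorn's lemma takes the place of an induction over skeleta. A simplex [y] of least dimension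
    outside the domain of a maximal partial section has its boundary inside, so [boundary_lifting]
    offers a value [w], and all pairs [(sact x y, sact x w)] can be adjoined. *)
Theorem section_extension (G0 : forall n, S n -> W n -> Prop) :
  boundary_lifting -> partial_section G0 ->
  exists s : simplicialMap S W,
    (forall n (y : S n), smap p (smap s y) = y) /\
    forall n y w, G0 n y w -> smap s y = w.
Proof.
move=> bl ps0.
pose T := {n & (S n * W n)%type}.
(* [G0] is kept apart from the set [A] to be enlarged, so that the union of the empty chain is
   admissible too. *)
pose rel (A : set T) n (y : S n) (w : W n) := A (existT _ n (y, w)) \/ G0 n y w.
pose P (A : set T) := partial_section (rel A).
have [A [PA Amax]] : exists A, P A /\ forall B, (A `<` B)%classic -> ~ P B.
  apply: Zorn_bigcup => F FP Ftot.
  have mono X n y w : F X -> rel X n y w -> rel (\bigcup_(X in F) X)%classic n y w.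
    by move=> FX [Xa|]; [left; exists X|right].
  have inv n y w : rel (\bigcup_(X in F) X)%classic n y w ->
      (exists2 X, F X & rel X n y w) \/ G0 n y w.
    by move=> [[X FX Xa]|]; [left; exists X => //; left|right].
  have [f0 n0 o0] := ps0; split.
  - move=> n y w w' /inv[[X FX Xw]|g] /inv[[Y FY Yw]|g'].
    + have [XY|YX] := Ftot X Y FX FY.
        have [f _ _] := FP Y FY; apply: f Yw; case: Xw => [Xw|]; [left; exact: XY|by right].
      have [f _ _] := FP X FX; apply: f Xw _; case: Yw => [Yw|]; [left; exact: YX|by right].
    + by have [f _ _] := FP X FX; apply: f Xw _; right.
    + by have [f _ _] := FP Y FY; apply: f Yw; right.
    + exact: f0 g g'.
  - move=> m n th y w /inv[[X FX Xw]|g]; last by right; exact: n0.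
    by have [_ h _] := FP X FX; apply: mono FX _; exact: h.
  - move=> n y w /inv[[X FX Xw]|g]; last exact: o0 g.
    by have [_ _ h] := FP X FX; exact: h Xw.
pose G := rel A.
have [Gf Gn Go] : partial_section G := PA.
have tot : forall n (y : S n), exists w, G n y w.
  apply: contrapT => /existsNP[n1 /existsNP[y1 h1]].
  pose missing n := `[< exists y : S n, ~ exists w, G n y w >].
  have ex : exists n, missing n by exists n1; apply/asboolP; exists y1.
  have [n /asboolP[y yG] nmin] := ex_minnP ex.
  have small m (z : S m) : (m < n)%N -> exists w, G m z w.
    move=> mn; apply: contrapT => h.
    have := nmin m; rewrite leqNgt mn => /(_ _)/negP; apply => //.
    by apply/asboolP; exists z.
  have bdry m (x : delta m n) : in_boundary x -> exists w, G m (sact x y) w.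
    move=> /delta_factor[k [d [e [kn ->]]]]; rewrite sact_comp.
    by have [w Gw] := small k (sact d y) kn; exists (sact e w); exact: Gn.
  (* Eilenberg-Zilber: [y] is not degenerate, since a degeneracy of [y] would be in
     the domain of [G] by minimality of [n], so [sact x y] determines [x] when [x]
     is onto. *)
  have surj m (x : delta m n) : (exists w, G m (sact x y) w) -> in_boundary x.
    move=> [w Gw]; apply: contrapT => xb; apply: yG.
    have [d [dx _]] := delta_section ord0 xb.
    exists (sact d w); have := Gn _ _ d _ _ Gw; rewrite -sact_comp.
    have -> : (x \o d : delta n n) = idfun :> delta n n by apply: delta_eqP.
    by rewrite sact_id.
  pose b m (x : delta m n) (hx : in_boundary x) : W m := projT1 (cid (bdry m x hx)).
  have bP m x hx : G m (sact x y) (b m x hx) by rewrite /b; case: cid.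
  have [l m th x hx hx'|m x hx|w [pw wb]] := bl n y b.
  - apply: Gf (bP _ _ _) _; rewrite sact_comp; exact: Gn (bP _ _ _).
  - exact: Go (bP _ _ _).
  pose N : set T := [set a | exists x : delta (projT1 a) n, projT2 a = (sact x y, sact x w)].
  have relN m z v : rel (A `|` N)%classic m z v ->
      G m z v \/ exists x : delta m n, z = sact x y /\ v = sact x w.
    move=> [[Aa|[x /= [-> ->]]]|g]; [by left; left|by right; exists x|by left; right].
  have relI m (x : delta m n) : rel (A `|` N)%classic m (sact x y) (sact x w).
    by left; right; exists x.
  have GN m (x : delta m n) v : G m (sact x y) v -> v = sact x w.
    move=> Gv; have hx : in_boundary x by apply: surj; exists v.
    by rewrite (wb m x hx); exact: Gf Gv (bP _ _ _).
  apply: (Amax (A `|` N)%classic).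
    split; first by move=> a; left.
    move=> sub; apply: yG; exists w; left; apply: sub; right.
    by exists (idfun : delta n n) => /=; rewrite !sact_id.
  split.
  - move=> m z v v' /relN[Gv|[x [-> ->]]] /relN[Gv'|[x' [E ->]]].
    + exact: Gf Gv Gv'.
    + by rewrite E in Gv; exact: GN.
    + by apply/esym/GN.
    (* The critical case is [x] onto. For a section [d] of [x] through [i], the operator [x' \o d]
       fixes [y]; it is not in the boundary, since [y] is outside the domain, so it is the identity,
       and [x' i = x i]. *)
    + have [xb|xb] := pselect (in_boundary x).
        have := bP m x xb; rewrite E => /GN <-; exact: wb.
      suff -> : x = x' by [].
      apply: delta_eqP => i; have [d [dx di]] := delta_section i xb.
      have yE : y = sact (x' \o d : delta n n) y.
        rewrite sact_comp -E -sact_comp.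
        have -> : (x \o d : delta n n) = idfun :> delta n n by apply: delta_eqP.
        by rewrite sact_id.
      have /surjective_delta_id/(_ (x i)) /= : ~ in_boundary (x' \o d : delta n n).
        by move=> /bdry; rewrite -yE.
      by rewrite di => ->.
  - move=> m k th z v /relN[Gv|[x [-> ->]]].
      by case: (Gn _ _ th _ _ Gv) => [?|?]; [left; left|right].
    by rewrite -!sact_comp; exact: relI.
  - move=> m z v /relN[Gv|[x [-> ->]]]; first exact: Go Gv.
    by rewrite smap_natural pw.
have sP n (y : S n) := projT2 (cid (tot n y)).
pose s n (y : S n) := projT1 (cid (tot n y)).
have snat m n (th : delta m n) (y : S n) : s m (sact th y) = sact th (s n y).
  by apply: Gf (sP _ _) _; exact: Gn (sP _ _).
exists (@SimplicialMap S W s snat); split=> [n y|n y w g0].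
  exact: Go (sP _ _).
by apply: Gf (sP _ _) _; right.
Qed.

End SectionExtension.

(** * Realization of simplicial homotopies *)

Lemma pasting (T Y : topologicalType) (I : finType) (D : I -> set T)
    (f : I -> T -> Y) (E : T -> Y) :
  (forall i, closed (D i)) -> (forall i, continuous (f i)) ->
  (forall x, exists i, D i x) -> (forall i x, D i x -> E x = f i x) -> continuous E.
Proof.
move=> Dc fc cov Ef; apply/continuous_closedP => A Ac.
have -> : E @^-1` A = \bigcup_(i in [set: I]) (D i `&` f i @^-1` A).
  apply/seteqP; split=> [x Ax|x [i _ [Dx Ax]]]; last by rewrite /preimage /= (Ef i x Dx).
  by have [i Dx] := cov x; exists i => //; split; rewrite // /preimage /= -(Ef i x Dx).
apply: closed_bigcup => [|i _]; first exact: finite_finset.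
by apply: closedI => //; apply: (continuous_closedP (f i)).1.
Qed.

Lemma continuous_pair (T U V : topologicalType) (f : T -> U) (g : T -> V) :
  continuous f -> continuous g -> continuous (fun t => (f t, g t)).
Proof.
move=> fc gc t A [[P Q] /= [Pf Qg] PQ]; have /= h1 := fc t P Pf; have /= h2 := gc t Q Qg.
by apply: (@filterS2 _ (nbhs t) (nbhs_filter t) _ _ _ _ h1 h2) => s Ps Qs; apply: PQ.
Qed.

Section Realization.
Local Open Scope quotient_scope.
Variable R : realType.

Lemma realization_ind (K : simplicialSet) (P : realization R K -> Prop) :
  (forall n (x : K n) (t : std_simplex R n), P (realization_class x t)) -> forall u, P u.
Proof.
move=> H u; have := H (projT1 (repr (u : {eq_quot realization_equiv R K})))
  (projT2 (repr (u : {eq_quot realization_equiv R K}))).1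
  (projT2 (repr (u : {eq_quot realization_equiv R K}))).2.
congr P; rewrite /realization_class -[RHS]reprK; congr \pi.
by case: (repr _) => n [x t].
Qed.

Lemma realization_class_sact (K : simplicialSet) m n (th : delta m n) (x : K n)
    (t : std_simplex R m) :
  realization_class (sact th x) t = realization_class x (std_simplex_push th t).
Proof.
apply/(@eqmodP _ (realization_equiv R K))/asboolP/rst_step.
exact: RealizationStep.
Qed.

Lemma realization_lift (K : simplicialSet) (Y : Type)
    (g : forall n, K n -> std_simplex R n -> Y) :
  (forall m n (th : delta m n) (x : K n) (t : std_simplex R m),
     g m (sact th x) t = g n x (std_simplex_push th t)) ->
  exists G : realization R K -> Y,
    forall n (x : K n) t, G (realization_class x t) = g n x t.
Proof.
move=> gn; pose g0 (a : realization_sum R K) := g (projT1 a) (projT2 a).1 (projT2 a).2.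
exists (fun u => g0 (repr (u : {eq_quot realization_equiv R K}))) => n x t.
set a := repr _.
have : realization_equiv R K a (realization_point x t).
  by apply/eqmodP; rewrite reprK.
move=> /asboolP; suff E b c : clos_refl_sym_trans _ (@realization_step R K) b c -> g0 b = g0 c.
  by move=> /E ->.
elim=> {b c} [b c [m p th y s]|//|b c _ -> //|b c d _ -> _ -> //].
exact: gn.
Qed.

Lemma realization_continuous (K : simplicialSet) (Y : topologicalType)
    (G : realization R K -> Y) :
  (forall n (x : K n), continuous (fun t : std_simplex R n => G (realization_class x t))) ->
  continuous G.
Proof.
move=> Gc; apply/quotient_continuous.
have -> : G \o \pi_(quotient_topology {eq_quot realization_equiv R K}) =
   unstable.sigT_fun (fun n (p : discrete_topology {classic K n} * std_simplex R n) =>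
     G (realization_class (p.1 : K n) p.2)).
  by apply/funext => -[n [x t]].
apply: sigT_continuous => n [x t] A GA.
exists ([set x], [set s | A (G (realization_class (x : K n) s))]); last first.
  by case=> y s [/= -> ].
split; first by apply: discrete_set1.
exact: (Gc n x t A GA).
Qed.

Lemma realization_class_continuous (K : simplicialSet) n (x : K n) :
  continuous (@realization_class R K n x).
Proof.
move=> t; rewrite /realization_class.
apply: (@continuous_comp _ _ _ (@realization_point R K n x)
  (\pi_(quotient_topology {eq_quot realization_equiv R K}))); last exact: pi_continuous.
apply: (@continuous_comp _ _ _ (fun t => (x : discrete_topology {classic K n}, t))
   (existT (fun n => (discrete_topology {classic K n} * std_simplex R n)%type) n)).
  move=> A [[P Q] /= [Px Qt] PQ]; apply: filterS Qt => s Qs; apply: PQ.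
  by split=> //=; exact: nbhs_singleton Px.
exact: existT_continuous.
Qed.

Lemma realization_map_continuous (K L : simplicialSet) (f : simplicialMap K L) :
  continuous (realization_map (R := R) f).
Proof.
apply: realization_continuous => n x.
have -> : (fun t => realization_map f (realization_class x t)) = @realization_class R L n (smap f x).
  by apply/funext => t; rewrite realization_mapE.
exact: realization_class_continuous.
Qed.

Import ArrowAsCompactOpen.

(** The realization is a quotient, and products need not preserve quotients. Since [R] is locally
    compact, [G] can be curried into a space of maps with the compact-open topology, where
    continuity is tested on each simplex. *)
Lemma realization_prod_continuous (K : simplicialSet) (Y : topologicalType)
    (G : realization R K -> R -> Y) :
  (forall n (x : K n), continuous (fun p : std_simplex R n * R => G (realization_class x p.1) p.2)) ->
  continuous (fun p : realization R K * R => G p.1 p.2).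
Proof.
move=> Gc.
have -> : (fun p : realization R K * R => G p.1 p.2) = uncurry G by apply/funext => -[].
apply: continuous_uncurry; [exact: locally_compactR|exact: Rhausdorff| |].
  apply: realization_continuous => n x.
  exact: (continuous_curry_fun (Gc n x)).
elim/realization_ind => n x t.
by have [_ /(_ t)] := continuous_curry (Gc n x).
Qed.

End Realization.

Lemma sum_simplex_push (K : numFieldType) m n (th : delta m n) (t : 'rV[K]_m.+1)
    (P : pred 'I_n.+1) :
  \sum_(j | P j) simplex_push th t 0 j = \sum_(i | P (th i)) t 0 i.
Proof.
rewrite (partition_big th P) //=; apply: eq_bigr => j Pj.
rewrite mxE; apply: eq_bigl => i.
by case: eqP => [->|]; rewrite ?Pj ?andbF.
Qed.

Lemma simplex_push_delta (K : numFieldType) m n (th : delta m n) (i : 'I_m.+1) :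
  simplex_push th (delta_mx 0 i : 'rV[K]_m.+1) = delta_mx 0 (th i).
Proof.
apply/rowP => k; rewrite !mxE /=.
under eq_bigr do rewrite mxE eqxx /=.
rewrite big_mkcond /= (bigD1 i)//= eqxx big1 ?addr0 => [|j ji].
  by rewrite eq_sym; case: eqP.
by rewrite (negbTE ji); case: ifP.
Qed.

Lemma ler_sum_subpred (R : realType) (I : finType) (P Q : pred I) (t : I -> R) :
  (forall i, P i -> Q i) -> (forall i, 0 <= t i) ->
  \sum_(i | P i) t i <= \sum_(i | Q i) t i.
Proof.
move=> PQ t0; rewrite big_mkcond [leRHS]big_mkcond /=; apply: ler_sum => i _.
by case: ifP => [/PQ ->//|_]; case: ifP.
Qed.

Lemma simplex_push_fix (K : numFieldType) n (th : delta n n) (t : 'rV[K]_n.+1) :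
  (forall i, th i <> i -> t 0 i = 0) -> simplex_push th t = t.
Proof.
move=> fix_th; apply/rowP => k; rewrite mxE big_mkcond /=.
rewrite (bigD1 k) //= big1 => [|i ik].
  by rewrite addr0; case: eqP => // /fix_th ->.
case: eqP => // thi; apply: fix_th; rewrite thi => ki.
by rewrite ki eqxx in ik.
Qed.

(** * The triangulated prism over a simplex *)

Section Prism.
Variable R : realType.
Local Notation TT := (std_simplex R).

Section Maps.
Variables (n : nat) (l : 'I_n.+1).

Lemma prism_face_homo : {homo (lift (lift ord0 l) : 'I_n.+1 -> 'I_n.+2) : i j / (i <= j)%O}.
Proof. by move=> i j ij; rewrite leEord /= leq_bump2. Qed.
(** The [l]-th top simplex of the prism has vertices [(0,0), ..., (l,0), (l,1), ..., (n,1)]. Its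
    projections to the two factors are [prism_fst] and [prism_snd]; [prism_face] omits the vertex
    [(l,1)]. *)
Definition prism_face : delta n n.+1 := mk_delta prism_face_homo.

Lemma prism_fst_subproof (i : 'I_n.+2) : (i - (l < i) < n.+1)%N.
Proof.
case: (ltnP l i) => h /=; last by rewrite subn0 ltnS (leq_trans h)// -ltnS.
by rewrite subn1 -ltnS (ltn_predK h).
Qed.
Lemma prism_fst_homo :
  {homo (fun i : 'I_n.+2 => Ordinal (prism_fst_subproof i)) : i j / (i <= j)%O}.
Proof.
move=> i j; rewrite !leEord /= => ij.
by case: (ltnP l i) => h1; case: (ltnP l j) => h2 /=; lia.
Qed.
Definition prism_fst : delta n.+1 n := mk_delta prism_fst_homo.

Lemma prism_snd_homo :
  {homo (fun i : 'I_n.+2 => if (l < i)%N then ord_max else ord0 : 'I_2) : i j / (i <= j)%O}.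
Proof.
move=> i j; rewrite !leEord /= => ij.
by case: (ltnP l i) => h1; case: (ltnP l j) => h2 //=; lia.
Qed.
Definition prism_snd : delta n.+1 1 := mk_delta prism_snd_homo.

Let e0 : 'I_n.+2 := widen_ord (leqnSn _) l.
Let e1 : 'I_n.+2 := lift ord0 l.

Definition prism_edge : 'rV[R]_n.+2 := delta_mx 0 e1 - delta_mx 0 e0.

Lemma prism_faceK : (prism_fst \o prism_face : delta n n) = idfun :> delta n n.
Proof.
apply: delta_eqP => i; apply: val_inj; rewrite /= /bump /=.
by case: (ltnP l i) => h /=; lia.
Qed.

(** [prism_face \o prism_fst] moves vertex [l + 1] to [l] and fixes the others; the multiple of the
    edge undoes this move. *)
Lemma prism_decomposition (v : 'rV[R]_n.+2) :
  v = simplex_push prism_face (simplex_push prism_fst v) + v 0 e1 *: prism_edge.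
Proof.
rewrite -simplex_push_comp.
have lin (u : 'rV[R]_n.+2) : u = \sum_i u 0 i *: delta_mx 0 i.
  by rewrite {1}(row_sum_delta u).
have H (i : 'I_n.+2) : (delta_mx 0 i : 'rV[R]_n.+2) =
    simplex_push (prism_face \o prism_fst : delta n.+1 n.+1) (delta_mx 0 i)
    + (if i == e1 then 1 else 0) *: prism_edge.
  rewrite simplex_push_delta /=.
  case: (eqVneq i e1) => [->|ie].
    have -> : lift (lift ord0 l) (Ordinal (prism_fst_subproof e1)) = e0.
      by apply: val_inj; rewrite /= /bump /=; lia.
    by rewrite scale1r /prism_edge addrC subrK.
  rewrite scale0r addr0; congr delta_mx; apply: val_inj; rewrite /= /bump /=.
  have : (i : nat) != l.+1 by apply: contra ie => /eqP il; apply/eqP/val_inj; rewrite /= il.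
  by case: (ltnP l i) => h /=; lia.
rewrite {1}(lin v) {2}(lin v) linear_sum /=.
have -> : v 0 e1 *: prism_edge = \sum_i (v 0 i * (if i == e1 then 1 else 0)) *: prism_edge.
  rewrite (bigD1 e1)//= eqxx mulr1 big1 ?addr0// => i /negbTE ->.
  by rewrite mulr0 scale0r.
rewrite -big_split /=; apply: eq_bigr => i _.
by rewrite {1}(H i) scalerDr scalerA linearZ.
Qed.

Definition tail_sum (t : 'rV[R]_n.+1) : R := \sum_(i < n.+1 | (l < i)%N) t 0 i.

Lemma tail_sum_head (t : 'rV[R]_n.+1) :
  tail_sum t + t 0 l = \sum_(i < n.+1 | (l <= i)%N) t 0 i.
Proof.
rewrite [RHS](bigD1 l)//= addrC; congr (_ + _); apply: eq_bigl => i.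
by rewrite ltn_neqAle eq_sym andbC.
Qed.

(** The barycentric coordinate of the vertex [(l,1)] at the point over [t] of height [s], the later
    vertices contributing [tail_sum t] to the height. Clamping yields a point of the simplex for
    every [s]. *)
Definition prism_time (t : 'rV[R]_n.+1) (s : R) : R :=
  Num.max 0 (Num.min (s - tail_sum t) (t 0 l)).

Definition prism_row (t : 'rV[R]_n.+1) (s : R) : 'rV[R]_n.+2 :=
  simplex_push prism_face t + prism_time t s *: prism_edge.

Lemma prism_point_subproof (t : TT n) (s : R) : prism_row (set_val t) s \in @std_simplex_set R n.+1.
Proof.
have [t1 t0] := set_valP t; apply/mem_set; split.
  under eq_bigr do rewrite mxE.
  rewrite big_split /= simplex_push_sum t1.
  under eq_bigr do rewrite mxE.
  rewrite -mulr_sumr.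
  have sum_delta (i : 'I_n.+2) : \sum_j (delta_mx 0 i : 'rV[R]_n.+2) 0 j = 1.
    rewrite (bigD1 i)//= mxE !eqxx big1 ?addr0// => j /negbTE ji.
    by rewrite mxE ji andbF.
  under [X in _ * X]eq_bigr do rewrite mxE [X in _ + X]mxE.
  by rewrite big_split /= sumrN !sum_delta subrr mulr0 addr0.
move=> i; have c0 : 0 <= prism_time (set_val t) s by rewrite le_max lexx.
have cl : prism_time (set_val t) s <= set_val t 0 l.
  by rewrite ge_max t0 ge_min lexx orbT.
have p0 : 0 <= simplex_push prism_face (set_val t) 0 i by rewrite mxE sumr_ge0.
rewrite !mxE /=; case: (eqVneq i e0) => [ie|ie].
  have -> : (i == e1) = false by rewrite ie; apply/negbTE/eqP => /(congr1 val); rewrite /= /bump /=; lia.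
  rewrite sub0r mulrN1 subr_ge0; apply: le_trans cl _.
  rewrite (bigD1 l) /=; first by rewrite lerDl sumr_ge0.
  by apply/eqP/val_inj; rewrite ie /= /bump /=; lia.
by rewrite subr0 addr_ge0 ?mulr_ge0// ?ler0n// sumr_ge0.
Qed.
Definition prism_point (t : TT n) (s : R) : TT n.+1 :=
  exist (fun s => s \in @std_simplex_set R n.+1) _ (prism_point_subproof t s).

Lemma prism_point_continuous : continuous (fun p : TT n * R => prism_point p.1 p.2).
Proof.
have vc : continuous (fun p : TT n * R => set_val p.1 : 'rV[R]_n.+1).
  move=> p; apply: (@continuous_comp _ _ _ fst set_val); [exact: cvg_fst|exact: initial_continuous].
have cc i : continuous (fun p : TT n * R => set_val p.1 0 i : R).
  move=> p; apply: (@continuous_comp _ _ _ (fun p : TT n * R => set_val p.1 : 'rV[R]_n.+1)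
    (fun t : 'rV[R]_n.+1 => t 0 i)); [exact: vc|exact: coord_continuous].
have tc : continuous (fun p : TT n * R => prism_time (set_val p.1) p.2).
  move=> p; apply: (@continuous_max R (TT n * R)%type (cst 0)); first exact: cvg_cst.
  apply: (@continuous_min R (TT n * R)%type (fun p => p.2 - tail_sum (set_val p.1))
    (fun p => set_val p.1 0 l)); last exact: cc.
  apply: cvgB; first exact: cvg_snd.
  exact: continuous_sum_fin.
apply: continuous_comp_initial => p.
have -> : set_val \o (fun p : TT n * R => prism_point p.1 p.2) =
  fun p => simplex_push prism_face (set_val p.1) + prism_time (set_val p.1) p.2 *: prism_edge.
  by [].
apply: cvgD.
  apply: (@continuous_comp _ _ _ (fun p : TT n * R => set_val p.1 : 'rV[R]_n.+1)
    (simplex_push prism_face)); [exact: vc|exact: simplex_push_continuous].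
apply: cvgZl; exact: tc.
Qed.

Lemma prism_pointE (v : TT n.+1) :
  v = prism_point (std_simplex_push prism_fst v)
        (set_val (std_simplex_push prism_snd v) 0 ord_max).
Proof.
have [_ v0] := set_valP v.
apply: val_inj => /=; rewrite /prism_row [LHS](prism_decomposition (\val v)).
congr (_ + _ *: _).
rewrite /prism_time /tail_sum sum_simplex_push.
have -> : simplex_push prism_snd (\val v) 0 ord_max =
    \val v 0 e1 + \sum_(i < n.+2 | (l < prism_fst i)%N) \val v 0 i.
  rewrite mxE (bigD1 e1) /=; last by rewrite ltnSn.
  congr (_ + _); apply: eq_bigl => i.
  have -> : (i == e1) = (i == l.+1 :> nat).
    by apply/eqP/eqP => [->//|h]; apply: val_inj; rewrite /= h.
  by case: (ltnP l i) => h /=; rewrite ?subn0 ?subn1; lia.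
rewrite addrK; have e1v : \val v 0 e1 <= simplex_push prism_fst (\val v) 0 l.
  rewrite mxE (bigD1 e1) /=; last by apply/eqP/val_inj; rewrite /= /bump /=; lia.
  by rewrite lerDl sumr_ge0.
by rewrite (min_idPl e1v) (max_idPr _).
Qed.

End Maps.

Definition prism_piece n (l : 'I_n.+1) (t : TT n) (s : R) : Prop :=
  tail_sum l (set_val t) <= s <= tail_sum l (set_val t) + set_val t 0 l.

Lemma prism_pointK n (l : 'I_n.+1) (t : TT n) (s : R) : prism_piece l t s ->
  std_simplex_push (prism_fst l) (prism_point l t s) = t /\
  set_val (std_simplex_push (prism_snd l) (prism_point l t s)) 0 ord_max = s.
Proof.
move=> lp; have c : prism_time l (set_val t) s = s - tail_sum l (set_val t).
  case/andP: lp => h1 h2; rewrite /prism_time (min_idPl _) ?lerBlDl// (max_idPr _)//.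
  by rewrite subr_ge0.
have [t1 t0] := set_valP t.
split.
  apply: val_inj; rewrite /= /prism_row linearD linearZ /= /prism_edge linearB /=.
  rewrite !simplex_push_delta -simplex_push_comp prism_faceK simplex_push_id.
  have -> : prism_fst l (widen_ord (leqnSn n.+1) l) = prism_fst l (lift ord0 l).
    by apply: val_inj; rewrite /= /bump /=; lia.
  by rewrite subrr scaler0 addr0.
rewrite set_valE /= /prism_row linearD linearZ /= /prism_edge linearB /=.
rewrite !simplex_push_delta -simplex_push_comp.
have -> : prism_snd l (widen_ord (leqnSn n.+1) l) = ord0 by rewrite /= ltnn.
have -> : prism_snd l (lift ord0 l) = ord_max by rewrite /= ltnSn.
rewrite c !mxE !eqxx /= subr0 mulr1 (eq_bigl (fun i : 'I_n.+1 => (l < i)%N)).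
  by rewrite addrC subrK.
by move=> i; rewrite /= /bump /=; case: (leqP l.+1 i) => h; case: (ltnP l) => //; lia.
Qed.

Variables (K L : simplicialSet) (H : simplicialMap (simplicial_prod K (standard_simplex 1)) L).

Definition prism_value n (l : 'I_n.+1) (x : K n) (t : TT n) (s : R) : realization R L :=
  realization_class (smap H (sact (prism_fst l) x, prism_snd l)) (prism_point l t s).

Definition straddles m n (l : 'I_n.+1) (al : delta m n) (be : delta m 1) : Prop :=
  forall i, if be i == ord0 then (al i <= l)%N else (l <= al i)%N.

Lemma straddlesP m n (l : 'I_n.+1) (al : delta m n) (be : delta m 1) :
  (forall i, be i = ord0 -> (al i <= l)%N) ->
  (forall i, be i <> ord0 -> (l <= al i)%N) -> straddles l al be.
Proof. by move=> h0 h1 i; case: eqP => [/h0|/h1]. Qed.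

(* The chain (al, be) of Delta[n] x Delta[1] lies in the [l]-th top simplex of
   the standard triangulation of the prism. *)
Lemma prism_value_straddles m n (l : 'I_n.+1) (al : delta m n) (be : delta m 1)
    (x : K n) (u : TT m) : straddles l al be ->
  realization_class (smap H (sact al x, be)) u =
    prism_value l x (std_simplex_push al u) (set_val (std_simplex_push be u) 0 ord_max)
  /\ prism_piece l (std_simplex_push al u) (set_val (std_simplex_push be u) 0 ord_max).
Proof.
move=> str.
have thP (i : 'I_m.+1) : ((if be i == ord0 then al i : nat else (al i).+1) < n.+2)%N.
  by have := ltn_ord (al i); case: ifP => _; lia.
have thm : {homo (fun i => Ordinal (thP i)) : i j / (i <= j)%O}.
  move=> i j ij; rewrite leEord /=.
  have h1 := delta_homo al ij; have h2 := delta_homo be ij.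
  have [bi|bi] := eqVneq (be i) ord0; have [bj|bj] := eqVneq (be j) ord0; rewrite ?ltnS//.
    exact: leqW.
  by move: bi; rewrite bj in h2; rewrite -(inj_eq val_inj) /= -leqn0 h2.
pose th : delta m n.+1 := mk_delta thm.
have alE : al = (prism_fst l \o th : delta m n).
  apply: delta_eqP => i; apply: val_inj => /=; have := str i.
  have [bi|bi] := eqVneq (be i) ord0; rewrite ?bi ?(negbTE bi) ?eqxx => /= h.
    by rewrite ltnNge h subn0.
  by rewrite ltnS h subn1.
have ord2 (k : 'I_2) : k != ord0 -> k = ord_max.
  by case: k => [[|[|k]]] //= h _; apply: val_inj.
have beE : be = (prism_snd l \o th : delta m 1).
  apply: delta_eqP => i /=; have := str i.
  have [bi|bi] := eqVneq (be i) ord0; rewrite ?bi ?(negbTE bi) ?eqxx => /= h.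
    by rewrite ltnNge h.
  by rewrite ltnS h; exact: ord2.
have u0 := (set_valP u).2.
split; last first.
  rewrite /prism_piece tail_sum_head /tail_sum /= !sum_simplex_push [simplex_push be _ 0 _]mxE.
  apply/andP; split; apply: ler_sum_subpred => // i; have := str i; case: eqP => [-> h|].
  + by rewrite ltnNge h.
  + by move=> /eqP/ord2->.
  + by rewrite -(inj_eq val_inj).
  + by [].
rewrite alE beE sact_comp.
have := smap_natural H th (sact (prism_fst l) x, prism_snd l).
rewrite /= => ->; rewrite realization_class_sact /prism_value; congr realization_class.
rewrite [LHS](prism_pointE l); congr prism_point; first by apply: val_inj; rewrite /= -simplex_push_comp.
by rewrite set_valE /= -simplex_push_comp.
Qed.

(** Take the least [l] whose tail sum is at most [s]. Minimality gives the upper bound, because the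
    tail sum at [l - 1] is the one at [l] plus the coordinate [l]. *)
Lemma prism_piece_exists n (t : TT n) (s : R) : 0 <= s <= 1 -> exists l, prism_piece l t s.
Proof.
have [t1 t0] := set_valP t; case/andP => s0 s1.
have ex : exists l : nat, (l < n.+1)%N && (tail_sum (inord l : 'I_n.+1) (set_val t) <= s).
  exists n; rewrite ltnSn /tail_sum big1// => i; rewrite inordK// => ni.
  by have := ltn_ord i; rewrite ltnS leqNgt ni.
have [l /andP[ln ls] lmin] := ex_minnP ex.
exists (inord l); rewrite /prism_piece ls /=; case: l ln ls lmin => [|l] ln ls lmin.
  by rewrite tail_sum_head inordK// (eq_bigl xpredT)// t1.
have := contra (lmin l); rewrite -ltnNge => /(_ (ltnSn _)).
rewrite (ltnW ln) /= -ltNge => /ltW/le_trans; apply.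
by rewrite tail_sum_head /tail_sum inordK ?(ltnW ln)// inordK.
Qed.

(** If [l < l'], the coordinates strictly between them vanish and [s] is the sum of those from [l']
    on. So [(t, s)] lies on a chain [(al, be)] common to both top simplices, to which
    [prism_value_straddles] applies twice. *)
Lemma prism_value_eq n (l l' : 'I_n.+1) (x : K n) (t : TT n) (s : R) :
  prism_piece l t s -> prism_piece l' t s -> prism_value l x t s = prism_value l' x t s.
Proof.
have [t1 t0] := set_valP t.
wlog ll : l l' / (l < l')%N => [W|] pl pl'.
  have [h|h|/val_inj->//] := ltngtP l l'; first exact: (W l l').
  by rewrite (W l' l h).
have gap (i : 'I_n.+1) : (l < i < l')%N -> set_val t 0 i = 0.
  move=> /andP[li il]; apply/le_anti; rewrite t0 andbT.
  case/andP: pl => h1 _; case/andP: pl' => _ h2; have := le_trans h1 h2.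
  rewrite tail_sum_head /tail_sum (bigD1 i)//= -lerBrDr => /le_trans; apply.
  rewrite subr_le0; apply: ler_sum_subpred => // k lk.
  rewrite (leq_trans ll lk) /=; apply/eqP => ki; rewrite ki in lk.
  by rewrite leqNgt il in lk.
pose al (i : 'I_n.+1) : 'I_n.+1 := if (l < i < l')%N then l else i.
have alm : {homo al : i j / (i <= j)%O}.
  by move=> i j; rewrite !leEord /al; case: ifP => h1; case: ifP => h2; lia.
pose be (i : 'I_n.+1) : 'I_2 := if (l' <= i)%N then ord_max else ord0.
have bem : {homo be : i j / (i <= j)%O}.
  by move=> i j; rewrite !leEord /be; case: ifP => h1; case: ifP => h2 //=; lia.
have alt : std_simplex_push (mk_delta alm) t = t.
  apply: val_inj; apply: simplex_push_fix => i /=; rewrite /al.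
  by case: ifP => // li _; exact: gap.
have bet : set_val (std_simplex_push (mk_delta bem) t) 0 ord_max = s.
  rewrite set_valE /= mxE (eq_bigl (fun i : 'I_n.+1 => (l' <= i)%N)).
    apply/le_anti; case/andP: pl' => _; rewrite tail_sum_head => ->; rewrite andbT.
    case/andP: pl => h _; apply: le_trans h; rewrite /tail_sum.
    by apply: ler_sum_subpred => // k; exact: leq_trans.
  by move=> i; rewrite /= /be; case: ifP.
have [|e1 _] := @prism_value_straddles _ _ l (mk_delta alm) (mk_delta bem) x t.
  by apply: straddlesP => i; rewrite /= /be /al; case: (leqP l' i) => // h1 _; case: ifP => //; lia.
have [|e2 _] := @prism_value_straddles _ _ l' (mk_delta alm) (mk_delta bem) x t.
  by apply: straddlesP => i; rewrite /= /be /al; case: (leqP l' i) => // h1 _; case: ifP => //; lia.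
by rewrite alt bet in e1 e2; rewrite -e1 -e2.
Qed.

Definition clamp01 (s : R) : R := Num.max 0 (Num.min 1 s).

Lemma clamp01_itv s : 0 <= clamp01 s <= 1.
Proof. by rewrite le_max lexx ge_max ler01 ge_min lexx. Qed.

Lemma clamp01_id s : 0 <= s <= 1 -> clamp01 s = s.
Proof. by case/andP=> s0 s1; rewrite /clamp01 (min_idPr s1) (max_idPr s0). Qed.

Lemma clamp01_continuous : continuous clamp01.
Proof.
move=> s; apply: (@continuous_max R R (cst 0)); first exact: cvg_cst.
by apply: (@continuous_min R R (cst 1) id); [exact: cvg_cst|exact: cvg_id].
Qed.

Definition prism_map n (x : K n) (t : TT n) (s : R) : realization R L :=
  prism_value (projT1 (cid (prism_piece_exists t (clamp01_itv s)))) x t (clamp01 s).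

Lemma prism_mapE n (l : 'I_n.+1) (x : K n) (t : TT n) (s : R) :
  prism_piece l t (clamp01 s) -> prism_map x t s = prism_value l x t (clamp01 s).
Proof. by move=> pl; apply: prism_value_eq => //; case: cid. Qed.

Lemma prism_map_continuous n (x : K n) :
  continuous (fun p : TT n * R => prism_map x p.1 p.2).
Proof.
have sc : continuous (fun p : TT n * R => clamp01 p.2).
  by move=> p; apply: (@continuous_comp _ _ _ snd clamp01); [exact: cvg_snd|exact: clamp01_continuous].
have cc i : continuous (fun p : TT n * R => set_val p.1 0 i : R).
  move=> p; apply: (@continuous_comp _ _ _ (fun p : TT n * R => set_val p.1 : 'rV[R]_n.+1)
    (fun t : 'rV[R]_n.+1 => t 0 i)); last exact: coord_continuous.
  by apply: (@continuous_comp _ _ _ fst set_val); [exact: cvg_fst|exact: initial_continuous].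
have tc (l : 'I_n.+1) : continuous (fun p : TT n * R => tail_sum l (set_val p.1)).
  exact: continuous_sum_fin.
apply: (@pasting _ _ 'I_n.+1 (fun l => [set p | prism_piece l p.1 (clamp01 p.2)])
  (fun l p => prism_value l x p.1 (clamp01 p.2))) => [l|l|p|l p].
- have -> : [set p : TT n * R | prism_piece l p.1 (clamp01 p.2)] =
     (fun p => clamp01 p.2 - tail_sum l (set_val p.1)) @^-1` [set r | 0 <= r] `&`
     (fun p => tail_sum l (set_val p.1) + set_val p.1 0 l - clamp01 p.2) @^-1` [set r | 0 <= r].
    apply/seteqP; split=> p /=; rewrite /prism_piece !subr_ge0 => /andP // -[-> ->]//.
  apply: closedI; apply: closed_comp => [p _|]; try exact: closed_ge.
    exact: (cvgB (sc p) (tc l p)).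
  exact: (cvgB (cvgD (tc l p) (cc l p)) (sc p)).
- move=> p; apply: (@continuous_comp _ _ _ (fun p : TT n * R => prism_point l p.1 (clamp01 p.2))
    (realization_class (smap H (sact (prism_fst l) x, prism_snd l)))).
    apply: (@continuous_comp _ _ _ (fun p : TT n * R => (p.1, clamp01 p.2))
       (fun p : TT n * R => prism_point l p.1 p.2)).
      by apply: continuous_pair => //; move=> q; exact: cvg_fst.
    exact: prism_point_continuous.
  exact: realization_class_continuous.
- by have [l lp] := prism_piece_exists p.1 (clamp01_itv p.2); exists l.
- exact: prism_mapE.
Qed.

(** The image of the [l]-th top simplex under [th] is a chain that straddles [th l], so the piece
    [th l] computes the right-hand side. *)
Lemma prism_map_sact m n (th : delta m n) (x : K n) (t : TT m) (s : R) :
  prism_map (sact th x) t s = prism_map x (std_simplex_push th t) s.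
Proof.
have [l lp] := prism_piece_exists t (clamp01_itv s).
rewrite (prism_mapE _ lp) /prism_value -sact_comp.
have [|e p] := @prism_value_straddles _ _ (th l) (th \o prism_fst l : delta m.+1 n)
   (prism_snd l) x (prism_point l t (clamp01 s)).
  apply: straddlesP => i si; apply: delta_homo.
    change ((if (l < i)%N then ord_max else ord0 : 'I_2) = ord0) in si.
    by change ((i - (l < i)%N <= l)%N); move: si; case: (ltnP l i) => h //= _; lia.
  change ((if (l < i)%N then ord_max else ord0 : 'I_2) <> ord0) in si.
  by change ((l <= i - (l < i)%N)%N); move: si; case: (ltnP l i) => h //= _; lia.
have [p1 p2] : std_simplex_push (prism_fst l) (prism_point l t (clamp01 s)) = t /\
   set_val (std_simplex_push (prism_snd l) (prism_point l t (clamp01 s))) 0 ord_max = clamp01 s.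
  exact: prism_pointK.
have E : std_simplex_push (th \o prism_fst l : delta m.+1 n) (prism_point l t (clamp01 s)) =
    std_simplex_push th t.
  by rewrite -[in RHS]p1; apply: val_inj; rewrite /= simplex_push_comp.
by rewrite e E p2 (prism_mapE (l := th l))// -[X in prism_piece _ X _]E -[X in prism_piece _ _ X]p2.
Qed.

Theorem realization_homotopic (f g : simplicialMap K L) :
  (forall n (x : K n), smap H (x, cst ord0 : delta n 1) = smap f x) ->
  (forall n (x : K n), smap H (x, cst ord_max : delta n 1) = smap g x) ->
  homotopic R (realization_map (R := R) f) (realization_map (R := R) g).
Proof.
move=> H0 H1.
have [G GE] : exists G : realization R K -> R -> realization R L,
    forall n (x : K n) t, G (realization_class x t) = prism_map x t.
  apply: realization_lift => m n th x t; apply/funext => s; exact: prism_map_sact.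
exists (fun p => G p.1 p.2); split.
- apply: continuous_subspaceT; apply: realization_prod_continuous => n x.
  under eq_fun do rewrite GE.
  exact: prism_map_continuous.
- elim/realization_ind => n x t; rewrite GE realization_mapE -H0 /=.
  have [|e p] := @prism_value_straddles _ _ ord_max (idfun : delta n n) (cst ord0 : delta n 1) x t.
    by apply: straddlesP => i //=; rewrite -ltnS.
  have E0 : set_val (std_simplex_push (cst ord0 : delta n 1) t) 0 ord_max = clamp01 0.
    by rewrite clamp01_id ?lexx ?ler01// set_valE /= mxE big1.
  have Et : std_simplex_push (idfun : delta n n) t = t by apply: val_inj; exact: simplex_push_id.
  by rewrite sact_id E0 Et in e p; rewrite e (prism_mapE _ p).
- elim/realization_ind => n x t; rewrite GE realization_mapE -H1 /=.
  have [|e p] := @prism_value_straddles _ _ ord0 (idfun : delta n n) (cst ord_max : delta n 1) x t.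
    by apply: straddlesP => i.
  have E1 : set_val (std_simplex_push (cst ord_max : delta n 1) t) 0 ord_max = clamp01 1.
    rewrite clamp01_id ?lexx ?ler01// set_valE /= mxE (eq_bigl xpredT) => [|i].
      by have [] := set_valP t.
    by rewrite /= eqxx.
  have Et : std_simplex_push (idfun : delta n n) t = t by apply: val_inj; exact: simplex_push_id.
  by rewrite sact_id E1 Et in e p; rewrite e (prism_mapE _ p).
Qed.

End Prism.

(** * Retracts of the singular set *)

(** Send [i] to the greatest element of [P] below or equal to the maximum of [i] and [q], where [q]
    is the least element of [P]. Thus a face is the fixed part of an endomorphism of the simplex,
    and no change of dimension is needed to restrict to it. *)
Lemma delta_retract n (P : pred 'I_n.+1) (p0 : 'I_n.+1) : P p0 ->
  exists z : delta n n, (forall i, P (z i)) /\ (forall i, P i -> z i = i).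
Proof.
move=> Pp0; case: (arg_minnP (fun p : 'I_n.+1 => p : nat) Pp0) => q Pq qmin.
pose z (i : 'I_n.+1) := [arg max_(p > q | P p && (p <= maxn i q)%N) (p : nat)].
have zP i : [/\ P (z i), (z i <= maxn i q)%N & forall p, P p -> (p <= maxn i q)%N -> (p <= z i)%N].
  rewrite /z; case: arg_maxnP => [|p /andP[Pp pi] pmax]; first by rewrite Pq leq_maxr.
  by split=> // k Pk ki; apply: pmax; rewrite Pk.
have zm : {homo z : i j / (i <= j)%O}.
  move=> i j; rewrite !leEord => ij; have [h1 h2 _] := zP i; have [_ _ h3] := zP j.
  apply: h3 => //; apply: leq_trans h2 _; rewrite geq_max leq_maxr andbT.
  exact: leq_trans ij (leq_maxl _ _).
exists (mk_delta zm); split=> i /=; first by have [] := zP i.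
move=> Pi; have [h1 h2 h3] := zP i; apply/val_inj/eqP; rewrite eqn_leq /=.
have qi := qmin i Pi; rewrite (maxn_idPl qi) in h2 h3.
by rewrite h2 h3.
Qed.

Section MinContinuous.
Variable R : realType.

Lemma continuous_bigmin (T : topologicalType) (I : Type) (s : seq I)
    (c : T -> R) (f : I -> T -> R) :
  continuous c -> (forall i, continuous (f i)) ->
  continuous (fun t => \big[Num.min/c t]_(i <- s) f i t).
Proof.
move=> cc fc; elim: s => [|i s IH].
  by under eq_fun do rewrite big_nil.
under eq_fun do rewrite big_cons.
by move=> t; exact: (@continuous_min R T (f i) _ t (fc i t) (IH t)).
Qed.

Variables (I : finType) (c : R) (f : I -> R).
Local Notation m := (\big[Num.min/c]_i f i).

Lemma bigmin_le_base : m <= c.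
Proof. by apply/bigmin_leP; left. Qed.

Lemma bigmin_le_term i : m <= f i.
Proof. by apply/bigmin_leP; right; exists i. Qed.

Lemma bigmin_attained : m = c \/ exists i, m = f i.
Proof.
have [h|[i _ h]] : c <= m \/ exists2 i, true & f i <= m by apply/bigmin_leP.
  by left; apply/le_anti; rewrite h bigmin_le_base.
by right; exists i; apply/le_anti; rewrite h bigmin_le_term.
Qed.

End MinContinuous.

Program Definition yoneda (K : simplicialSet) n (y : K n) : simplicialMap (standard_simplex n) K :=
  @SimplicialMap (standard_simplex n) K (fun m (x : delta m n) => sact x y) _.
Next Obligation. by move=> K n y m p th x; rewrite /= sact_comp. Qed.

Section SingularKan.
Variables (R : realType) (X : topologicalType).
Local Notation TT := (std_simplex R).

Lemma mkctsE (T U : topologicalType) (f : T -> U) (fc : continuous f) t : mkcts fc t = f t.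
Proof. by []. Qed.

(** A topological simplex retracts onto its horn: [rho] moves a point towards the vertex [k] until
    another coordinate vanishes, and [f] is evaluated on the facet so reached. *)
Lemma singular_set_kan : kan (singular_set R X).
Proof.
move=> n k f.
have facet_ex a : exists z : delta n.+1 n.+1,
   (forall i, z i <> lift k a) /\ (forall i, i <> lift k a -> z i = i).
  have [|z [z1 z2]] := @delta_retract n.+1 (fun i => i != lift k a) k.
    exact: neq_lift.
  by exists z; split=> [i /eqP|i /eqP]; [rewrite (negbTE (z1 i))|exact: z2].
have [e eP] := choice facet_ex.
have lkF a : (lift k a == k) = false by rewrite eq_sym (negbTE (neq_lift _ _)).
have lk a : lift k a <> k by apply/eqP; rewrite lkF.
have eh a : in_horn k (e a) by exists (lift k a) => //; have [] := eP a.
(* The datum on the facet opposite to [lift k a], spread over the whole simplex by the collapse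
   [e a]. *)
pose phi a : TT n.+1 -> X := smap f (exist _ _ (eh a)).
have phic a : continuous (phi a) by exact: cts_fun.
have horn_push m (x : delta m n.+1) (hx : in_horn k x) a (t : TT m) :
    (forall i, x i <> lift k a) -> phi a (std_simplex_push x t) = smap f (exist _ x hx) t.
  move=> xa.
  have -> : exist (fun x => in_horn k x) x hx = sact x (exist _ _ (eh a) : horn k n.+1).
    apply: eq_exist; apply: delta_eqP => i /=; have [_ h] := eP a; by rewrite h.
  by rewrite smap_natural.
(* The face common to both facets contains the vertex [k], so there is a collapse onto it, and this
   collapse lies in the horn. *)
have agree a b (t : TT n.+1) :
    set_val t 0 (lift k a) = 0 -> set_val t 0 (lift k b) = 0 -> phi a t = phi b t.
  move=> ta tb.
  have [|z [z1 z2]] := @delta_retract n.+1 (fun i => (i != lift k a) && (i != lift k b)) k.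
    by rewrite !neq_lift.
  have za i : z i <> lift k a by apply/eqP; have /andP[] := z1 i.
  have zb i : z i <> lift k b by apply/eqP; have /andP[] := z1 i.
  have tz : t = std_simplex_push z t.
    apply: val_inj; apply/esym; apply: simplex_push_fix => i zi.
    have [->//|ia] := eqVneq i (lift k a); have [->//|ib] := eqVneq i (lift k b).
    by case: zi; apply: z2; rewrite ia ib.
  have zh : in_horn k z by exists (lift k a).
  by rewrite tz (horn_push _ _ zh)// (horn_push _ _ zh).
pose mu (t : TT n.+1) : R := \big[Num.min/1]_a set_val t 0 (lift k a).
have t0 (t : TT n.+1) i : 0 <= set_val t 0 i by have [] := set_valP t.
have t1 (t : TT n.+1) : \sum_i set_val t 0 i = 1 by have [] := set_valP t.
have cc i : continuous (fun t : TT n.+1 => set_val t 0 i : R).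
  move=> t; apply: (@continuous_comp _ _ _ (set_val : TT n.+1 -> _)
    (fun t : 'rV[R]_n.+2 => t 0 i)); [exact: initial_continuous|exact: coord_continuous].
have muc : continuous mu.
  by apply: (@continuous_bigmin R (TT n.+1) _ _ (cst 1)); [exact: cst_continuous|move=> a; exact: cc].
have mu0 t : 0 <= mu t by apply: le_bigmin => // a _; exact: t0.
(* There are [n.+1] coordinates besides the [k]-th, which receives all that they lose. *)
pose rho_row (t : TT n.+1) : 'rV[R]_n.+2 :=
  \row_i (set_val t 0 i + (if i == k then n.+1%:R else -1) * mu t).
have rhoP t : rho_row t \in @std_simplex_set R n.+1.
  apply/mem_set; split.
    under eq_bigr do rewrite mxE.
    rewrite big_split /= t1 -mulr_suml (bigD1_ord k)//= eqxx.
    rewrite (eq_bigr (fun=> -1)) => [|a _]; last by rewrite lkF.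
    by rewrite sumr_const card_ord mulNrn subrr mul0r addr0.
  move=> i; rewrite mxE; case: (unliftP k i) => [a ->|->].
    rewrite lkF mulN1r subr_ge0; exact: bigmin_le_term.
  by rewrite eqxx addr_ge0// mulr_ge0.
pose rho t : TT n.+1 := exist (fun s => s \in @std_simplex_set R n.+1) _ (rhoP t).
have rhoc : continuous rho.
  apply: continuous_comp_initial; apply: continuous_rV => i.
  have -> : (fun t => (set_val \o rho) t 0 i) =
      fun t : TT n.+1 => set_val t 0 i + (if i == k then n.+1%:R else -1) * mu t.
    by apply/funext => t; rewrite /= set_valE /= mxE.
  by move=> t; exact: (cvgD (cc i t) (cvgM (cvg_cst _) (muc t))).
have att (t : TT n.+1) : exists a, set_val t 0 (lift k a) <= mu t.
  have [h|[a h]] := bigmin_attained 1 (fun a => set_val t 0 (lift k a)); last by exists a; rewrite /mu h.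
  exists ord0; rewrite /mu h -(t1 t) (bigD1 (lift k ord0))//= lerDl.
  by apply: sumr_ge0.
pose g (t : TT n.+1) := phi (projT1 (cid (att t))) (rho t).
have rho_zero a (t : TT n.+1) : set_val t 0 (lift k a) <= mu t -> set_val (rho t) 0 (lift k a) = 0.
  move=> h; rewrite set_valE /= mxE lkF mulN1r.
  apply/eqP; rewrite subr_eq0; apply/eqP/le_anti; rewrite h.
  exact: bigmin_le_term.
have gE a (t : TT n.+1) : set_val t 0 (lift k a) <= mu t -> g t = phi a (rho t).
  by move=> h; apply: agree; apply: rho_zero => //; case: cid.
have gc : continuous g.
  apply: (@pasting _ _ 'I_n.+1 (fun a => [set t : TT n.+1 | set_val t 0 (lift k a) <= mu t])
    (fun a t => phi a (rho t))) => [a|a t|t|a t].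
  - have -> : [set t : TT n.+1 | set_val t 0 (lift k a) <= mu t] =
        (fun t : TT n.+1 => mu t - set_val t 0 (lift k a)) @^-1` [set r | 0 <= r].
      by apply/seteqP; split=> t /=; rewrite subr_ge0.
    apply: closed_comp => [t _|]; last exact: closed_ge.
    exact: (cvgB (muc t) (cc _ t)).
  - by apply: (@continuous_comp _ _ _ rho (phi a)); [exact: rhoc|exact: phic].
  - exact: att.
  - exact: gE.
exists (yoneda (mkcts gc : singular_set R X n.+1)) => m [x hx].
have [j jk xj] := hx.
have [a ja] : exists a, j = lift k a by case: (unliftP k j) jk => [a ->|->//]; exists a.
apply/continuousEP => t; rewrite -(horn_push m x hx a) => [|i]; last by rewrite -ja.
rewrite /= mkctsE /=.
have xa : set_val (std_simplex_push x t) 0 (lift k a) = 0.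
  rewrite set_valE /= mxE big1// => i /eqP xi; case: (xj i).
  by rewrite xi -ja.
have m0 : mu (std_simplex_push x t) = 0.
  by apply/le_anti; rewrite mu0 andbT -xa; exact: bigmin_le_term.
rewrite [LHS](gE a) ?xa ?m0//; congr phi; apply: val_inj; apply/rowP => i.
by rewrite mxE m0 mulr0 addr0.
Qed.

End SingularKan.

(** Homotopies are continuous for times in the unit interval only; with clamped time they are
    continuous everywhere and can be pasted. *)
Lemma within_continuous_clamp (R : realType) (S T Y : topologicalType) (H : S * R -> Y)
    (f : T -> S) (g : T -> R) :
  {within [set: S] `*` `[0, 1]%classic, continuous H} ->
  continuous f -> continuous g -> continuous (fun t => H (f t, clamp01 (g t))).
Proof.
move=> Hc fc gc t A HA.
pose D : set (S * R) := [set: S] `*` `[0, 1]%classic.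
have pD u : D (f u, clamp01 (g u)) by split=> //=; rewrite in_itv /= clamp01_itv.
have W : within D (nbhs (f t, clamp01 (g t))) (H @^-1` A).
  rewrite (nbhs_subspace_in (pD t)); exact: (Hc _ A HA).
have pc : continuous (fun u => (f u, clamp01 (g u))).
  apply: continuous_pair => // u.
  by apply: continuous_comp; [exact: gc|exact: clamp01_continuous].
have := pc t _ W; rewrite nbhs_simpl /=; apply: filterS => u /=; apply; exact: pD.
Qed.

Section Retract.
Variables (K L : simplicialSet) (i : simplicialMap K L).

Program Definition smap_comp (A B C : simplicialSet) (g : simplicialMap B C)
    (f : simplicialMap A B) : simplicialMap A C := @SimplicialMap A C (fun n x => smap g (smap f x)) _.
Next Obligation.
by move=> A B C g f m n th x /=; rewrite (smap_natural f) (smap_natural g).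
Qed.

Program Definition smap_id (A : simplicialSet) : simplicialMap A A :=
  @SimplicialMap A A (fun n x => x) _.
Next Obligation. by []. Qed.

Lemma kan_retract : strong_deformation_retract i -> kan L -> kan K.
Proof.
move=> [r [_ [ri _ _ _]]] kL n k f.
have [g gP] := kL n k (smap_comp i f).
exists (smap_comp r g) => m x.
by rewrite /= gP /= ri.
Qed.

Lemma realization_map_comp (R : realType) (A B C : simplicialSet) (g : simplicialMap B C)
    (f : simplicialMap A B) u :
  realization_map (R := R) (smap_comp g f) u = realization_map g (realization_map f u).
Proof. by elim/realization_ind: u => n x t; rewrite !realization_mapE. Qed.

Lemma realization_map_id (R : realType) (A : simplicialSet) u :
  realization_map (R := R) (smap_id A) u = u.
Proof. by elim/realization_ind: u => n x t; rewrite realization_mapE. Qed.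

Lemma weak_equivalence_retract (R : realType) :
  strong_deformation_retract i -> weak_equivalence R i.
Proof.
move=> [r [H [ri H0 H1 _]]]; split; first exact: realization_map_continuous.
exists (realization_map r); split; first exact: realization_map_continuous.
  have E u : realization_map r (realization_map (R := R) i u) = u.
    by elim/realization_ind: u => n x t; rewrite !realization_mapE ri.
  exists fst; split; [|by move=> u /=; rewrite E|by []].
  by apply: continuous_subspaceT => p; exact: cvg_fst.
have [G [Gc G0 G1]] := realization_homotopic (f := smap_id L) (g := smap_comp i r) R H0 H1.
(* [G] runs from the identity to the composite, and the definition asks for the opposite direction:
   time is reversed. *)
exists (fun p : realization R L * R => G (p.1, clamp01 (1 - p.2))); split => [|u|u].
- apply: continuous_subspaceT.
  apply: (@within_continuous_clamp R (realization R L) (realization R L * R)%type _ G fst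
    (fun p => 1 - p.2)) => // p; first exact: cvg_fst.
  by apply: cvgB; [exact: cvg_cst|exact: cvg_snd].
- by rewrite /= subr0 clamp01_id ?ler01 ?lexx// G1 realization_map_comp.
- by rewrite /= subrr clamp01_id ?ler01 ?lexx// G0 realization_map_id.
Qed.

End Retract.

(** * Continuous extension of boundary data to an affine simplex *)

Section ContinuousArith.
Variables (K : numFieldType) (T : topologicalType) (f g : T -> K).
Hypotheses (fc : continuous f) (gc : continuous g).

Lemma continuous_add : continuous (fun t => f t + g t : K).
Proof. by move=> t; exact: (cvgD (@fc t) (@gc t)). Qed.

Lemma continuous_sub : continuous (fun t => f t - g t : K).
Proof. by move=> t; exact: (cvgB (@fc t) (@gc t)). Qed.

Lemma continuous_mul : continuous (fun t => f t * g t : K).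
Proof. by move=> t; exact: (cvgM (@fc t) (@gc t)). Qed.

End ContinuousArith.

Section SoftThreshold.
Variable R : realType.

Definition soft (m x : R) : R := Num.max 0 (x - m) + Num.min 0 (x + m).

Lemma soft_small m x : `|x| <= m -> soft m x = 0.
Proof.
rewrite ler_norml => /andP[h1 h2]; rewrite /soft (max_idPl _) ?subr_le0//.
by rewrite (min_idPl _) ?addr0// -lerBlDr sub0r.
Qed.

Lemma soft0 x : soft 0 x = x.
Proof. by rewrite /soft subr0 addr0; have [h|h] := leP 0 x; rewrite ?addr0 ?add0r. Qed.

Lemma soft_pos m x : 0 <= m -> 0 <= x -> soft m x = Num.max 0 (x - m).
Proof. by move=> m0 x0; rewrite /soft (min_idPl _) ?addr0// addr_ge0. Qed.

Lemma soft_continuous (T : topologicalType) (f g : T -> R) :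
  continuous f -> continuous g -> continuous (fun t => soft (f t) (g t)).
Proof.
move=> fc gc t; apply: cvgD.
  apply: (@continuous_max R T (cst 0) (fun t => g t - f t)); first exact: cst_continuous.
  exact: (cvgB (gc t) (fc t)).
apply: (@continuous_min R T (cst 0) (fun t => g t + f t)); first exact: cst_continuous.
exact: (cvgD (gc t) (fc t)).
Qed.

End SoftThreshold.

Section Core.
Variables (R : realType) (X : complexManifold R) (n : nat).
Local Notation N := n.+1.
Local Notation C := (Cplx R).
Local Notation Re := (@complex.Re R).
Local Notation Im := (@complex.Im R).
Local Notation "x %:C" := (real_complex R x : C) (format "x %:C").
Local Notation TT := (std_simplex R N).
Local Notation AA := (affine_simplex R N).
Implicit Types (t : AA) (s : R) (i j : 'I_N.+1).

(** The maximum norm, because thresholding will act on real and imaginary parts separately and has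
    to annihilate both. *)
Definition coordmod t i : R := Num.max `|Re (set_val t 0 i)| `|Im (set_val t 0 i)|.

Lemma coordmod_ge0 t i : 0 <= coordmod t i.
Proof. by rewrite le_max normr_ge0. Qed.

Lemma coordmod_eq0 t i : set_val t 0 i = 0 -> coordmod t i = 0.
Proof. by move=> h; rewrite /coordmod h normr0 maxxx. Qed.

Lemma coord_val_continuous i : continuous (fun t => set_val t 0 i : C).
Proof.
move=> t; apply: (@continuous_comp _ _ _ (set_val : AA -> _)
  (fun t : 'rV[C]_N.+1 => t 0 i)); [exact: initial_continuous|exact: coord_continuous].
Qed.

Lemma Re_coord_continuous i : continuous (fun t => Re (set_val t 0 i)).
Proof.
move=> t; apply: (@continuous_comp _ _ _ (fun t : AA => set_val t 0 i : C) Re);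
 [exact: coord_val_continuous|exact: Re_continuous].
Qed.

Lemma Im_coord_continuous i : continuous (fun t => Im (set_val t 0 i)).
Proof.
move=> t; apply: (@continuous_comp _ _ _ (fun t : AA => set_val t 0 i : C) Im);
 [exact: coord_val_continuous|exact: Im_continuous].
Qed.

Lemma coordmod_continuous i : continuous (fun t => coordmod t i).
Proof.
move=> t; apply: (@continuous_max R AA (fun t => `|Re (set_val t 0 i)|)
  (fun t => `|Im (set_val t 0 i)|)).
  apply: (@continuous_comp _ _ _ (fun t => Re (set_val t 0 i)) (@Num.norm R R)).
    exact: Re_coord_continuous.
  exact: norm_continuous.
apply: (@continuous_comp _ _ _ (fun t => Im (set_val t 0 i)) (@Num.norm R R)).
  exact: Im_coord_continuous.
exact: norm_continuous.
Qed.

(* Below 1 / n.+2, so that some coordinate of real part > c2 always remains. *)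
Let c2 : R := (2 * N.+1%:R)^-1.
Let c2_gt0 : 0 < c2.
Proof. by rewrite invr_gt0 mulr_gt0// ltr0n. Qed.

(** The least coordinate modulus, capped. The cap is 0 at time 0, so that nothing is shrunk at the
    start; later, points near a hyperplane are those where a coordinate rather than the cap attains
    the minimum. *)
Definition shrink_amount (q : AA * R) : R :=
  \big[Num.min/c2 * Num.min q.2 1]_i coordmod q.1 i.
Local Notation m := shrink_amount.

Lemma shrink_amount_le q : m q <= c2.
Proof.
apply: le_trans (bigmin_le_base _ _) _.
by rewrite ger_pMr// ge_min lexx orbT.
Qed.

Lemma shrink_amount_continuous : continuous m.
Proof.
apply: (@continuous_bigmin R (AA * R)%type _ _ (fun q => c2 * Num.min q.2 1)) => [q|i q].
  apply: cvgM; first exact: cst_continuous.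
  apply: (@continuous_min R (AA * R)%type snd (cst 1)); [exact: cvg_snd|exact: cst_continuous].
by apply: (@continuous_comp _ _ _ fst (fun t => coordmod t i)); [exact: cvg_fst|exact: coordmod_continuous].
Qed.

Lemma sum_Re t : \sum_i Re (set_val t 0 i) = 1.
Proof.
have := set_valP t; rewrite /affine_simplex_set /= => /(congr1 Re) /= <-.
by rewrite raddf_sum.
Qed.

Definition shrink_total (q : AA * R) : R := \sum_i Num.max 0 (Re (set_val q.1 0 i) - m q).

(** The real parts sum to 1, and at most [c2 * N.+1 = 1 / 2] is subtracted from them in total. *)
Lemma shrink_total_gt0 q : 0 < shrink_total q.
Proof.
have : \sum_i (Re (set_val q.1 0 i) - m q) <= shrink_total q.
  by apply: ler_sum => i _; rewrite le_max lexx orbT.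
rewrite sumrB sum_Re sumr_const card_ord => h.
apply: lt_le_trans h; rewrite subr_gt0.
have h := shrink_amount_le q.
rewrite -mulr_natr; apply: le_lt_trans (_ : c2 * N.+1%:R < 1).
  by rewrite ler_wpM2r// ler0n.
rewrite /c2 invfM -mulrA mulVf ?mulr1; last by rewrite pnatr_eq0.
by rewrite invf_lt1// ltr1n.
Qed.

Lemma shrink_subproof (q : AA * R) :
  (\row_i (Num.max 0 (Re (set_val q.1 0 i) - m q) / shrink_total q)) \in @std_simplex_set R N.
Proof.
have D0 := shrink_total_gt0 q; apply/mem_set; split.
  under eq_bigr do rewrite mxE.
  by rewrite -mulr_suml divff// gt_eqF.
by move=> i; rewrite mxE divr_ge0 ?(ltW D0)// le_max lexx.
Qed.
Definition shrink (q : AA * R) : TT :=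
  exist (fun u => u \in @std_simplex_set R N) _ (shrink_subproof q).

Lemma shrink_val q i :
  set_val (shrink q) 0 i = Num.max 0 (Re (set_val q.1 0 i) - m q) / shrink_total q.
Proof. by rewrite set_valE /= mxE. Qed.

Lemma shrink_continuous : continuous shrink.
Proof.
have tc i : continuous (fun q : AA * R => Num.max 0 (Re (set_val q.1 0 i) - m q)).
  move=> q; apply: (@continuous_max R (AA * R)%type (cst 0)
    (fun q => Re (set_val q.1 0 i) - m q)); first exact: cst_continuous.
  apply: cvgB; last exact: shrink_amount_continuous.
  by apply: (@continuous_comp _ _ _ fst (fun t => Re (set_val t 0 i)));
    [exact: cvg_fst|exact: Re_coord_continuous].
apply: continuous_comp_initial; apply: continuous_rV => i q.
have -> : (fun q => (set_val \o shrink) q 0 i) =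
  fun q => Num.max 0 (Re (set_val q.1 0 i) - m q) / shrink_total q.
  by apply/funext => q'; exact: shrink_val.
apply: cvgM; first exact: tc.
apply: cvgV; first by rewrite gt_eqF// shrink_total_gt0.
by apply: (@continuous_sum_fin R) => j; exact: tc.
Qed.

Lemma shrink_eq0 q j : coordmod q.1 j <= m q -> set_val (shrink q) 0 j = 0.
Proof.
move=> h; rewrite shrink_val (max_idPl _) ?mul0r// subr_le0.
by apply: le_trans h; rewrite le_max ler_norm.
Qed.

Lemma std_to_affine_val (t : TT) i : set_val (std_to_affine t) 0 i = (set_val t 0 i)%:C.
Proof. by rewrite set_valE /= mxE. Qed.

Lemma shrink_id (t : TT) s : m (std_to_affine t, s) = 0 -> shrink (std_to_affine t, s) = t.
Proof.
move=> m0; have [t1 t0] := set_valP t.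
have E i : Num.max 0 (Re (set_val (std_to_affine t) 0 i) - m (std_to_affine t, s)) = set_val t 0 i.
  by rewrite m0 subr0 std_to_affine_val /= (max_idPr (t0 i)).
apply: val_inj; apply/rowP => i; rewrite -[LHS]/(set_val (shrink _) 0 i) shrink_val /= E.
rewrite /shrink_total (eq_bigr (fun i => set_val t 0 i)) => [|k _]; last exact: E.
by rewrite t1 divr1.
Qed.

Variables (y : TT -> X) (k : 'I_N.+1 -> TT * R -> X)
  (r : 'I_N.+1 -> holoMap (affine_simplex_manifold R N) X) (a : R).
Hypothesis a0 : 0 < a.
Hypothesis yc : continuous y.
Hypothesis kc : forall j, continuous (k j).
Hypothesis rr : forall i j t, set_val t 0 i = 0 -> set_val t 0 j = 0 -> r i t = r j t.
Hypothesis kk : forall i j (t : TT) s,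
  set_val t 0 i = 0 -> set_val t 0 j = 0 -> k i (t, s) = k j (t, s).
Hypothesis k0 : forall j (t : TT) s, set_val t 0 j = 0 -> s <= 0 -> k j (t, s) = y t.
Hypothesis ka : forall j (t : TT) s,
  set_val t 0 j = 0 -> a <= s -> k j (t, s) = r j (std_to_affine t).

Let rc j : continuous (r j : AA -> X).
Proof. by move=> t; have [] := @holo_funP _ _ _ (r j) t I. Qed.

(** For [s] in the unit interval, this is [a * s] on the hyperplanes, where [m = 0], and 0 where [m]
    attains its cap [c2 * s]. The slope [2 / c2] is chosen such that at [s = 1] the full time [a] is
    reached as long as [m <= c2 / 2]. *)
Let time (q : AA * R) : R :=
  a * Num.min (Num.min q.2 1) (Num.max 0 (2 * Num.min q.2 1 - m q / (c2 / 2))).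

Let time_continuous : continuous time.
Proof.
have s1 : continuous (fun q : AA * R => Num.min q.2 1).
  move=> q; apply: (@continuous_min R (AA * R)%type snd (cst 1)); [exact: cvg_snd|exact: cst_continuous].
move=> q; apply: cvgM; first exact: cst_continuous.
apply: (@continuous_min R (AA * R)%type (fun q => Num.min q.2 1)); first exact: s1.
apply: (@continuous_max R (AA * R)%type (cst 0)); first exact: cst_continuous.
apply: cvgB; first by apply: cvgM; [exact: cst_continuous|exact: s1].
by apply: cvgM; [exact: shrink_amount_continuous|exact: cst_continuous].
Qed.

(* [shrink] maps the points where the j-th coordinate is of least modulus to the
   j-th facet; there [k j] is run, for a time that decreases to 0 towards the region
   where no coordinate is small, on which [y] is used. *)
Definition collar_map (q : AA * R) : X :=
  if [pick j | coordmod q.1 j <= m q] is Some j then k j (shrink q, time q) else y (shrink q).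

Lemma collar_map_face q j : coordmod q.1 j <= m q -> collar_map q = k j (shrink q, time q).
Proof.
move=> h; rewrite /collar_map; case: pickP => [i hi|/(_ j)]; last by rewrite h.
by apply: kk; exact: shrink_eq0.
Qed.

Lemma collar_map_inner q : c2 * Num.min q.2 1 <= m q -> collar_map q = y (shrink q).
Proof.
move=> h; rewrite /collar_map; case: pickP => // i hi.
apply: k0; first exact: shrink_eq0.
rewrite /time pmulr_rle0// ge_min; apply/orP; right; rewrite ge_max lexx /= subr_le0.
by rewrite ler_pdivlMr ?divr_gt0// -mulrA mulrCA (mulrC 2) divfK// mulrC.
Qed.

Lemma collar_map_continuous : continuous collar_map.
Proof.
pose D (o : option 'I_N.+1) : set (AA * R) :=
  if o is Some j then [set q | coordmod q.1 j <= m q] else [set q | c2 * Num.min q.2 1 <= m q].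
pose f (o : option 'I_N.+1) (q : AA * R) :=
  if o is Some j then k j (shrink q, time q) else y (shrink q).
apply: (@pasting _ _ _ D f) => [[j|]|[j|]|q|[j|] q] /=.
- have -> : [set q : AA * R | coordmod q.1 j <= m q] =
    (fun q : AA * R => m q - coordmod q.1 j) @^-1` [set r | 0 <= r].
    by apply/seteqP; split=> q /=; rewrite subr_ge0.
  apply: closed_comp => [q _|]; last exact: closed_ge.
  apply: cvgB; first exact: shrink_amount_continuous.
  by apply: (@continuous_comp _ _ _ fst (fun t => coordmod t j)); [exact: cvg_fst|exact: coordmod_continuous].
- have -> : [set q : AA * R | c2 * Num.min q.2 1 <= m q] =
    (fun q : AA * R => m q - c2 * Num.min q.2 1) @^-1` [set r | 0 <= r].
    by apply/seteqP; split=> q /=; rewrite subr_ge0.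
  apply: closed_comp => [q _|]; last exact: closed_ge.
  apply: cvgB; first exact: shrink_amount_continuous.
  apply: cvgM; first exact: cst_continuous.
  by apply: (@continuous_min R (AA * R)%type snd (cst 1)); [exact: cvg_snd|exact: cst_continuous].
- move=> q; apply: (@continuous_comp _ _ _ (fun q => (shrink q, time q)) (k j)); last exact: kc.
  by apply: continuous_pair; [exact: shrink_continuous|exact: time_continuous].
- by move=> q; apply: (@continuous_comp _ _ _ shrink y); [exact: shrink_continuous|exact: yc].
- have [h|[j h]] := bigmin_attained (c2 * Num.min q.2 1) (fun i => coordmod q.1 i).
    by exists None; rewrite /D /= -h.
  by exists (Some j); rewrite /D /= -h.
- exact: collar_map_face.
- exact: collar_map_inner.
Qed.

Lemma collar_map_start (t : TT) : collar_map (std_to_affine t, 0) = y t.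
Proof.
have m0 : m (std_to_affine t, 0) = 0.
  apply/le_anti; rewrite (le_trans (bigmin_le_base _ _)) /= ?(min_idPl ler01) ?mulr0//.
  by rewrite /m /= (min_idPl ler01) mulr0; apply: le_bigmin => // i _; exact: coordmod_ge0.
by rewrite collar_map_inner /= ?shrink_id// m0 (min_idPl ler01) mulr0.
Qed.

Lemma shrink_amount0 t s j : 0 <= s -> set_val t 0 j = 0 -> m (t, s) = 0.
Proof.
move=> s0 tj; apply/le_anti; apply/andP; split.
  by rewrite -(coordmod_eq0 tj); exact: bigmin_le_term.
apply: le_bigmin => [|i _]; last exact: coordmod_ge0.
by rewrite mulr_ge0 ?(ltW c2_gt0)// le_min s0 ler01.
Qed.

Lemma collar_map_boundary (t : TT) s j : 0 <= s <= 1 -> set_val t 0 j = 0 ->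
  collar_map (std_to_affine t, s) = k j (t, a * s).
Proof.
case/andP=> s0 s1 tj.
have tj' : set_val (std_to_affine t) 0 j = 0.
  by rewrite std_to_affine_val tj rmorph0.
have m0 := shrink_amount0 s0 tj'.
rewrite (@collar_map_face _ j) ?shrink_id ?m0 ?coordmod_eq0//.
rewrite /time m0 mul0r subr0 /= (min_idPl s1) (max_idPr _) ?mulr_ge0// (min_idPl _)//.
by rewrite mulr_natl mulr2n lerDl.
Qed.

Let speed t : R := Num.min (m (t, 1) / (c2 / 2)) 1.
Let st t i : C := (soft (m (t, 1)) (Re (set_val t 0 i)) +i* soft (m (t, 1)) (Im (set_val t 0 i)))%C.

(* Soft thresholding annihilates the coordinates of least modulus, so that near the
   coordinate hyperplanes [slide] takes values in them, and [r] can be applied; as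
   [m] grows to [c2 / 2], [slide t] moves to the point [shrink (t, 1)] of the real
   simplex, where [r j] is the end of the homotopy [k j]. *)
Definition slide_row t : 'rV[C]_N.+1 :=
  \row_i ((1 - speed t)%:C * st t i +
    (1 - (1 - speed t)%:C * \sum_l st t l) * (set_val (shrink (t, 1)) 0 i)%:C).

Lemma slide_subproof t : slide_row t \in @affine_simplex_set R N.
Proof.
apply/mem_set; rewrite /affine_simplex_set /=.
under eq_bigr do rewrite mxE.
rewrite big_split /= -!mulr_sumr -rmorph_sum; have [-> _] := set_valP (shrink (t, 1)).
by rewrite rmorph1 mulr1 addrC subrK.
Qed.
Definition slide t : AA := exist (fun u => u \in @affine_simplex_set R N) _ (slide_subproof t).

Let pair1c : continuous (fun t : AA => (t, 1 : R)).
Proof. by apply: continuous_pair; [move=> t; exact: cvg_id|exact: cst_continuous]. Qed.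

Let m1c : continuous (fun t : AA => m (t, 1)).
Proof.
by move=> t; apply: (@continuous_comp _ _ _ (fun t : AA => (t, 1 : R)) m);
  [exact: pair1c|exact: shrink_amount_continuous].
Qed.

Lemma slide_continuous : continuous slide.
Proof.
have stc i : continuous (fun t => st t i).
  by apply: Complex_continuous; apply: soft_continuous => //;
    [exact: Re_coord_continuous|exact: Im_coord_continuous].
have spc : continuous (fun t => (1 - speed t)%:C).
  move=> t; apply: (@continuous_comp _ _ _ (fun t => 1 - speed t) (real_complex R : R -> C));
    last exact: real_complex_continuous.
  apply: (@continuous_sub R AA (cst 1)); first exact: cst_continuous.
  move=> t'; apply: (@continuous_min R AA (fun t => m (t, 1) / (c2 / 2)) (cst 1));
    last exact: cst_continuous.
  by apply: (@continuous_mul R AA _ (cst _)); [exact: m1c|exact: cst_continuous].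
have shc i : continuous (fun t => (set_val (shrink (t, 1)) 0 i)%:C).
  move=> t.
  apply: (@continuous_comp _ _ _ (fun t => set_val (shrink (t, 1)) 0 i : R) (real_complex R : R -> C));
    last exact: real_complex_continuous.
  apply: (@continuous_comp _ _ _ (fun t => shrink (t, 1)) (fun x : TT => set_val x 0 i : R)).
    by apply: (@continuous_comp _ _ _ (fun t : AA => (t, 1 : R)) shrink);
    [exact: pair1c|exact: shrink_continuous].
  by apply: (@continuous_comp _ _ _ (set_val : TT -> _) (fun t : 'rV[R]_N.+1 => t 0 i));
    [exact: initial_continuous|exact: coord_continuous].
apply: continuous_comp_initial; apply: continuous_rV => i.
have -> : (fun t => (set_val \o slide) t 0 i) = fun t => (1 - speed t)%:C * st t i +
    (1 - (1 - speed t)%:C * \sum_l st t l) * (set_val (shrink (t, 1)) 0 i)%:C.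
  by apply/funext => t'; rewrite /= set_valE /= mxE.
have sumc := @continuous_sum_fin C AA _ (index_enum _) xpredT (fun l t => st t l) stc.
have c1 : continuous (fun t => 1 - (1 - speed t)%:C * \sum_l st t l : C).
  exact: (continuous_sub (@cst_continuous AA C 1) (continuous_mul spc sumc)).
exact: (continuous_add (continuous_mul spc (stc i)) (continuous_mul c1 (shc i))).
Qed.

Lemma slide_eq0 t j : coordmod t j <= m (t, 1) -> set_val (slide t) 0 j = 0.
Proof.
move=> h; rewrite set_valE /= mxE shrink_eq0// rmorph0 mulr0 addr0.
have [h1 h2] : `|Re (set_val t 0 j)| <= m (t, 1) /\ `|Im (set_val t 0 j)| <= m (t, 1).
  by split; apply: le_trans h; rewrite le_max lexx ?orbT.
by rewrite /st !soft_small// mulr0.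
Qed.

Lemma slide_face t j : set_val t 0 j = 0 -> slide t = t.
Proof.
move=> tj; have m0 := shrink_amount0 ler01 tj.
have stE i : st t i = set_val t 0 i by rewrite /st m0 !soft0; case: (set_val t 0 i).
apply: val_inj; apply/rowP => i; rewrite mxE stE.
rewrite /speed m0 mul0r (min_idPl ler01) subr0 rmorph1 !mul1r.
rewrite (eq_bigr _ (fun i _ => stE i)) (set_valP t) subrr mul0r addr0.
by [].
Qed.

Lemma slide_inner t : c2 / 2 <= m (t, 1) -> slide t = std_to_affine (shrink (t, 1)).
Proof.
move=> h; have sp : speed t = 1.
  by rewrite /speed (min_idPr _)// ler_pdivlMr ?divr_gt0// mul1r.
apply: val_inj; apply/rowP => i.
by rewrite !mxE sp subrr rmorph0 !mul0r add0r subr0 mul1r.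
Qed.

(** On real simplex points the thresholded coordinates are [shrink_total] times those of [shrink],
    so both terms of [slide_row] are multiples of one point and the speed cancels. Hence the
    extension agrees there with the end of the collar homotopy. *)
Lemma slide_std (t : TT) : slide (std_to_affine t) = std_to_affine (shrink (std_to_affine t, 1)).
Proof.
have [_ t0] := set_valP t.
set t' := std_to_affine t.
have m0 : 0 <= m (t', 1).
  apply: le_bigmin => [|i _]; last exact: coordmod_ge0.
  by rewrite mulr_ge0 ?(ltW c2_gt0)// le_min ler01.
have stE i : st t' i = (Num.max 0 (Re (set_val t' 0 i) - m (t', 1)))%:C.
  have Ri : Re (set_val t' 0 i) = set_val t 0 i by rewrite std_to_affine_val.
  have Ii : Im (set_val t' 0 i) = 0 by rewrite std_to_affine_val.
  have s1 : soft (m (t', 1)) 0 = 0 by rewrite soft_small// normr0.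
  by rewrite /st Ii s1 soft_pos// Ri.
have sumE : \sum_l st t' l = (shrink_total (t', 1))%:C.
  by rewrite (eq_bigr _ (fun i _ => stE i)) -rmorph_sum.
apply: val_inj; apply/rowP => i.
rewrite [LHS]mxE -[RHS]/(set_val (std_to_affine _) 0 i) std_to_affine_val sumE stE !shrink_val /=.
rewrite -rmorphM -(rmorph1 (real_complex R)) -!rmorphM -rmorphB -rmorphM -rmorphD.
congr (real_complex R _).
have := shrink_total_gt0 (t', 1); move: (shrink_total _) => D D0.
by field; rewrite gt_eqF.
Qed.

(** If [m <= c2 / 2], the minimum is below its cap [c2] at time 1, hence attained by a coordinate:
    the default of the inner test never occurs. *)
Definition affine_extension t : X :=
  if m (t, 1) <= c2 / 2 then
    if [pick j | coordmod t j <= m (t, 1)] is Some j then r j (slide t) else collar_map (t, 1)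
  else collar_map (t, 1).

(** Here [time] has reached [a], where [k j] has become [r j]. This matches the two formulas of
    [affine_extension] along [m = c2 / 2]. *)
Lemma collar_map_end t j : coordmod t j <= m (t, 1) -> m (t, 1) <= c2 / 2 ->
  collar_map (t, 1) = r j (std_to_affine (shrink (t, 1))).
Proof.
move=> h mc; rewrite (@collar_map_face _ j)// ka//; first exact: shrink_eq0.
rewrite /time /= minxx; set w := Num.max _ _.
have w1 : 1 <= w.
  rewrite /w le_max; apply/orP; right; rewrite mulr1 lerBrDr -lerBrDl.
  rewrite ler_pdivrMr ?divr_gt0//.
  by rewrite (_ : 2 - 1 = 1) ?mul1r//; ring.
by rewrite (min_idPl w1) mulr1.
Qed.

Lemma affine_extension_face t j : coordmod t j <= m (t, 1) -> m (t, 1) <= c2 / 2 ->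
  affine_extension t = r j (slide t).
Proof.
move=> h mc; rewrite /affine_extension mc; case: pickP => [i hi|/(_ j)]; last by rewrite h.
by apply: rr; exact: slide_eq0.
Qed.

Lemma affine_extension_inner t : c2 / 2 <= m (t, 1) -> affine_extension t = collar_map (t, 1).
Proof.
move=> h; rewrite /affine_extension; case: ifP => // mc; case: pickP => // j hj.
by rewrite (collar_map_end hj mc) slide_inner.
Qed.

Lemma affine_extension_continuous : continuous affine_extension.
Proof.
pose D (o : option 'I_N.+1) : set AA :=
  if o is Some j then [set t | coordmod t j <= m (t, 1)] `&` [set t | m (t, 1) <= c2 / 2]
  else [set t | c2 / 2 <= m (t, 1)].
pose f (o : option 'I_N.+1) (t : AA) :=
  if o is Some j then r j (slide t) else collar_map (t, 1).
apply: (@pasting _ _ _ D f) => [[j|]|[j|]|t|[j|] t] /=.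
- apply: closedI.
    have -> : [set t | coordmod t j <= m (t, 1)] =
      (fun t => m (t, 1) - coordmod t j) @^-1` [set r | 0 <= r].
      by apply/seteqP; split=> q /=; rewrite subr_ge0.
    apply: closed_comp => [q _|]; last exact: closed_ge.
    by apply: (@continuous_sub R AA); [exact: m1c|exact: coordmod_continuous].
  apply: (@closed_comp _ _ (fun t => m (t, 1)) [set r | r <= c2 / 2]) => [t _|]; [exact: m1c|exact: closed_le].
- by apply: (@closed_comp _ _ (fun t => m (t, 1)) [set r | c2 / 2 <= r]) => [t _|]; [exact: m1c|exact: closed_ge].
- by move=> t; apply: (@continuous_comp _ _ _ slide (r j)); [exact: slide_continuous|exact: rc].
- by move=> t; apply: (@continuous_comp _ _ _ (fun t : AA => (t, 1 : R)) collar_map);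
    [exact: pair1c|exact: collar_map_continuous].
- have [h|h] := leP (c2 / 2) (m (t, 1)); first by exists None.
  have [e|[j e]] := bigmin_attained (c2 * Num.min 1 1) (fun i => coordmod t i).
    have : c2 < c2 / 2 by rewrite -[X in X < _]mulr1 -[X in _ * X](minxx (1 : R)) -e.
    by rewrite ltr_pdivlMr// gtr_pMr// ltrn1.
  by exists (Some j); split; [rewrite /= /m /= e|exact: ltW].
- by case; exact: affine_extension_face.
- exact: affine_extension_inner.
Qed.

Lemma affine_extension_boundary t j : set_val t 0 j = 0 -> affine_extension t = r j t.
Proof.
move=> tj; have m0 := shrink_amount0 ler01 tj.
rewrite (@affine_extension_face _ j) ?m0 ?coordmod_eq0 ?divr_ge0 ?(ltW c2_gt0)//.
by rewrite (slide_face tj).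
Qed.

Lemma affine_extension_std (t : TT) :
  affine_extension (std_to_affine t) = collar_map (std_to_affine t, 1).
Proof.
rewrite /affine_extension; case: ifP => // mc; case: pickP => // j hj.
by rewrite (collar_map_end hj mc) slide_std.
Qed.

End Core.

(** * Holomorphy on the coordinate hyperplanes *)

(* The step is G + (F - G) \o proj i: this is F on Z i, where proj i is the identity,
   and on Z j it is still F because proj i preserves Z j. *)
Lemma germ_extension (K : numFieldType) (V W : normedModType K) (I : eqType) (l : seq I)
    (Z : I -> set V) (proj : I -> V -> V) (F : V -> W) (p : V) :
  (forall i s, differentiable (proj i) s) ->
  (forall i, i \in l -> proj i p = p) ->
  (forall i s, Z i s -> proj i s = s) ->
  (forall i j s, i \in l -> j \in l -> Z j s -> Z j (proj i s)) ->
  (forall i, i \in l -> \forall s \near p, differentiable (F \o proj i) s) ->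
  exists G : V -> W, (\forall s \near p, differentiable G s) /\
    forall i s, i \in l -> Z i s -> G s = F s.
Proof.
move=> pd pp pZ pZZ; elim: l pp pZZ => [|i l IH] pp pZZ Fd.
  by exists (cst 0); split=> //; apply: nearW => s; exact: differentiable_cst.
have [j jl|i' j s il jl|j jl|G [Gd GF]] := IH.
- by apply: pp; rewrite inE jl orbT.
- by apply: pZZ; rewrite inE ?il ?jl orbT.
- by apply: Fd; rewrite inE jl orbT.
have il : i \in i :: l by rewrite inE eqxx.
have pc : {for p, continuous (proj i)} by apply: differentiable_continuous.
have Gd' : \forall s \near p, differentiable G (proj i s).
  by apply: (pc [set s | differentiable G s]); rewrite /= (pp i il).
exists (fun s => G s + F (proj i s) - G (proj i s)); split.
  near=> s.
  have h1 : differentiable G s by near: s.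
  have h2 : differentiable (F \o proj i) s by near: s; exact: Fd.
  have h3 : differentiable (G \o proj i) s.
    by apply: differentiable_comp => //; near: s.
  exact: (differentiableB (differentiableD h1 h2) h3).
move=> j s; rewrite inE => /orP[/eqP ->|jl] Zs.
  by rewrite (pZ _ _ Zs) addrAC subrr add0r.
have jl' : j \in i :: l by rewrite inE jl orbT.
by rewrite (GF j s jl Zs) (GF j (proj i s) jl (pZZ i j s il jl' Zs)) addrK.
Unshelve. all: by end_near. Qed.

Lemma near_comp (T U : topologicalType) (f : T -> U) (p : T) (P : set U) :
  {for p, continuous f} -> nbhs (f p) P -> nbhs p [set t | P (f t)].
Proof. by move=> fc; exact: fc. Qed.

(** * Stein property of affine simplices, and facewise holomorphic maps *)

Section AffineSimplex.
Variables (R : realType) (n : nat).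
Local Notation C := (Cplx R).
Local Notation AA := (affine_simplex R n).
Local Notation AM := (affine_simplex_manifold R n).
Local Notation "x %:C" := (real_complex R x : C) (format "x %:C").

Lemma affine_coord_differentiable (j : 'I_n.+1) (s : 'rV[C]_n) :
  differentiable (fun s : 'rV[C]_n => affine_lift s 0 j : C) s.
Proof.
have -> : (fun s : 'rV[C]_n => affine_lift s 0 j : C) =
  (fun s : 'rV[C]_n.+1 => s 0 j : C) \o (cst (delta_mx 0 0) + @affine_lift0 R n).
  by apply/funext => u; rewrite /= affine_liftE.
apply: differentiable_comp; last exact: coord_differentiable.
apply: differentiableD; first exact: differentiable_cst.
by apply: linear_differentiable; exact: linear_rV_continuous.
Qed.

Lemma coord_holomorphic (j : 'I_n.+1) :
  holomorphic_fun_on setT (fun t : AM => set_val (t : AA) 0 j : C).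
Proof. by move=> t _ c _; exact: affine_coord_differentiable. Qed.

Definition coord_hyperplanes : set AM := [set t | exists j, set_val (t : AA) 0 j = 0].

Lemma prod_differentiable (V : normedModType C) (I : Type) (l : seq I) (f : I -> V -> C) (s : V) :
  (forall i, differentiable (f i) s) -> differentiable (fun s => \prod_(i <- l) f i s : C) s.
Proof.
move=> fd; elim: l => [|i l IH].
  by under eq_fun do rewrite big_nil; exact: differentiable_cst.
under eq_fun do rewrite big_cons.
exact: (differentiableM (fd i) IH).
Qed.

Lemma coord_hyperplanes_analytic : analytic_subvariety coord_hyperplanes.
Proof.
move=> p; exists setT, 1%N, (fun _ t => \prod_(j < n.+1) (set_val (t : AA) 0 j : C)).
split=> //; first exact: openT.
  move=> _ t _ c _; apply: (@prod_differentiable _ _ _ (fun j s => affine_lift s 0 j)) => j.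
  exact: affine_coord_differentiable.
move=> t _; split=> [[j tj] _|/(_ ord0)/eqP]; first by rewrite (bigD1 j)//= tj mul0r.
by rewrite prodf_seq_eq0 => /hasP[j _ /= /eqP tj]; exists j.
Qed.

Lemma holomorphic_fun_continuous (f : AM -> C) :
  holomorphic_fun_on setT f -> continuous (f : AA -> C).
Proof.
move=> fh t; have -> : f = (f \o @affine_chart_inv R n) \o @affine_chart R n.
  by apply/funext => u; rewrite /= affine_chartK.
apply: (@continuous_comp AA _ C (@affine_chart R n)); first exact: affine_chart_continuous.
exact: differentiable_continuous (fh t I tt I).
Qed.

(** The order of [C] is partial: the set is empty unless [b] is a nonnegative real number, and then
    it is a disc. *)
Lemma closed_norm_le (b : C) : closed [set z : C | `|z| <= b].
Proof.
have [b0|b0] := boolP (0 <= b); last first.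
  have -> : [set z : C | `|z| <= b] = set0; last exact: closed0.
  by apply/seteqP; split=> // z /=; move/(le_trans (normr_ge0 z)) => h; rewrite h in b0.
have bE : b = (complex.Re b)%:C by case: b b0 => x y; rewrite lecE /= => /andP[/eqP-> _].
have -> : [set z : C | `|z| <= b] = @cmod R @^-1` [set x | x <= complex.Re b].
  by apply/seteqP; split=> z /=; rewrite bE cmodE lecR.
by apply: closed_comp => [z _|]; [exact: cmod_continuous|exact: closed_le].
Qed.

(** Coordinate functions suffice: they separate points, and they confine the hull of a compact set,
    which is closed, to a compact box. *)
Lemma affine_simplex_stein : stein AM.
Proof.
split; last first.
  move=> t u tu; have [j tj] : exists j, set_val (t : AA) 0 j <> set_val (u : AA) 0 j.
    apply: contrapT => h; apply: tu; apply: val_inj; apply/rowP => j.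
    by apply: contrapT => tj; apply: h; exists j.
  by exists (fun t : AM => set_val (t : AA) 0 j) => //; exact: coord_holomorphic.
move=> K Kc.
have hcl : closed (holomorphic_hull K).
  have -> : holomorphic_hull K =
    \bigcap_(q in [set q : (AM -> C) * C | holomorphic_fun_on setT q.1 /\
        forall y, K y -> `|q.1 y| <= q.2])
      (q.1 @^-1` [set z : C | `|z| <= q.2]).
    apply/seteqP; split=> [t Kt [f b] [/= fh fb]|t Kt f fh b fb]; first exact: Kt.
    exact: (Kt (f, b)).
  apply: closed_bigI => -[f b] [/= fh _].
  apply: closed_comp => [t _|]; last exact: closed_norm_le.
  exact: holomorphic_fun_continuous.
have [b bP] : exists b : R, forall t, K t -> forall j, `|set_val (t : AA) 0 j : C| <= b%:C.
  have bj (j : 'I_n.+1) : exists b : R, forall t, K t -> `|set_val (t : AA) 0 j : C| <= b%:C.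
    have [K0|/set0P K0] := eqVneq K set0; first by exists 0 => t; rewrite K0.
    have cc : continuous (fun t : AA => cmod (set_val t 0 j : C)).
      move=> t; apply: (@continuous_comp AA C R (fun t : AA => set_val t 0 j : C) (@cmod R)).
        exact: (holomorphic_fun_continuous (@coord_holomorphic j)).
      exact: cmod_continuous.
    have [|u _ umax] := @compact_EVT_max AA R (fun t : AA => cmod (set_val t 0 j : C)) K K0 Kc.
      exact: continuous_subspaceT.
    exists (cmod (set_val u 0 j : C)) => t Kt; rewrite cmodE lecR.
    by apply: umax; apply/mem_set.
  have [b bP] := choice bj.
  exists (\big[Num.max/0]_j b j) => t Kt j; apply: le_trans (bP j t Kt) _.
  by rewrite lecR; apply: le_bigmax.
pose B : set 'rV[C]_n := [set s : 'rV[C]_n | forall i, closed_square b (s 0 i)].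
have box : compact B.
  by apply: (@rV_compact C n (fun=> closed_square b)) => i; exact: closed_square_compact.
have boxc : compact (@affine_chart_inv R n @` B).
  apply: continuous_compact => //; apply: continuous_subspaceT.
  exact: affine_chart_inv_continuous.
refine (@subclosed_compact AA _ _ hcl boxc _) => t Kt.
 exists (affine_chart t); last exact: affine_chartK.
move=> i /=; rewrite mxE.
have := Kt _ (@coord_holomorphic (lift ord0 i)) b%:C (fun t Kt' => bP t Kt' _).
rewrite cmodE lecR => h; split; apply: le_trans h; [exact: Re_le_cmod|exact: Im_le_cmod].
Qed.

Variable X : complexManifold R.

(** For [i <> k], the projection onto the i-th coordinate hyperplane that adds the i-th coordinate
    to the k-th one. *)
Definition push_coord (k i : 'I_n.+1) (s : 'rV[C]_n.+1) : 'rV[C]_n.+1 :=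
  s + s 0 i *: (delta_mx 0 k - delta_mx 0 i).

Lemma push_coord_subproof (k i : 'I_n.+1) (t : AA) :
  push_coord k i (set_val t) \in @affine_simplex_set R n.
Proof.
apply/mem_set; rewrite /affine_simplex_set /=.
under eq_bigr do rewrite mxE [X in _ + X]mxE [X in _ * X]mxE [X in _ * (_ + X)]mxE.
have sum_delta (j : 'I_n.+1) : \sum_i (delta_mx 0 j : 'rV[C]_n.+1) 0 i = 1.
  rewrite (bigD1 j)//= mxE !eqxx big1 ?addr0// => l /negbTE lj.
  by rewrite mxE lj andbF.
by rewrite big_split /= -mulr_sumr big_split /= sumrN !sum_delta subrr mulr0 addr0 (set_valP t).
Qed.
Definition affine_push (k i : 'I_n.+1) (t : AA) : AA :=
  exist (fun u => u \in @affine_simplex_set R n) _ (push_coord_subproof k i t).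

Lemma affine_push_val k i (t : AA) j : set_val (affine_push k i t) 0 j =
  set_val t 0 j + set_val t 0 i * ((j == k)%:R - (j == i)%:R).
Proof. by rewrite set_valE /= !mxE. Qed.

Lemma affine_push_id k i (t : AA) : set_val t 0 i = 0 -> affine_push k i t = t.
Proof.
move=> ti; apply: val_inj; apply/rowP => j.
by rewrite -[LHS]/(set_val (affine_push k i t) 0 j) affine_push_val ti mul0r addr0.
Qed.

Lemma chart_push_differentiable_coord k i (s : 'rV[C]_n) :
  differentiable (@affine_chart R n \o affine_push k i \o @affine_chart_inv R n) s.
Proof.
pose v : 'rV[C]_n := \row_l ((lift ord0 l == k)%:R - (lift ord0 l == i)%:R).
have -> : @affine_chart R n \o affine_push k i \o @affine_chart_inv R n =
   id + (fun s : 'rV[C]_n => affine_lift s 0 i *: v).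
  apply/funext => u; apply/rowP => l; rewrite /= mxE affine_push_val [RHS]mxE [X in _ = _ + X]mxE.
  by rewrite [v 0 l]mxE; congr (_ + _); rewrite set_valE /= mxE liftK.
apply: differentiableD; first by [].
apply: differentiableZl; exact: affine_coord_differentiable.
Qed.

(** In a chart at [E p] the map is vector-valued, and [germ_extension] applies to the hyperplanes
    through [p]. Coordinates are pushed onto some [k] with nonzero k-th coordinate at [p], so each
    projection preserves the other hyperplanes through [p]. *)
Lemma facewise_holomorphic (E : AM -> X) (r : 'I_n.+1 -> holoMap AM X) :
  continuous (E : AA -> X) ->
  (forall (t : AA) j, set_val t 0 j = 0 -> E t = r j t) ->
  holomorphic_on_subvariety coord_hyperplanes E.
Proof.
move=> Ec Er p [j0 pj0].
have [c cE] := mcover (E p).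
have [k pk] : exists k, set_val (p : AA) 0 k <> 0.
  apply: contrapT => h.
  have := set_valP (p : AA); rewrite /affine_simplex_set /= big1 => [/eqP|i _].
    by rewrite eq_sym oner_eq0.
  by apply: contrapT => pi; apply: h; exists i.
pose l := [seq i <- index_enum 'I_n.+1 | set_val (p : AA) 0 i == 0].
have lP i : (i \in l) = (set_val (p : AA) 0 i == 0).
  by rewrite mem_filter mem_index_enum andbT.
have lk i : i \in l -> i != k.
  by rewrite lP => /eqP pi; apply/eqP => ik; rewrite ik in pi.
pose Z i : set 'rV[C]_n := [set s | affine_lift s 0 i = 0].
pose proj i := @affine_chart R n \o affine_push k i \o @affine_chart_inv R n.
pose F (s : 'rV[C]_n) : 'rV[C]_(mdim c) := mmap c (E (affine_chart_inv s)).
have liftE (s : 'rV[C]_n) i : affine_lift s 0 i = set_val (affine_chart_inv s) 0 i by [].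
have projK i s : affine_chart_inv (proj i s) = affine_push k i (affine_chart_inv s).
  by rewrite /proj /= affine_chartK.
have projZ i j s : i \in l -> j \in l -> Z j s -> Z j (proj i s).
  rewrite /Z /= !liftE projK affine_push_val => _ /lk jk Zj.
  rewrite Zj add0r (negbTE jk) sub0r.
  by have [ji|_] := eqVneq j i; rewrite ?oppr0 ?mulr0// -ji Zj mul0r.
have [||||i il|G [Gd GF]] :=
  @germ_extension C 'rV[C]_n 'rV[C]_(mdim c) 'I_n.+1 l Z proj F (affine_chart p).
- by move=> i s; exact: chart_push_differentiable_coord.
- by move=> i; rewrite lP => /eqP pi; rewrite /proj /= affine_chartK affine_push_id.
- by move=> i s Zs; rewrite /proj /= affine_push_id ?affine_chart_invK.
- exact: projZ.
- have FE : F \o proj i = (mmap c \o r i \o @affine_chart_inv R n) \o proj i.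
    apply/funext => s; rewrite /F /= -/(proj i s) projK (Er _ i)//.
    by rewrite affine_push_val eqxx (negbTE (lk i il)) sub0r mulrN1 subrr.
  have pi0 : set_val (p : AA) 0 i = 0 by apply/eqP; rewrite -lP.
  have projp : proj i (affine_chart p) = affine_chart p.
    by rewrite /proj /= affine_chartK affine_push_id.
  have cr : \forall s \near affine_chart p, mdom c (r i (affine_chart_inv (proj i s))).
    have cont : {for affine_chart p, continuous (r i \o @affine_chart_inv R n \o proj i)}.
      apply: continuous_comp; first exact/differentiable_continuous/chart_push_differentiable_coord.
      apply: continuous_comp; first exact: affine_chart_inv_continuous.
      by have [] := @holo_funP _ _ _ (r i) (affine_chart_inv (proj i (affine_chart p))) I.
    apply: cont; apply: open_nbhs_nbhs; split; first exact: mdom_open.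
    by rewrite /= -/(proj i _) projp affine_chartK -Er.
  apply: filterS cr => s cs; rewrite FE; apply: differentiable_comp.
    exact: chart_push_differentiable_coord.
  have [_ rd] := @holo_funP _ _ _ (r i) (affine_chart_inv (proj i s)) I.
  by have := rd tt c I cs; rewrite /= affine_chart_invK.
(* The last condition avoids the hyperplanes that miss [p], on which [G] is not controlled. *)
pose good (t : AA) : Prop := [/\ differentiable G (affine_chart t),
  (mmap c @` mdom c) (G (affine_chart t)), mdom c (E t) &
  forall i, set_val (p : AA) 0 i <> 0 -> set_val t 0 i <> 0].
exists (interior (good : set AA)), (fun t => minv c (G (affine_chart (t : AA)))).
have j0l : j0 \in l by rewrite lP; apply/eqP.
split.
- exact: open_interior.
- have Gp : {for affine_chart p, continuous G}.
    by apply: differentiable_continuous; exact: nbhs_singleton Gd.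
  have cp := @affine_chart_continuous R n p.
  have GE : G (affine_chart p) = mmap c (E p).
    by rewrite (GF j0) ?/F ?affine_chartK// /Z /= liftE affine_chartK.
  have h1 := @near_comp AA _ _ p [set s | differentiable G s] cp Gd.
  have h2 : nbhs (p : AA) [set t : AA | (mmap c @` mdom c) (G (affine_chart t))].
    apply: (@near_comp AA _ _ p [set s | (mmap c @` mdom c) (G s)] cp).
    apply: (@near_comp _ _ G _ (mmap c @` mdom c) Gp).
    apply: open_nbhs_nbhs; split; first exact: mrange_open.
    by exists (E p).
  have h3 : nbhs (p : AA) [set t : AA | mdom c (E t)].
    apply: (@near_comp AA _ E p (mdom c) (Ec p)).
    by apply: open_nbhs_nbhs; split; first exact: mdom_open.
  have h4 : nbhs (p : AA) [set t : AA | forall i, set_val (p : AA) 0 i <> 0 -> set_val t 0 i <> 0].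
    refine (@filter_forall AA 'I_n.+1
      (fun i (t : AA) => set_val (p : AA) 0 i <> 0 -> set_val t 0 i <> 0)
      (nbhs (p : AA)) (nbhs_filter _) _) => i.
    have [pi|pi] := eqVneq (set_val (p : AA) 0 i) 0.
      refine (@filterE AA (nbhs (p : AA)) (nbhs_filter _) _ _) => t nz.
      by case: (nz pi).
    have ci := holomorphic_fun_continuous (@coord_holomorphic i).
    have C0 : open (~` [set 0 : C]).
      apply: closed_openC; apply: accessible_closed_set1; apply: hausdorff_accessible.
      exact: norm_hausdorff.
    have := @near_comp AA _ _ p (~` [set 0 : C]) (ci p).
    move=> /(_ (open_nbhs_nbhs (conj C0 (elimN eqP pi)))).
    by apply: (@filterS AA (nbhs (p : AA)) (nbhs_filter _)).
  have h1234 := @filterI AA (nbhs (p : AA)) (nbhs_filter _) _ _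
    (@filterI AA (nbhs (p : AA)) (nbhs_filter _) _ _ h1 h2)
    (@filterI AA (nbhs (p : AA)) (nbhs_filter _) _ _ h3 h4).
  refine (@filterS AA (nbhs (p : AA)) (nbhs_filter _) _ _ _ h1234).
  by move=> t [[? ?] [? ?]].
- move=> t /interior_subset [Gt [x cx GE] _ _]; split.
    apply: (@continuous_comp AA 'rV[C]_n X (@affine_chart R n) (minv c \o G)).
      exact: affine_chart_continuous.
    apply: continuous_comp; first exact: differentiable_continuous.
    by rewrite -GE; exact: minv_continuous.
  move=> c0 c' _ gc'.
  have -> : mmap c' \o (fun t => minv c (G (affine_chart (t : AA)))) \o @minv _ AM c0 =
     (mmap c' \o minv c) \o G.
    by apply/funext => s; rewrite /= affine_chart_invK.
  apply: differentiable_comp; first exact: Gt.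
  rewrite -GE; apply: mtransition => //.
  by move: gc'; rewrite -GE mmapK.
- move=> t /interior_subset [_ _ cEt tne] [j tj].
  have jl : j \in l by rewrite lP; apply/eqP; apply: contrapT => pj; exact: (tne j pj).
  rewrite (GF j) ?/F ?affine_chartK//; first exact: mmapK.
  by rewrite /Z /= liftE affine_chartK.
Qed.

End AffineSimplex.

(** * Homotopies ending at holomorphic maps *)

Lemma clamp01_le0 (R : realType) (s : R) : s <= 0 -> clamp01 s = 0.
Proof.
move=> s0; rewrite /clamp01; apply/max_idPl.
by apply: le_trans s0; rewrite ge_min lexx orbT.
Qed.

Lemma clamp01_ge1 (R : realType) (s : R) : 1 <= s -> clamp01 s = 1.
Proof. by move=> s1; rewrite /clamp01 (min_idPl s1); apply/max_idPr. Qed.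

Section Filling.
Variables (R : realType) (X : complexManifold R).
Local Notation TT := (std_simplex R).
Local Notation AA := (affine_simplex R).

(** Until time [a] the collar map leads from [y] to the extension [E]; from [a] to [b] the Oka
    property deforms [E]. The second deformation is fixed on the hyperplanes, where [k j] is
    stationary after [a], so the facet data are respected throughout. *)
Lemma oka_filling n (y : TT n.+1 -> X) (k : 'I_n.+2 -> TT n.+1 * R -> X)
    (r : 'I_n.+2 -> holoMap (affine_simplex_manifold R n.+1) X) (a b : R) :
  oka X -> 0 < a -> a < b ->
  continuous y -> (forall j, continuous (k j)) ->
  (forall i j (t : AA n.+1), set_val t 0 i = 0 -> set_val t 0 j = 0 -> r i t = r j t) ->
  (forall i j (t : TT n.+1) s, set_val t 0 i = 0 -> set_val t 0 j = 0 -> k i (t, s) = k j (t, s)) ->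
  (forall j (t : TT n.+1) s, set_val t 0 j = 0 -> s <= 0 -> k j (t, s) = y t) ->
  (forall j (t : TT n.+1) s, set_val t 0 j = 0 -> a <= s -> k j (t, s) = r j (std_to_affine t)) ->
  exists (K : TT n.+1 * R -> X) (g : holoMap (affine_simplex_manifold R n.+1) X),
    [/\ continuous K,
        forall j (t : TT n.+1) s, set_val t 0 j = 0 -> K (t, s) = k j (t, s),
        forall j (t : AA n.+1), set_val t 0 j = 0 -> g t = r j t,
        forall (t : TT n.+1) s, s <= 0 -> K (t, s) = y t &
        forall (t : TT n.+1) s, b <= s -> K (t, s) = g (std_to_affine t)].
Proof.
move=> hX a0 ab yc kc rr kk k0 ka.
have b0 : 0 < b - a by rewrite subr_gt0.
pose E := affine_extension y k r a.
have Ec : continuous E by exact: affine_extension_continuous.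
have Er (t : AA n.+1) j : set_val t 0 j = 0 -> E t = r j t by exact: affine_extension_boundary.
have [G [Gc G0 Gh GT]] := hX _ _ (affine_simplex_stein R n.+1) (@coord_hyperplanes_analytic R n.+1)
  (E : affine_simplex_manifold R n.+1 -> X) Ec (facewise_holomorphic Ec Er).
pose c (p : TT n.+1 * R) := collar_map y k a (std_to_affine p.1, clamp01 (p.2 / a)).
pose e (p : TT n.+1 * R) := G (std_to_affine p.1, clamp01 ((p.2 - a) / (b - a))).
pose K p := if p.2 <= a then c p else e p.
have cE (t : TT n.+1) s : a <= s -> c (t, s) = E (std_to_affine t).
  move=> as_; rewrite /c /= clamp01_ge1 ?ler_pdivlMr ?mul1r//.
  by rewrite /E affine_extension_std.
have eE (t : TT n.+1) s : s <= a -> e (t, s) = E (std_to_affine t).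
  move=> sa; rewrite /e /= clamp01_le0 ?G0//.
  by rewrite pmulr_lle0 ?invr_gt0// subr_le0.
have stc : continuous (fun p : TT n.+1 * R => std_to_affine p.1 : AA n.+1).
  move=> p; apply: (@continuous_comp _ _ _ fst (@std_to_affine R n.+1)).
    exact: cvg_fst.
  exact: std_to_affine_continuous.
have sc : continuous (fun p : TT n.+1 * R => p.2 : R) by move=> p; exact: cvg_snd.
have cc : continuous c.
  have pc : continuous (fun p : TT n.+1 * R => (std_to_affine p.1 : AA n.+1, clamp01 (p.2 / a))).
    apply: continuous_pair => // p.
    apply: (@continuous_comp _ _ _ (fun p : TT n.+1 * R => p.2 / a)).
      by apply: continuous_mul; [exact: sc|exact: cst_continuous].
    exact: clamp01_continuous.
  move=> p; apply: (@continuous_comp _ _ _ _ (collar_map y k a)); first exact: pc.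
  exact: collar_map_continuous.
have ec : continuous e.
  apply: (@within_continuous_clamp R (AA n.+1) _ X G) => //.
  apply: continuous_mul; last exact: cst_continuous.
  by apply: continuous_sub; [exact: sc|exact: cst_continuous].
exists K, (HoloMap Gh); split.
- apply: (@pasting _ _ bool (fun q =>
      if q then [set p : TT n.+1 * R | p.2 <= a] else [set p : TT n.+1 * R | a <= p.2])
    (fun q => if q then c else e)) => [[]|[]|p|[] [t s] /=].
  + by apply: (@closed_comp _ _ snd [set s | s <= a]); [move=> p _; exact: sc|exact: closed_le].
  + by apply: (@closed_comp _ _ snd [set s | a <= s]); [move=> p _; exact: sc|exact: closed_ge].
  + exact: cc.
  + exact: ec.
  + by have [pa|/ltW pa] := leP p.2 a; [exists true|exists false].
  + by rewrite /K /= => ->.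
  + by rewrite /K /= => as_; case: ifP => // sa; rewrite cE// eE.
- move=> j t s tj; rewrite /K /=; case: ifP => sa; last first.
    rewrite /e /= GT.
    + rewrite (Er _ j) ?std_to_affine_val ?tj// ka// ltW//.
      by rewrite ltNge sa.
    + by exists j; rewrite std_to_affine_val tj.
    + by rewrite /= in_itv /= clamp01_itv.
  rewrite /c /= (collar_map_boundary _ _ kk (clamp01_itv _) tj).
  have [s0|/ltW s0] := leP 0 s.
    have -> : clamp01 (s / a) = s / a.
      apply: clamp01_id; rewrite ler_pdivrMr// mul1r sa andbT.
      by rewrite pmulr_lge0 ?invr_gt0.
    by rewrite mulrC divfK// gt_eqF.
  have -> : clamp01 (s / a) = 0.
    by apply: clamp01_le0; rewrite pmulr_lle0 ?invr_gt0.
  by rewrite mulr0 (k0 j t 0 tj (lexx 0)) (k0 j t s tj s0).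
- move=> j t tj /=; rewrite GT ?(Er _ j)//; first by exists j.
  by rewrite /= in_itv /= ler01 lexx.
- move=> t s s0; rewrite /K /= (le_trans s0 (ltW a0)) /c /= clamp01_le0 ?collar_map_start//.
  by rewrite pmulr_lle0 ?invr_gt0.
- move=> t s bs; rewrite /K /= leNgt (lt_le_trans ab bs) /= /e /= clamp01_ge1//.
  by rewrite ler_pdivlMr// mul1r lerB.
Qed.

End Filling.

(** * The simplicial set of staged homotopies *)

Section StagedHomotopies.
Variables (R : realType) (X : complexManifold R).
Local Notation TT := (std_simplex R).
Local Notation AA := (affine_simplex R).

(** Strictly increasing and below 1: every dimension gets a time slot of its own, and all of them
    are over at time 1. *)
Definition stage (j : nat) : R := 1 - j.+1%:R^-1.

Lemma stage_lt i j : (i < j)%N -> stage i < stage j.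
Proof. by move=> ij; rewrite /stage ltrD2l ltrN2 ltf_pV2 ?posrE// ltr_nat. Qed.

Lemma stage_le i j : (i <= j)%N -> stage i <= stage j.
Proof. by rewrite leq_eqVlt => /predU1P[->|/stage_lt/ltW]. Qed.

Lemma stage_lt1 j : stage j < 1.
Proof. by rewrite /stage ltrBlDr ltrDl invr_gt0. Qed.

Lemma stage_gt0 j : 0 < stage j.+1.
Proof. by rewrite /stage subr_gt0 invf_lt1// ltr1n. Qed.

Definition supp_card m (t : TT m) : nat := #|[pred i | set_val t 0 i != 0]|.

Lemma supp_card_push m n (th : delta m n) (t : TT m) :
  (supp_card (std_simplex_push th t) <= supp_card t)%N.
Proof.
apply: leq_trans (leq_image_card th _); apply: subset_leq_card.
apply/fintype.subsetP => i si.
have ti : \sum_(j | th j == i) set_val t 0 j != 0.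
  by move: si; rewrite inE set_valE /= mxE.
have [j /andP[/eqP thj tj]|h] := pickP (fun j => (th j == i) && (set_val t 0 j != 0)).
  by rewrite -thj; apply: fintype.image_f; rewrite inE.
case/eqP: ti; apply: big1 => j thj; apply/eqP.
by move: (h j); rewrite thj /= => /negbFE.
Qed.

Lemma supp_card_face m (t : TT m) j : set_val t 0 j = 0 -> (supp_card t <= m)%N.
Proof.
move=> tj; rewrite -ltnS -[X in (_ < X)%N]card_ord -cardsT.
apply: proper_card; apply/properP; split.
  by apply/fintype.subsetP => i; rewrite !inE.
by exists j; rewrite !inE ?tj ?eqxx.
Qed.

Lemma supp_card_full m (t : TT m) : (forall j, set_val t 0 j <> 0) -> supp_card t = m.+1.
Proof.
move=> h; rewrite -[RHS]card_ord; apply: eq_card => i; rewrite !inE; exact/eqP.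
Qed.

(* Over the interior of a face with d vertices the homotopy has to reach the
   holomorphic map by the time [stage d].  Boundary data over an n-simplex are then
   holomorphic from [stage n] on, and the interval from [stage n] to [stage n.+1] is
   free for the homotopy given by the Oka property. *)
Definition is_staged m (w : (TT m * R -> X) * holoMap (affine_simplex_manifold R m) X) : Prop :=
  [/\ continuous w.1,
      forall t s, s <= 0 -> w.1 (t, s) = w.1 (t, 0) &
      forall t s, stage (supp_card t) <= s -> w.1 (t, s) = w.2 (std_to_affine t)].

Lemma staged_act m n (th : delta m n) w : is_staged w ->
  @is_staged m (fun p => w.1 (std_simplex_push th p.1, p.2),
                @sact (affine_singular_set X) m n th w.2).
Proof.
move=> [wc w0 w1]; split=> /= [|t s s0|t s st]; first 1 last.
- exact: w0.
- rewrite w1 ?std_to_affine_push//; apply: le_trans st; apply: stage_le.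
  exact: supp_card_push.
have pc : continuous (fun p : TT m * R => (std_simplex_push th p.1 : TT n, p.2 : R)).
  apply: continuous_pair => [p|p]; last exact: cvg_snd.
  apply: (@continuous_comp _ _ _ fst (@std_simplex_push R m n th)); first exact: cvg_fst.
  exact: std_simplex_push_continuous.
by move=> p; apply: (@continuous_comp _ _ _ _ w.1); [exact: pc|exact: wc].
Qed.

Program Definition staged_homotopies : simplicialSet :=
  @SimplicialSet (fun m => {w | @is_staged m w})
    (fun m n th w => exist _ _ (staged_act th (proj2_sig w))) _ _.
Next Obligation.
move=> n [[k r] kr]; apply: eq_exist; rewrite (sact_id (r : affine_singular_set X n)).
congr pair; apply/funext => -[t s] /=; congr (k (_, s)).
by apply: val_inj; exact: simplex_push_id.
Qed.
Next Obligation.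
move=> l m n g f [[k r] kr]; apply: eq_exist; rewrite (sact_comp g f (r : affine_singular_set X n)).
congr pair; apply/funext => -[t s] /=; congr (k (_, s)).
by apply: val_inj; exact: simplex_push_comp.
Qed.

Local Notation W := staged_homotopies.
Local Notation stage_map w := ((proj1_sig w).1).
Local Notation stage_end w := ((proj1_sig w).2).

Lemma staged_slice_continuous m (w : W m) (s : TT m -> R) : continuous s ->
  continuous (fun t : TT m => stage_map w (t, s t)).
Proof.
move=> sc; have [wc _ _] := proj2_sig w.
have pc : continuous (fun t : TT m => (t, s t)) by apply: continuous_pair => // t; exact: cvg_id.
by move=> t; apply: (@continuous_comp _ _ _ _ (stage_map w)); [exact: pc|exact: wc].
Qed.

Lemma zero_continuous m : continuous (fun _ : TT m => 0 : R).
Proof. exact: cst_continuous. Qed.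

Program Definition staged_start : simplicialMap W (singular_set R X) :=
  @SimplicialMap W (singular_set R X)
    (fun m w => mkcts (@staged_slice_continuous m w _ (@zero_continuous m))) _.
Next Obligation. by move=> m n th w; apply/continuousEP. Qed.

Program Definition staged_finish : simplicialMap W (affine_singular_set X) :=
  @SimplicialMap W (affine_singular_set X) (fun m w => stage_end w) _.
Next Obligation. by []. Qed.

Lemma constant_staged m (x : holoMap (affine_simplex_manifold R m) X) :
  is_staged (fun p => x (std_to_affine p.1), x).
Proof.
split=> //=.
move=> p; apply: (@continuous_comp _ _ _ fst (fun t : TT m => x (std_to_affine t))).
  exact: cvg_fst.
exact: affine_restrict_continuous.
Qed.

Lemma std_simplex0_eq (t u : TT 0) : t = u.
Proof.
apply: val_inj; apply/rowP => i; rewrite (ord1 i).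
have [t1 _] := set_valP t; have [u1 _] := set_valP u.
by move: t1 u1; rewrite !big_ord1 => t1 u1; rewrite [LHS]t1 [RHS]u1.
Qed.

Lemma std_simplex0_point : TT 0.
Proof.
exists (const_mx 1); apply/mem_set; split; first by rewrite big_ord1 mxE.
by move=> i; rewrite mxE ler01.
Qed.

Lemma holomorphic_cst (M : complexManifold R) (p : X) : holomorphic (fun _ : M => p).
Proof.
move=> x _; split; first exact: cst_continuous.
move=> c c' _ _.
exact: (differentiable_cst (mmap c' p)).
Qed.

(** Provides a vertex for the collapse onto the face where two coordinates vanish. On an edge with
    [i <> j] there is no such point [t], and compatibility of the facet data is vacuous. *)
Lemma sum1_support (K : numFieldType) n (t : 'rV[K]_n.+1) i j :
  \sum_l t 0 l = 1 -> t 0 i = 0 -> t 0 j = 0 -> exists p0, (p0 != i) && (p0 != j).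
Proof.
move=> t1 ti tj; apply: contrapT => h; move: t1; rewrite big1.
  by move/esym/eqP; rewrite oner_eq0.
move=> l _; have [->//|li] := eqVneq l i; have [->//|lj] := eqVneq l j.
by case: h; exists l; rewrite li lj.
Qed.

(** The boundary data are determined by the facets [w j]. These agree where two hyperplanes meet,
    since a collapse onto the common face fixes such points. Then [oka_filling] works between the
    stages [n.+1] and [n.+2], the largest supports on the boundary and in the interior. *)
Lemma staged_lifting : oka X -> boundary_lifting staged_start.
Proof.
move=> hX [|n] y b bnat by_.
  (* [T_0] is a point without boundary: a homotopy constant in time and a constant holomorphic map
     will do. *)
  have wP : is_staged (fun p : TT 0 * R => y p.1,
      HoloMap (@holomorphic_cst (affine_simplex_manifold R 0) (y std_simplex0_point))).
    split=> //= [p|t s _]; last by rewrite (std_simplex0_eq t std_simplex0_point).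
    apply: (@continuous_comp _ _ _ fst (y : TT 0 -> X)); first exact: cvg_fst.
    exact: cts_fun.
  exists (exist _ _ wP); split; first by apply/continuousEP.
  by move=> m x [j xj]; case: (xj ord0); rewrite (ord1 j) (ord1 (x ord0)).
have facet_ex j : exists z : delta n.+1 n.+1, (forall i, z i <> j) /\ (forall i, i <> j -> z i = i).
  have [|z [z1 z2]] := @delta_retract n.+1 (fun i => i != j) (lift j ord0).
    by rewrite eq_sym neq_lift.
  by exists z; split=> i; [apply/eqP; exact: z1|move/eqP; exact: z2].
have [e eP] := choice facet_ex.
have eh j : in_boundary (e j) by exists j; have [] := eP j.
pose w j : W n.+1 := b _ (e j) (eh j).
have b_eq m (x x' : delta m n.+1) hx hx' : x = x' -> b m x hx = b m x' hx'.
  by move=> xx; subst x'; rewrite (Prop_irrelevance hx hx').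
have bE m (x : delta m n.+1) hx j : (forall i, x i <> j) -> b m x hx = sact x (w j).
  move=> xj; have hx' := in_boundary_sact x (eh j).
  rewrite -(bnat _ _ x (e j) (eh j) hx'); apply: b_eq; apply: delta_eqP => i /=.
  by have [_ ->] := eP j.
have meet i j p0 : (p0 != i) && (p0 != j) -> exists z : delta n.+1 n.+1,
    sact z (w i) = sact z (w j) /\ forall l, z l <> l -> l = i \/ l = j.
  move=> pij; have [|z [z1 z2]] := @delta_retract n.+1 (fun l => (l != i) && (l != j)) p0 => //.
  have zi l : z l <> i by apply/eqP; have /andP[] := z1 l.
  have zj l : z l <> j by apply/eqP; have /andP[] := z1 l.
  have zh : in_boundary z by exists i.
  exists z; split; first by rewrite -(bE _ _ zh)// -(bE _ _ zh).
  move=> l zl; have [|li] := eqVneq l i; first by left.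
  by have [|lj] := eqVneq l j; [right|case: zl; apply: z2; rewrite li lj].
pose k j := stage_map (w j); pose r j := stage_end (w j).
have rr i j (t : AA n.+1) : set_val t 0 i = 0 -> set_val t 0 j = 0 -> r i t = r j t.
  move=> ti tj; have [p0 /meet[z [zw zl]]] := sum1_support (set_valP t) ti tj.
  have tz : affine_simplex_push z t = t.
    by apply: val_inj; apply: simplex_push_fix => l /zl[->|->].
  by have /(congr1 (fun w : W n.+1 => stage_end w t)) := zw; rewrite /= tz.
have kk i j (t : TT n.+1) s : set_val t 0 i = 0 -> set_val t 0 j = 0 -> k i (t, s) = k j (t, s).
  move=> ti tj; have [p0 /meet[z [zw zl]]] := sum1_support (proj1 (set_valP t)) ti tj.
  have tz : std_simplex_push z t = t.
    by apply: val_inj; apply: simplex_push_fix => l /zl[->|->].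
  by have /(congr1 (fun w : W n.+1 => stage_map w (t, s))) := zw; rewrite /= tz.
have k0 j (t : TT n.+1) s : set_val t 0 j = 0 -> s <= 0 -> k j (t, s) = y t.
  move=> tj s0; have [_ w0 _] := proj2_sig (w j); rewrite /k w0//.
  have tz : std_simplex_push (e j) t = t.
    apply: val_inj; apply: simplex_push_fix => l ll; have [->//|lj] := eqVneq l j.
    by case: ll; have [_ ->] := eP j => //; exact/eqP.
  have /(congr1 (fun f : continuousType (TT n.+1) X => f t)) := by_ _ (e j) (eh j).
  by rewrite /= !mkctsE /= tz.
have ka j (t : TT n.+1) s : set_val t 0 j = 0 -> stage n.+1 <= s ->
    k j (t, s) = r j (std_to_affine t).
  move=> tj ts; have [_ _ w1] := proj2_sig (w j); apply: w1; apply: le_trans ts.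
  by apply: stage_le; exact: supp_card_face tj.
have yc : continuous (y : TT n.+1 -> X) by exact: cts_fun.
have kc j : continuous (k j) by have [] := proj2_sig (w j).
have [K [g [Kc Kk gr K0 K1]]] :=
  oka_filling hX (stage_gt0 n) (@stage_lt n.+1 n.+2 (leqnn _)) yc kc rr kk k0 ka.
have KP : is_staged (K, g).
  split=> //= [t s s0|t s ts]; first by rewrite !K0.
  have [[j tj]|h] := pselect (exists j, set_val t 0 j = 0).
    rewrite (Kk j)// (gr j) ?std_to_affine_val ?tj//.
    by have [_ _ w1] := proj2_sig (w j); exact: w1.
  apply: K1; apply: le_trans ts; rewrite supp_card_full// => j tj.
  by apply: h; exists j.
exists (exist _ _ KP); split.
  by apply/continuousEP => t; rewrite /= mkctsE K0.
move=> m x hx; have [j xj] := hx; rewrite (bE _ _ _ j)//.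
apply: eq_exist.
have xt (K' : numFieldType) (t : 'rV[K']_m.+1) : simplex_push x t 0 j = 0.
  by rewrite mxE big1// => i /eqP /xj.
congr pair; first by apply/funext => -[t s] /=; apply: Kk; exact: xt.
by apply: holoMap_eqP => t /=; apply: gr; exact: xt.
Qed.

End StagedHomotopies.

(** The ends of the staged homotopies chosen by the section form the retraction; running them up to
    a time prescribed by a simplex of the interval gives the deformation. It is strong because the
    section is constant in time on [eX]. *)
Lemma oka_strong_deformation_retract (R : realType) (X : complexManifold R) :
  oka X -> strong_deformation_retract (affine_singular_inclusion X).
Proof.
move=> hX.
pose W := staged_homotopies X; pose S := singular_set R X.
pose cw m (x : affine_singular_set X m) : W m := exist _ _ (constant_staged x).
pose G0 m (y : S m) (w : W m) := exists2 x, y = smap (affine_singular_inclusion X) x & w = cw m x.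
have G0P : partial_section (staged_start X) G0.
  split=> [m y _ _ [x -> ->] [x' + ->]|m n th y w [x -> ->]|m _ _ [x -> ->]].
  - move=> /continuousEP xx'; congr cw; apply: holoMap_eq_of_std_simplex => t.
    exact: xx' t.
  - exists (sact th x); first by rewrite smap_natural.
    apply: eq_exist; congr pair; apply/funext => p /=; by rewrite std_to_affine_push.
  - exact/continuousEP.
have [s [s1 s2]] := section_extension (staged_lifting hX) G0P.
pose r := smap_comp (staged_finish X) s.
(* A simplex [th] of the interval defines an affine function on the standard simplex, the sum of the
   coordinates that [th] sends to 1; it serves as time. *)
have timec m (th : delta m 1) :
    continuous (fun t : std_simplex R m => set_val (std_simplex_push th t) 0 ord_max : R).
  move=> t.
  apply: (@continuous_comp _ _ _ (set_val \o @std_simplex_push R m 1 th)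
    (fun u : 'rV[R]_2 => u 0 ord_max)); last exact: coord_continuous.
  apply: continuous_comp; first exact: std_simplex_push_continuous.
  exact: initial_continuous.
have Hnat m n (th : delta m n) (p : simplicial_prod S (standard_simplex 1) n) :
   (mkcts (@staged_slice_continuous R X m (smap s (sact th p).1) _ (timec m (sact th p).2)) : S m) =
   sact th (mkcts (@staged_slice_continuous R X n (smap s p.1) _ (timec n p.2)) : S n).
  apply/continuousEP => t; rewrite /= mkctsE smap_natural /=.
  have E : std_simplex_push (p.2 \o th : delta m 1) t =
      std_simplex_push p.2 (std_simplex_push th t).
    by apply: val_inj; exact: simplex_push_comp.
  by rewrite -[LHS]/((proj1_sig (smap s p.1)).1
    (_, set_val (std_simplex_push (p.2 \o th : delta m 1) t) 0 ord_max)) E.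
exists r, (@SimplicialMap (simplicial_prod S (standard_simplex 1)) S
  (fun n p => mkcts (@staged_slice_continuous R X n (smap s p.1) _ (timec n p.2))) Hnat).
split=> [n x|n y|n y|n x th].
- by rewrite /r /= (s2 _ _ (cw n x))//; exists x.
- apply/continuousEP => t; rewrite /= mkctsE.
  have -> : set_val (std_simplex_push (cst ord0 : delta n 1) t) 0 ord_max = 0.
    by rewrite set_valE /= mxE big_pred0.
  by have /(congr1 (fun f : continuousType (std_simplex R n) X => f t)) := s1 n y.
- apply/continuousEP => t; rewrite /= !mkctsE.
  have -> : set_val (std_simplex_push (cst ord_max : delta n 1) t) 0 ord_max = 1.
    have [t1 _] := set_valP t.
    by rewrite set_valE /= mxE -[RHS]t1; apply: eq_bigl.
  have [_ _ w1] := proj2_sig (smap s y); apply: w1.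
  exact/ltW/stage_lt1.
- apply/continuousEP => t; rewrite /= mkctsE (s2 _ _ (cw n x))//; by exists x.
Qed.

Theorem theorem1 (R : realType) (X : complexManifold R) (hX : oka X) :
  homotopically_elliptic X /\
  strong_deformation_retract (affine_singular_inclusion X).
Proof.
have sdr := oka_strong_deformation_retract hX.
split=> //; split; first exact: kan_retract sdr (@singular_set_kan R X).
exact: weak_equivalence_retract.
Qed.
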